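(* Let $n\ge 1$. The following classes of subsets of $\mathcal L([n])$ all coincide: (a) the A-domains (Abello); (b) the GR-domains (Galambos and Reiner); (c) the inclusion-wise maximal distributive covering sublattices of the Bruhat lattice $(\mathcal L([n]),\ll)$ (Chameni-Nembua); (d) the inclusion-wise maximal peak-pit domains; (e) the Condorcet domains of tiling type.
   Context: Linear orders and Bruhat lattice. $[n]=\{1,\dots,n\}$; $\mathcal L([n])$ is the set of linear orders on $[n]$, a linear order $x_1<\dots<x_n$ being encoded by the word $x_1\dots x_n$ ($x_1$ least). $\alpha=12\dots n$, $\omega=n(n-1)\dots 1$. $Inv(\sigma)=\{(i,j): i<j,\ j<_\sigma i\}$. The weak Bruhat order is $\sigma\ll\tau\iff Inv(\sigma)\subseteq Inv(\tau)$; $(\mathcal L([n]),\ll)$ is known to be a lattice with minimum $\alpha$ and maximum $\omega$, in which $\tau$ covers $\sigma$ iff $Inv(\tau)$ is $Inv(\sigma)$ plus exactly one inversion. All domains (sets of linear orders regarded as Condorcet or peak-pit domains) considered contain both $\alpha$ and $\omega$. Castings and A-domains. For $i<j<k$ define four sets of linear orders on $\{i,j,k\}$: $\mathcal D_3(\cap)=\{ijk,ikj,kij,kji\}$, $\mathcal D_3(\cup)=\{ijk,jik,jki,kji\}$, $\mathcal D_3(\to)=\{ijk,jik,kij,kji\}$, $\mathcal D_3(\gets)=\{ijk,ikj,jki,kji\}$. A casting is a map $c$ from the set of triples $i<j<k$ in $[n]$ to $\{\cap,\cup,\to,\gets\}$, and $\mathcal D(c)$ is the set of $\sigma\in\mathcal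 L([n])$ whose restriction to each triple $i<j<k$ belongs to $\mathcal D_3(c(ijk))$. For a maximal chain $\mathcal C$ of the Bruhat lattice there is a unique casting $c$ with $\mathcal C\subseteq\mathcal D(c)$; put $\widehat{\mathcal C}=\mathcal D(c)$. The A-domains are the sets $\widehat{\mathcal C}$. GR-domains. Two maximal chains $\mathcal C,\mathcal C'$ are equivalent if $\widehat{\mathcal C}=\widehat{\mathcal C'}$ (equivalently, as Abello showed: regarding maximal chains as reduced decompositions of the longest permutation $\omega$ into standard transpositions $s_1,\dots,s_{n-1}$, one is obtained from the other by a sequence of replacements of fragments $s_is_j$ with $|i-j|>1$ by $s_js_i$). A GR-domain is the union of all maximal chains in one equivalence class. Covering sublattices. A sublattice $\mathcal D$ of the Bruhat lattice is covering if the cover relation in $\mathcal D$ is induced by the cover relation in the Bruhat lattice (whenever one element covers another within $\mathcal D$, it covers it in the Bruhat lattice). In (c), maximality is with respect to inclusion among distributive covering sublattices. Peak-pit domains. $\mathcal D\subseteq\mathcal L([n])$ is a peak-pit domain if for each triple $i<j<k$ the set of restrictions of its members to $\{i,j,k\}$ is contained in $\mathcal D_3(\cap)$ or in $\mathcal D_3(\cup)$ (or both). Tiling type. In the upper half-plane $\mathbb R\times\mathbb R_{>0}$ fix $n$ vectors $\xi_1,\dots,\xi_n$ of the same length and with distinct directions, going in this order clockwise around $(0,0)$. The zonogon is $Z_n=\{\sum_i a_i\xi_i: 0\le a_i\le 1\}$; its bottom vertex is $(0,0)$ and its top vertex is $\xi_1+\dots+\xi_n$. For $i<j$, an $ij$-tile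 is a translate of $[0,\xi_i]+[0,\xi_j]$. A rhombus tiling $T$ of $Z_n$ is a subdivision of $Z_n$ into tiles in which any two intersecting tiles meet in a single vertex or a single closed edge. $G_T$ is the directed graph of vertices and edges of the tiles, edges directed upward; an edge that is a translate of $[0,\xi_i]$ has color $i$. (For $n=1$, $Z_1=[0,\xi_1]$ and $G_T$ is a single edge.) A snake is a directed path in $G_T$ from the bottom to the top vertex; each snake is known to have exactly one edge of each color, so the colors along it from bottom to top form a linear order on $[n]$ (first color least). $\Sigma(T)$ is the set of linear orders so obtained, and a Condorcet domain of tiling type is a set of the form $\Sigma(T)$. *)

(* Defs.v *)
From HB Require Import structures.
From mathcomp Require Import all_boot all_order all_fingroup all_algebra.
From mathcomp Require Import boolp classical_sets cardinality reals.

Set Implicit Arguments.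
Unset Strict Implicit.
Unset Printing Implicit Defensive.

Import Order.TTheory GRing.Theory Num.Theory.

(* The ground set {1, ..., n} is 'I_n = {0, ..., n - 1}.  The linear order
   x_1 < ... < x_n is the permutation s with s k = x_(k+1), so that s^-1 x is
   the position of x. *)
Definition linord (n : nat) := {perm 'I_n}.
HB.instance Definition _ n := Finite.copy (linord n) {perm 'I_n}.

Section LinearOrders.
Variable n : nat.
Implicit Types (s t : linord n) (x y : 'I_n).

Definition word s : seq 'I_n := [seq s k | k <- enum 'I_n].

Definition before s x y : bool := ((s^-1)%g x < (s^-1)%g y)%N.

Definition Inv s : {set 'I_n * 'I_n} :=
  [set p : 'I_n * 'I_n | (p.1 < p.2)%N && before s p.2 p.1].

Definition alpha : linord n := 1%g.
Definition omega : linord n := perm (@rev_ord_inj n).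

Definition lebr s t : bool := Inv s \subset Inv t.

End LinearOrders.

Section BruhatLattice.
Variable n : nat.
Implicit Types (s t u : linord n) (x y z i j k : 'I_n) (r : rel 'I_n).

Lemma beforeN s x y : x != y -> before s y x = ~~ before s x y.
Proof.
by move=> xy; rewrite /before -leqNgt [RHS]leq_eqVlt val_eqE (inj_eq perm_inj) eq_sym
  (negbTE xy).
Qed.

Lemma ord_lt_neq x y : (x < y)%N -> x != y.
Proof. by move=> xy; rewrite -val_eqE neq_ltn xy. Qed.

Lemma before_irr s x : before s x x = false.
Proof. exact: ltnn. Qed.

Lemma before_trans s : transitive (before s).
Proof. by move=> y x z; apply: ltn_trans. Qed.

Lemma in_Inv s x y : ((x, y) \in Inv s) = (x < y)%N && before s y x.
Proof. by rewrite inE. Qed.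

Lemma card_before s x : #|[set y | before s y x]| = ((s^-1)%g x : nat).
Proof.
have -> : [set y | before s y x] = s @: [set i : 'I_n | (i < (s^-1)%g x)%N].
  apply/setP => y; rewrite inE; apply/idP/imsetP => [lt_yx|[i]].
    by exists ((s^-1)%g y); rewrite ?inE // permKV.
  by rewrite inE => lt_i ->; rewrite /before permK.
rewrite card_imset; last exact: perm_inj.
set k := (s^-1)%g x; have le_kn : (k <= n)%N by exact: ltnW.
have -> : [set i : 'I_n | (i < k)%N] = widen_ord le_kn @: [set: 'I_k].
  apply/setP => i; rewrite inE; apply/idP/imsetP => [ik|[j _ ->] /=].
    by exists (Ordinal ik); rewrite ?inE //; apply: val_inj.
  exact: ltn_ord.
rewrite card_imset ?cardsT ?card_ord // => a b /(congr1 val) /= ?.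
exact: val_inj.
Qed.

Lemma before_inj s t : before s =2 before t -> s = t.
Proof.
move=> st; apply: invg_inj; apply/permP => x; apply: val_inj => /=.
rewrite -[LHS]card_before -[RHS]card_before.
by apply: eq_card => y; rewrite !inE st.
Qed.

Lemma lebr_refl : reflexive (@lebr n).
Proof. by move=> s; apply: subxx. Qed.

Lemma lebr_trans : transitive (@lebr n).
Proof. by move=> t s u; apply: fintype.subset_trans. Qed.

Lemma lebr_anti : antisymmetric (@lebr n).
Proof.
move=> s t /andP[st ts].
have eqI : Inv s = Inv t by apply/eqP; rewrite finset.eqEsubset; apply/andP.
apply: before_inj => x y; have := congr1 (fun A : {set _} => (y, x) \in A) eqI.
have := congr1 (fun A : {set _} => (x, y) \in A) eqI.
rewrite !in_Inv; case: (ltngtP x y) => [xy|yx|/val_inj ->] //=.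
- by have ne := ord_lt_neq xy; rewrite !(@beforeN _ x y) // => /negb_inj.
- by rewrite !before_irr.
Qed.

Lemma size_sort_enum r : size (sort r (enum 'I_n)) = n.
Proof. by rewrite size_sort size_enum_ord. Qed.

Lemma rank_subproof r x : (index x (sort r (enum 'I_n)) < n)%N.
Proof. by rewrite -[ltnRHS](size_sort_enum r) index_mem mem_sort mem_enum. Qed.

Definition rank r x : 'I_n := Ordinal (rank_subproof r x).

Lemma rank_inj r : injective (rank r).
Proof.
move=> x y /(congr1 val) /= eq_xy.
have mem z : z \in sort r (enum 'I_n) by rewrite mem_sort mem_enum.
by rewrite -(nth_index x (mem x)) eq_xy nth_index.
Qed.

Definition linord_of r : linord n := (perm (@rank_inj r))^-1%g.

Lemma before_linord_of r x y : total r -> transitive r -> antisymmetric r ->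
  before (linord_of r) x y = (x != y) && r x y.
Proof.
move=> r_total r_trans r_anti.
have sorted_r := sort_sorted r_total (enum 'I_n).
have mem z : z \in sort r (enum 'I_n) by rewrite mem_sort mem_enum.
have r_refl z : r z z by have := r_total z z; rewrite orbb.
rewrite /before invgK !permE /=.
have [->|xy] := eqVneq x y; first by rewrite ltnn.
apply/idP/idP => [|/= rxy].
  by move/(sorted_ltn_index r_trans sorted_r _ _ (mem x) (mem y)).
rewrite ltnNge; apply/negP.
move/(sorted_leq_index r_trans r_refl sorted_r _ _ (mem y) (mem x)) => ryx.
by case/eqP: xy; apply: r_anti; rewrite rxy.
Qed.

(* The inversions of the join are the transitive closure of the union. *)
Definition inv2 s t : rel 'I_n :=
  fun i j => ((i, j) \in Inv s) || ((i, j) \in Inv t).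

Definition join_rel s t : rel 'I_n :=
  fun x y => if (x < y)%N then ~~ connect (inv2 s t) x y
             else connect (inv2 s t) y x.

Definition joinbr s t : linord n := linord_of (join_rel s t).
Definition revbr s : linord n := (omega n * s)%g.
Definition meetbr s t : linord n := revbr (joinbr (revbr s) (revbr t)).

Lemma inv2_lt s t i j : inv2 s t i j -> (i < j)%N.
Proof. by rewrite /inv2 !in_Inv => /orP[] /andP[]. Qed.

Lemma connect_inv2_le s t i j : connect (inv2 s t) i j -> (i <= j)%N.
Proof.
case/connectP => p; elim: p i => [|k p IH] i /= => [_ ->//|].
move=> /andP[/inv2_lt ik kp] ej; apply: leq_trans (ltnW ik) _.
exact: IH kp ej.
Qed.

Lemma inv_split s i j k : (i < j)%N -> (j < k)%N ->
  (i, k) \in Inv s -> ((i, j) \in Inv s) || ((j, k) \in Inv s).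
Proof.
move=> ij jk; rewrite !in_Inv ij jk /= => /andP[_ ki].
have [//|nji] := boolP (before s j i); apply: (before_trans ki).
by rewrite beforeN // eq_sym ord_lt_neq.
Qed.

Lemma connect_split s t i j k : (i < j)%N -> (j < k)%N ->
  connect (inv2 s t) i k ->
  connect (inv2 s t) i j || connect (inv2 s t) j k.
Proof.
move=> ij jk /connectP[p]; elim: p i ij => [|m p IH] i ij /=.
  by move=> _ eq_ki; move: ij jk; rewrite eq_ki => /ltn_trans h /h; rewrite ltnn.
move=> /andP[im mp] eq_k; have cmk : connect (inv2 s t) m k.
  by apply/connectP; exists p.
case: (ltngtP j m) => [jm|mj|/val_inj ->]; last by rewrite connect1.
- have : inv2 s t i j || inv2 s t j m.
    by case/orP: im => /(inv_split ij jm) /orP[] h; rewrite /inv2 h ?orbT.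
  case/orP => h; first by rewrite connect1.
  by rewrite (connect_trans (connect1 h) cmk) orbT.
- case/orP: (IH m mj mp eq_k) => h; last by rewrite h orbT.
  by rewrite (connect_trans (connect1 im) h).
Qed.

Lemma join_rel_total s t : total (join_rel s t).
Proof.
move=> x y; rewrite /join_rel.
by case: ltngtP => [_|_|/val_inj ->]; rewrite ?connect0 ?orNb ?orbN.
Qed.

Lemma join_rel_anti s t : antisymmetric (join_rel s t).
Proof.
move=> x y; rewrite /join_rel.
by case: ltngtP => [_|_|/val_inj ->] //; rewrite ?andbN ?andNb.
Qed.

Lemma join_rel_trans s t : transitive (join_rel s t).
Proof.
move=> y x z; rewrite /join_rel.
have cs := @connect_split s t.
have [xy|yx|/val_inj ->] := ltngtP x y; last by [].
- have [yz|zy|/val_inj <-] := ltngtP y z; last by rewrite xy.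
  + rewrite (ltn_trans xy yz) => nxy nyz; apply/negP => /(cs _ _ _ xy yz).
    by rewrite (negbTE nxy) (negbTE nyz).
  + move=> nxy czy; have [xz|zx|/val_inj ->] := ltngtP x z; last exact: connect0.
      by apply: contra nxy => cxz; apply: connect_trans cxz czy.
    by have := cs _ _ _ zx xy czy; rewrite (negbTE nxy) orbF.
- have [yz|zy|/val_inj <-] := ltngtP y z.
  + move=> cyx nyz; have [xz|zx|/val_inj ->] := ltngtP x z; last exact: connect0.
      by apply: contra nyz => cxz; apply: connect_trans cyx cxz.
    by have := cs _ _ _ yz zx cyx; rewrite (negbTE nyz).
  + move=> cyx czy; rewrite ltnNge (ltnW (ltn_trans zy yx)) /=.
    exact: connect_trans czy cyx.
  + by move=> cyx _; rewrite ltnNge (ltnW yx).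
Qed.

Lemma Inv_join s t i j :
  ((i, j) \in Inv (joinbr s t)) = (i < j)%N && connect (inv2 s t) i j.
Proof.
rewrite in_Inv; case: (ltnP i j) => //= ij.
rewrite /joinbr before_linord_of; first last.
- exact: join_rel_anti.
- exact: join_rel_trans.
- exact: join_rel_total.
by rewrite eq_sym ord_lt_neq //= /join_rel ltnNge (ltnW ij).
Qed.

Lemma Inv_trans s i j k :
  (i, j) \in Inv s -> (j, k) \in Inv s -> (i, k) \in Inv s.
Proof.
rewrite !in_Inv => /andP[ij ji] /andP[jk kj].
by rewrite (ltn_trans ij jk) (before_trans kj ji).
Qed.

Lemma joinbrP s t u : lebr (joinbr s t) u = lebr s u && lebr t u.
Proof.
apply/idP/andP => [le_u|[su tu]].
  by split; apply: fintype.subset_trans le_u; apply/fintype.subsetP => -[i j] h;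
    rewrite Inv_join connect1 ?andbT /inv2 ?h ?orbT //;
    move: h; rewrite in_Inv => /andP[].
apply/fintype.subsetP => -[i j]; rewrite Inv_join => /andP[ij /connectP[p]].
elim: p i ij => [|k p IH] i ij /=; first by move=> _ e; rewrite e ltnn in ij.
move=> /andP[ik kp] ej.
have iku : (i, k) \in Inv u.
  by case/orP: ik => h; [apply: (fintype.subsetP su)|apply: (fintype.subsetP tu)].
have : (k <= j)%N by apply: (@connect_inv2_le s t); apply/connectP; exists p.
rewrite leq_eqVlt => /orP[/eqP/val_inj <- //|kj].
exact: Inv_trans iku (IH k kj kp ej).
Qed.

Lemma before_rev s x y : before (revbr s) x y = before s y x.
Proof.
have rev_pos z : ((revbr s)^-1)%g z = rev_ord ((s^-1)%g z).
  apply: (@perm_inj _ (revbr s)); rewrite permKV permM permE rev_ordK.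
  by rewrite permKV.
by rewrite /before !rev_pos /= ltn_sub2lE // ltnS.
Qed.

Lemma revbrK : involutive revbr.
Proof. by move=> s; apply: before_inj => x y; rewrite !before_rev. Qed.

Lemma lebr_rev s t : lebr (revbr s) (revbr t) = lebr t s.
Proof.
suff imp u v : lebr v u -> lebr (revbr u) (revbr v).
  by apply/idP/idP => [/imp|/imp //]; rewrite !revbrK.
move=> /fintype.subsetP vu; apply/fintype.subsetP => -[i j]; rewrite !in_Inv !before_rev.
move=> /andP[ij uij]; rewrite ij /=; have ne := ord_lt_neq ij.
rewrite -[before v i j]negbK -beforeN //; apply: contraL uij => vji.
by rewrite -beforeN //; have := vu (i, j); rewrite !in_Inv ij /=; apply.
Qed.

Lemma meetbrP s t u : lebr s (meetbr t u) = lebr s t && lebr s u.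
Proof. by rewrite -{1}[s]revbrK lebr_rev joinbrP !lebr_rev. Qed.

End BruhatLattice.

Fact bruhat_display : Order.disp_t.
Proof. exact: Order.Disp tt tt. Qed.

HB.instance Definition _ n := Order.Le_isPOrder.Build bruhat_display (linord n)
  (@lebr_refl n) (@lebr_anti n) (@lebr_trans n).
HB.instance Definition _ n := Order.POrder_MeetJoin_isLattice.Build
  bruhat_display (linord n) (@meetbrP n) (@joinbrP n).

Section Domains.
Variable n : nat.
Implicit Types (s t : linord n) (C D X : {set linord n}).
Local Open Scope order_scope.

Definition inclusion_maximal (P : {set linord n} -> Prop) D : Prop :=
  P D /\ forall D', P D' -> D \subset D' -> D' = D.

Definition triple := {q : 'I_n * 'I_n * 'I_n | (q.1.1 < q.1.2 < q.2)%N}.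

Definition restriction s (q : triple) : seq 'I_n :=
  let: (i, j, k) := val q in [seq x <- word s | x \in [:: i; j; k]].

Inductive castval := Cap | Cup | Rightarrow | Leftarrow.

Definition D3 (v : castval) (q : triple) : seq (seq 'I_n) :=
  let: (i, j, k) := val q in
  match v with
  | Cap => [:: [:: i; j; k]; [:: i; k; j]; [:: k; i; j]; [:: k; j; i]]
  | Cup => [:: [:: i; j; k]; [:: j; i; k]; [:: j; k; i]; [:: k; j; i]]
  | Rightarrow => [:: [:: i; j; k]; [:: j; i; k]; [:: k; i; j]; [:: k; j; i]]
  | Leftarrow => [:: [:: i; j; k]; [:: i; k; j]; [:: j; k; i]; [:: k; j; i]]
  end.

Definition casting := triple -> castval.

Definition casting_domain (c : casting) : {set linord n} :=
  [set s | [forall q : triple, restriction s q \in D3 (c q) q]].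

Definition chain C : Prop := {in C &, forall s t, s >=< t}.

Definition maximal_chain C : Prop := inclusion_maximal chain C.

(* [hat C X]: X is the domain of the casting c with C \subset casting_domain c.
   Such a c exists and is unique when C is a maximal chain, and then this is
   the graph of the hat operation. *)
Definition hat C X : Prop :=
  exists2 c : casting, C \subset casting_domain c & X = casting_domain c.

Definition A_domain X : Prop := exists2 C, maximal_chain C & hat C X.

Definition chain_equiv C C' : Prop := exists2 X, hat C X & hat C' X.

Definition GR_domain X : Prop :=
  exists2 C, maximal_chain C &
    forall s, s \in X <->
      exists C', [/\ maximal_chain C', chain_equiv C C' & s \in C'].

Definition covers_in D s t : Prop :=
  [/\ s \in D, t \in D, s < t & forall u, u \in D -> ~~ (s < u < t)].

Definition sublattice D : Prop := meet_closed D /\ join_closed D.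

Definition distributive_in D : Prop :=
  {in D & &, forall s t u, s `&` (t `|` u) = (s `&` t) `|` (s `&` u)}.

Definition covering D : Prop :=
  forall s t, covers_in D s t -> covers_in [set: linord n] s t.

Definition distributive_covering_sublattice D : Prop :=
  [/\ sublattice D, distributive_in D & covering D].

(* Domains are assumed to contain both alpha and omega. *)
Definition peak_pit D : Prop :=
  [/\ alpha n \in D, omega n \in D &
    forall q : triple,
      {in D, forall s, restriction s q \in D3 Cap q} \/
      {in D, forall s, restriction s q \in D3 Cup q}].

End Domains.

Section Tilings.
Variables (R : realType) (n : nat) (xi : 'I_n -> 'rV[R]_2).
Local Open Scope ring_scope.
Local Open Scope classical_set_scope.
Implicit Types (u v p : 'rV[R]_2) (k : 'I_n).

Definition abscissa v : R := v ord0 ord0.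
Definition ordinate v : R := v ord0 ord_max.

(* For vectors of the open upper half-plane, the negative determinant says that
   xi j is obtained from xi i by a clockwise rotation of angle in ]0, pi[;
   in particular the directions are distinct. *)
Definition zonogon_vectors : Prop :=
  [/\ forall i, 0 < ordinate (xi i),
      forall i j, abscissa (xi i) ^+ 2 + ordinate (xi i) ^+ 2 =
                  abscissa (xi j) ^+ 2 + ordinate (xi j) ^+ 2 &
      forall i j : 'I_n, (i < j)%N ->
        abscissa (xi i) * ordinate (xi j) - ordinate (xi i) * abscissa (xi j)
          < 0].

Definition zonogon : set 'rV[R]_2 :=
  [set p | exists2 a : 'I_n -> R,
     forall i, 0 <= a i <= 1 & p = \sum_i a i *: xi i].

Definition top_vertex : 'rV[R]_2 := \sum_i xi i.

(* The translate of [0, xi i] + [0, xi j] by its bottom vertex. *)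
Record tile := Tile {
  tile_bottom : 'rV[R]_2;
  tile_i : 'I_n;
  tile_j : 'I_n;
  tile_lt : (tile_i < tile_j)%N }.

Definition tile_points (t : tile) : set 'rV[R]_2 :=
  [set p | exists a b : R, [/\ 0 <= a <= 1, 0 <= b <= 1 &
     p = tile_bottom t + a *: xi (tile_i t) + b *: xi (tile_j t)]].

Definition tile_vertex (t : tile) v : Prop :=
  v \in [:: tile_bottom t;
            tile_bottom t + xi (tile_i t);
            tile_bottom t + xi (tile_j t);
            tile_bottom t + xi (tile_i t) + xi (tile_j t)].

(* The upward edge of color k from v to v + xi k is encoded by (v, k). *)
Definition edge_points v k : set 'rV[R]_2 :=
  [set p | exists2 a : R, 0 <= a <= 1 & p = v + a *: xi k].

Definition tile_edge (t : tile) v k : Prop :=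
  (v, k) \in [:: (tile_bottom t, tile_i t);
                 (tile_bottom t, tile_j t);
                 (tile_bottom t + xi (tile_i t), tile_j t);
                 (tile_bottom t + xi (tile_j t), tile_i t)].

(* Disjointness of interiors follows from the last clause.  For n = 1 the
   zonogon is a segment and T is necessarily empty, hence the guard 1 < n. *)
Definition rhombus_tiling (T : set tile) : Prop :=
  [/\ finite_set T,
      (1 < n)%N -> \bigcup_(t in T) tile_points t = zonogon &
      forall t t', T t -> T t' -> t <> t' ->
        let I := tile_points t `&` tile_points t' in
        [\/ I = set0,
            exists v, [/\ tile_vertex t v, tile_vertex t' v & I = [set v]] |
            exists v k, [/\ tile_edge t v k, tile_edge t' v k &
                            I = edge_points v k]]].

(* The second disjunct is the single edge of the graph when n = 1. *)
Definition graph_edge (T : set tile) v k : Prop :=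
  (exists2 t, T t & tile_edge t v k) \/ (n = 1%N /\ v = 0).

(* A directed path is determined by its origin and its sequence of colors. *)
Fixpoint directed_path (T : set tile) u (w : seq 'I_n) v : Prop :=
  match w with
  | [::] => u = v
  | k :: w' => graph_edge T u k /\ directed_path T (u + xi k) w' v
  end.

Definition snake (T : set tile) (w : seq 'I_n) : Prop :=
  directed_path T 0 w top_vertex.

Definition tiling_type (X : {set linord n}) : Prop :=
  exists2 T, rhombus_tiling T & forall s, s \in X <-> snake T (word s).

End Tilings.

(* Main.v *)
Require Import Defs.
From HB Require Import structures.
From mathcomp Require Import all_boot all_order all_fingroup all_algebra.
From mathcomp Require Import boolp classical_sets reals.
From mathcomp Require Import cardinality finset zify ring lra.

(** Write a linear order as its set of inversions. On a triple [i < j < k] a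
    maximal chain of the weak order inverts [(i, k)] second, after exactly one
    of [(i, j)] and [(j, k)]; recording which of the two comes first is a
    casting with values cup and cap only, encoded below as a boolean function
    [u], and [cdom u] is its domain. Call [u] realizable when it comes from a
    maximal chain, or equivalently from a schedule, that is, a numbering of
    the pairs which is lexicographic on the cup triples and reverse
    lexicographic on the cap triples. Each of the five classes is shown to
    consist of the sets [cdom u] with [u] realizable ([realized]).

    The inversion sets of the members of [cdom u] are the down-sets of the
    relation that [u] prescribes on the pairs of each triple ([dom_ideal]).
    Two consequences drive the combinatorial part. Unions and intersections of
    inversion sets stay in the domain, and they are joins and meets; and between
    two comparable members one can always add the missing inversion that is
    scheduled first ([dom_succ]). So every member lies on a maximal chain inside
    the domain, which identifies the A-domains with the GR-domains, and
    [cdom u] is a distributive covering sublattice.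

    Conversely, in a distributive covering sublattice diamonds transport the
    inversion added by a cover, so that joins and meets are again unions and
    intersections ([dcs_closed]); a member violating the casting of a maximal
    chain of the sublattice would then produce a union or an intersection that
    is not an inversion set ([closed_sub_cup]).

    The main combinatorial step is that every peak-pit domain is contained in a
    realizable domain ([pp_in_realized]). It goes by inserting the elements of
    the ground set one after the other. If the domain is already handled below
    [w], the positions of [w] in its members force some pairs below [w] to be
    inverted before [w] passes and forbid it for others; one needs a member of
    the realizable domain below [w] that complies ([separating_path]), and [w]
    then travels along this order. Since down-sets are closed under unions and
    intersections, it suffices to treat two members at a time ([separator]), and
    this reduces to joining two nested initial sets by one order of the domain
    ([common_path]), a consequence of the strong separation of initial sets.

    For the tilings, the key fact is that a nontrivial linear dependency between
    the vectors changes sign at least twice ([no_alternation]), whereas initial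
    sets of members of [cdom u] never alternate. So on the two-dimensional faces
    of the unit cube that correspond to the flips of [u], the linear map from
    the cube onto the zonogon is injective ([tame_inj]): their images are tiles
    that meet face to face, and the paths in the tiling are the members of
    [cdom u] ([path_cdom]). The tiles cover the zonogon because the paths of a
    maximal chain sweep it from left to right ([left_of_covered]). Conversely, an
    arbitrary tiling is swept by flips from the left to the right boundary: as
    long as the path is not the right boundary, two consecutive edges of it are
    the left edges of one tile ([sweep_flip]). The resulting maximal chain yields
    a casting whose tiles all belong to the tiling, and since they cover the
    zonogon there are no others ([tiling_casting]). *)

Set Implicit Arguments.
Unset Strict Implicit.
Unset Printing Implicit Defensive.
Import Order.TTheory GRing.Theory Num.Theory.

(** * Linear orders and inversion sets *)

Section Inversions.
Variable n : nat.
Implicit Types (s t r : linord n) (i j k x y z : 'I_n).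
Implicit Types (I : {set 'I_n * 'I_n}).

Lemma before_asym s x y : before s x y -> before s y x = false.
Proof. by rewrite /before => xy; rewrite ltnNge (ltnW xy). Qed.

Lemma before_neq s x y : before s x y -> x != y.
Proof. by apply: contraTneq => ->; rewrite before_irr. Qed.

Lemma Inv_lt s x y : (x, y) \in Inv s -> x < y.
Proof. by rewrite in_Inv => /andP[]. Qed.

Lemma before_Inv s x y : x < y -> before s y x = ((x, y) \in Inv s).
Proof. by move=> xy; rewrite in_Inv xy. Qed.

Lemma before_nInv s x y : x < y -> before s x y = ((x, y) \notin Inv s).
Proof.
by move=> xy; rewrite in_Inv xy /= (@beforeN _ s x y) ?negbK // ord_lt_neq.
Qed.

Lemma Inv_inj : injective (@Inv n).
Proof. by move=> s t e; apply: lebr_anti; rewrite /lebr e subxx. Qed.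

Lemma before_alpha x y : before (alpha n) x y = (x < y).
Proof. by rewrite /before /alpha invg1 !perm1. Qed.

Lemma before_omega x y : before (omega n) x y = (y < x).
Proof.
have -> : omega n = revbr (alpha n) by rewrite /revbr /alpha mulg1.
by rewrite before_rev before_alpha.
Qed.

Lemma Inv_alpha : Inv (alpha n) = finset.set0.
Proof.
by apply/setP => -[x y]; rewrite in_Inv before_alpha inE; apply/negP; lia.
Qed.

Lemma in_Inv_omega x y : ((x, y) \in Inv (omega n)) = (x < y).
Proof. by rewrite in_Inv before_omega andbb. Qed.

Lemma lebrP s t :
  reflect (forall x y, (x, y) \in Inv s -> (x, y) \in Inv t) (lebr s t).
Proof.
apply: (iffP (fintype.subsetP)) => [st x y|st [x y]]; exact: st.
Qed.

Lemma lebr_alpha s : lebr (alpha n) s.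
Proof. by rewrite /lebr Inv_alpha finset.sub0set. Qed.

Lemma lebr_omega s : lebr s (omega n).
Proof. by apply/lebrP => x y /Inv_lt; rewrite in_Inv_omega. Qed.

Lemma lebr_card s t : lebr s t -> s <> t -> #|Inv s| < #|Inv t|.
Proof.
move=> st ne; apply: proper_card; rewrite finset.properEneq; apply/andP; split=> //.
by apply/eqP => /Inv_inj.
Qed.

Lemma Inv_cotrans s i j k : i < j -> j < k ->
  (i, k) \in Inv s -> (i, j) \in Inv s \/ (j, k) \in Inv s.
Proof. by move=> ij jk ik; apply/orP; apply: inv_split ik. Qed.

(** Inversion sets are the sets of increasing pairs that are transitive and
    whose complement is transitive. *)
Definition biconvex I : Prop :=
  (forall x y, (x, y) \in I -> x < y) /\
  forall i j k, i < j -> j < k ->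
    ((i, j) \in I -> (j, k) \in I -> (i, k) \in I) /\
    ((i, k) \in I -> (i, j) \in I \/ (j, k) \in I).

Lemma biconvex_Inv I : biconvex I -> exists s, Inv s = I.
Proof.
move=> [Ilt Ibc].
pose r : rel 'I_n := fun x y =>
  if x < y then (x, y) \notin I else (x == y) || ((y, x) \in I).
have r_total : total r.
  move=> x y; rewrite /r; case: (ltngtP x y) => [_|_|/val_inj ->].
  - by case: (_ \in I); rewrite ?orbT.
  - by case: (_ \in I); rewrite ?orbT.
  - by rewrite eqxx.
have r_anti : antisymmetric r.
  move=> x y; rewrite /r; case: (ltngtP x y) => [xy|yx|/val_inj ->] //.
  - by rewrite (gtn_eqF xy : (y == x) = false) andNb.
  - by rewrite (gtn_eqF yx : (x == y) = false) andbN.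
have rL x y : x < y -> r x y = ((x, y) \notin I) by rewrite /r => ->.
have rG x y : y < x -> r x y = ((y, x) \in I).
  by move=> yx; rewrite /r ltnNge (ltnW yx) /= -val_eqE (gtn_eqF yx).
have r_trans : transitive r.
  move=> y x z; case: (ltngtP x y) => [xy|yx|/val_inj -> //];
  case: (ltngtP y z) => [yz|zy|/val_inj <- //];
  case: (ltngtP x z) => [xz|zx|/val_inj <-]; try lia;
    try (by move=> _ _; rewrite /r ltnn eqxx);
    rewrite ?(rL _ _ xy) ?(rL _ _ yz) ?(rL _ _ xz) ?(rG _ _ zx) => h1 h2.
  - apply/negP => h; case: (Ibc _ _ _ xy yz) => _ /(_ h).
    by case=> h'; [rewrite h' in h1|rewrite h' in h2].
  - apply/negP => h; rewrite (rG _ _ zy) in h2.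
    by case: (Ibc _ _ _ xz zy) => /(_ h h2); rewrite (negbTE h1).
  - rewrite (rG _ _ zy) in h2; case: (Ibc _ _ _ zx xy) => _ /(_ h2) [] //.
    by rewrite (negbTE h1).
  - apply/negP => h; rewrite (rG _ _ yx) in h1.
    by case: (Ibc _ _ _ yx xz) => /(_ h1 h); rewrite (negbTE h2).
  - rewrite (rG _ _ yx) in h1; case: (Ibc _ _ _ yz zx) => _ /(_ h1) [] //.
    by rewrite (negbTE h2).
  - rewrite (rG _ _ yx) in h1; rewrite (rG _ _ zy) in h2.
    exact: (proj1 (Ibc _ _ _ zy yx)) h2 h1.
exists (linord_of r); apply/setP => -[x y]; rewrite in_Inv.
rewrite before_linord_of //; case: (boolP (x < y)) => xy /=; last first.
  by apply/esym/negbTE; apply: contra xy => /Ilt.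
by rewrite /r ltnNge (ltnW xy) /= -!val_eqE (gtn_eqF xy).
Qed.

(** The cover relation of the weak order, labelled by the added inversion. *)
Definition flip s t x y : Prop :=
  [/\ x < y, (x, y) \notin Inv s & Inv t = (x, y) |: Inv s].

Lemma flip_le s t x y : flip s t x y -> lebr s t.
Proof. by case=> _ _ e; rewrite /lebr e finset.subsetUr. Qed.

Lemma flip_card s t x y : flip s t x y -> #|Inv t| = #|Inv s|.+1.
Proof. by case=> _ ns e; rewrite e cardsU1 ns. Qed.

Lemma flip_in s t x y : flip s t x y -> (x, y) \in Inv t.
Proof. by case=> _ _ ->; rewrite !inE eqxx. Qed.

Lemma flip_before s t x y a b : flip s t x y -> (a, b) <> (x, y) ->
  (a, b) <> (y, x) -> before t a b = before s a b.
Proof.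
case=> xy nin e ne1 ne2; case: (ltngtP a b) => [ab|ba|/val_inj ->].
- rewrite !before_nInv // e !inE; case: eqP => //.
- rewrite !before_Inv // e !inE; case: eqP => // -[ea eb].
  by case: ne2; rewrite ea eb.
- by rewrite !before_irr.
Qed.

Lemma flip_before_s s t x y : flip s t x y -> before s x y.
Proof. by case=> xy nin _; rewrite before_nInv. Qed.

Lemma flip_before_t s t x y : flip s t x y -> before t y x.
Proof. by move=> f; case: (f) => xy _ _; rewrite before_Inv // (flip_in f). Qed.

Lemma flip_other s t x y z w : flip s t x y -> z != x -> z != y ->
  before t z w = before s z w /\ before t w z = before s w z.
Proof.
move=> f /eqP zx /eqP zy; split; apply: (flip_before f).
- by move=> /(congr1 fst)/zx.
- by move=> /(congr1 fst)/zy.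
- by move=> /(congr1 snd)/zy.
- by move=> /(congr1 snd)/zx.
Qed.

(** The two exchanged elements are neighbours: an element between them would be
    after [x] and before [y] in both orders, but [y] precedes [x] in [t]. *)
Lemma flip_adj s t x y z : flip s t x y -> z != x -> z != y ->
  before s z x = before s z y.
Proof.
move=> f zx zy; have sxy := flip_before_s f; have tyx := flip_before_t f.
have [e1 _] := flip_other x f zx zy; have [e2 _] := flip_other y f zx zy.
apply/idP/idP => h; first exact: before_trans h sxy.
by rewrite -e1; apply: before_trans tyx; rewrite e2.
Qed.

(** Adding the pair of two neighbours to a biconvex set preserves biconvexity:
    a third element sees both of them on the same side. *)
Lemma flip_adjacent s x y : x < y -> before s x y ->
  (forall z, ~ (before s x z /\ before s z y)) -> exists t, flip s t x y.
Proof.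
move=> xy sxy adj; have nin : (x, y) \notin Inv s by rewrite -before_nInv.
have [|t tI] := @biconvex_Inv ((x, y) |: Inv s); last by exists t; split.
have nz z : z != x -> z != y -> before s z x = before s z y.
  move=> zx zy; apply/idP/idP => [h|h]; first exact: before_trans h sxy.
  apply: contraT => h'; case: (adj z); split=> //.
  by rewrite (@beforeN _ s z x) // eq_sym.
split=> [a b|i j k ij jk].
  by rewrite !inE => /orP[/eqP[-> ->] //|/andP[]].
rewrite !in_setU1; split.
- case/orP=> [/eqP[-> ->]|hij] /orP[/eqP[e1 e2]|hjk].
  + by rewrite e1 ltnn in xy.
  + have ky : y < k := Inv_lt hjk.
    rewrite -!before_Inv // in hjk *; last by lia.
    by rewrite [before _ k x]nz ?hjk ?orbT // -val_eqE /=; lia.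
  + subst; have ix : i < x := Inv_lt hij.
    have xi : before s x i by rewrite before_Inv.
    apply/orP; right; rewrite -before_Inv; last by lia.
    rewrite (@beforeN _ s i y); last by rewrite -val_eqE /=; lia.
    have [ix' iy'] : i != x /\ i != y by rewrite -!val_eqE /=; lia.
    by rewrite -(nz i ix' iy') (before_asym xi).
  + by rewrite (Inv_trans hij hjk) orbT.
- case/orP=> [/eqP[ei ek]|hik].
  + rewrite ei ek in ij jk *.
    have [jx jy] : j != x /\ j != y by rewrite -!val_eqE /=; lia.
    rewrite -!(before_Inv s) //; case: (boolP (before s j x)) => h; first by rewrite orbT; left.
    by right; rewrite (@beforeN _ s j y) // -nz // h orbT.
  + by case: (Inv_cotrans ij jk hik) => ->; rewrite orbT; [left|right].
Qed.

(** Among the inversions of [t] missing in [s], one whose two elements are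
    closest in [s] is a pair of neighbours of [s]. *)
Lemma bruhat_succ s t : lebr s t -> s <> t ->
  exists r x y, flip s r x y /\ lebr r t.
Proof.
move=> st neq; have /fintype.subsetPn[q0 q0t q0s] : ~~ (Inv t \subset Inv s).
  by apply: contra_notN neq => ts; apply: lebr_anti; rewrite /lebr ts andbT.
pose P (q : 'I_n * 'I_n) := (q \in Inv t) && (q \notin Inv s).
have P0 : P q0 by rewrite /P q0t.
pose d (q : 'I_n * 'I_n) := ((s^-1)%g q.2 - (s^-1)%g q.1)%N.
case: (arg_minnP d P0) => -[x y] /andP[/= xyt xys] dmin.
have xy := Inv_lt xyt; have sxy : before s x y by rewrite before_nInv.
have tI := lebrP _ _ st.
have [r f] : exists r, flip s r x y; last first.
  exists r, x, y; split=> //; apply/lebrP => a b; case: f => _ _ ->.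
  by rewrite in_setU1 => /orP[/eqP[-> ->] //|/tI].
apply: flip_adjacent => // z [sxz szy].
have nx : ~~ P (x, z).
  by apply/negP => /dmin; rewrite /d /=; move: sxz szy; rewrite /before; lia.
have ny : ~~ P (z, y).
  by apply/negP => /dmin; rewrite /d /=; move: sxz szy; rewrite /before; lia.
move: nx ny; rewrite /P.
case: (ltngtP z x) => [zx|xz|/val_inj zx]; last by rewrite zx before_irr in sxz.
- have zxs : (z, x) \in Inv s by rewrite -before_Inv.
  have zy := ltn_trans zx xy.
  by rewrite (Inv_trans (tI _ _ zxs) xyt) -(before_nInv s zy) szy.
- case: (ltngtP z y) => [zy|yz|/val_inj zy]; last by rewrite zy before_irr in szy.
  + rewrite -(before_nInv s xz) -(before_nInv s zy) sxz szy !andbT => /negbTE a /negbTE b.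
    by case: (Inv_cotrans xz zy xyt); rewrite ?a ?b.
  + have yzs : (y, z) \in Inv s by rewrite -before_Inv.
    by rewrite (Inv_trans xyt (tI _ _ yzs)) -(before_nInv s xz) sxz.
Qed.

(** * Flags: the maximal chains *)

(** A flag climbs from [alpha] to [omega] by flips; the relation [R] records
    additional information on its steps. *)
Definition flag (R : linord n -> linord n -> 'I_n -> 'I_n -> Prop)
    (C : {set linord n}) : Prop :=
  [/\ alpha n \in C, omega n \in C, {in C &, forall s t, lebr s t || lebr t s} &
      {in C, forall s, s <> omega n ->
         exists t x y, [/\ t \in C, flip s t x y & R s t x y]}].

Definition plain s t x y : Prop := True.

(** Following the rule upwards, by induction on the number of missing
    inversions. *)
Lemma climb (P : linord n -> Prop) R :
  (forall s, P s -> s <> omega n ->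
     exists t x y, [/\ P t, flip s t x y & R s t x y]) ->
  P (alpha n) ->
  exists2 C, flag R C & {in C, forall s, P s}.
Proof.
move=> up; suff main d s : (#|Inv (omega n)| - #|Inv s| <= d)%N -> P s ->
  exists C : {set linord n}, [/\ s \in C, omega n \in C, {in C, forall t, lebr s t},
     {in C &, forall s t, lebr s t || lebr t s} &
     {in C, forall t, P t /\ (t <> omega n ->
         exists r x y, [/\ r \in C, flip t r x y & R t r x y])}].
  move=> Pa; have [C [aC oC _ ch CP]] := main _ _ (leqnn _) Pa.
  exists C; last by move=> s /CP[].
  by split=> // s /CP[_ h]; apply: h.
have base r : P r -> r = omega n -> exists C : {set linord n},
  [/\ r \in C, omega n \in C, {in C, forall t, lebr r t},
     {in C &, forall s t, lebr s t || lebr t s} &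
     {in C, forall t, P t /\ (t <> omega n ->
         exists r x y, [/\ r \in C, flip t r x y & R t r x y])}].
  move=> Pr ro; exists (finset.set1 r); split.
  - by rewrite inE.
  - by rewrite ro inE.
  - by move=> t; rewrite inE => /eqP->; apply: lebr_refl.
  - by move=> a b; rewrite !inE => /eqP-> /eqP->; rewrite lebr_refl.
  - by move=> t; rewrite inE => /eqP->; split=> // /(_ ro).
elim: d s => [|d IH] s sd Ps.
all: have [so|/eqP so] := eqVneq s (omega n); first exact: base.
  case: so; apply: Inv_inj; apply/eqP; rewrite eqEcard (lebr_omega s : is_true (_ \subset _)).
  by rewrite -subn_eq0 -leqn0.
have [t [x [y [Pt f Rt]]]] := up s Ps so.
have [|C [tC oC Cge ch CP]] := IH t _ Pt; first by rewrite (flip_card f); lia.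
have st := flip_le f.
exists (s |: C); split.
- by rewrite setU11.
- by rewrite inE oC orbT.
- move=> r; rewrite inE => /orP[|rC]; first by rewrite inE => /eqP->; apply: lebr_refl.
  exact: lebr_trans st (Cge r rC).
- move=> a b; rewrite !in_setU1 => /orP[/eqP->|aC] /orP[/eqP->|bC].
  + by rewrite lebr_refl.
  + by rewrite (lebr_trans st (Cge b bC)).
  + by rewrite (lebr_trans st (Cge a aC)) orbT.
  + exact: ch.
- move=> r; rewrite in_setU1 => /orP[/eqP->|rC].
    by split=> // _; exists t, x, y; rewrite in_setU1 tC orbT.
  have [Pr h] := CP r rC; split=> // ro; have [a [b [c [aC fa Ra]]]] := h ro.
  by exists a, b, c; rewrite in_setU1 aC orbT.
Qed.

(** The longest member of the flag in which the pair is not inverted has a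
    successor, which can only add this pair. *)
Lemma flag_step R C x y : flag R C -> x < y ->
  exists s t, [/\ s \in C, t \in C, flip s t x y & R s t x y].
Proof.
case=> aC oC ch st xy.
pose P s := (s \in C) && ((x, y) \notin Inv s).
have P0 : P (alpha n) by rewrite /P aC Inv_alpha inE.
case: (arg_maxnP (fun s => #|Inv s|) P0) => s /andP[sC sxy] smax.
have so : s <> omega n by move=> e; rewrite e in_Inv_omega xy in sxy.
have [t [a [b [tC f Rt]]]] := st s sC so; exists s, t.
have [[-> ->] //|ne] := eqVneq (x, y) (a, b).
have /smax : P t.
  by case: f => _ _ e; rewrite /P tC e in_setU1 (negbTE ne).
by rewrite (flip_card f); lia.
Qed.

(** An order comparable to the whole flag is squeezed between the largest
    member below it and the successor of this member. *)
Lemma flag_maximal C : flag plain C -> maximal_chain C.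
Proof.
case=> aC oC ch st; split=> [s t sC tC|C' ch' CC']; first exact: ch.
apply/eqP; rewrite finset.eqEsubset CC' andbT; apply/fintype.subsetP => s sC'.
pose P t := (t \in C) && lebr t s.
have P0 : P (alpha n) by rewrite /P aC lebr_alpha.
case: (arg_maxnP (fun s => #|Inv s|) P0) => t /andP[tC ts] tmax.
have [<- //|/eqP ne] := eqVneq t s.
have to : t <> omega n.
  move=> e; case: ne; apply: lebr_anti; rewrite ts e; exact: lebr_omega.
have [r [x [y [rC f _]]]] := st t tC to.
have nrs : ~~ lebr r s.
  apply/negP => rs; have := tmax r; rewrite /P rC rs (flip_card f) => /(_ isT).
  by rewrite /= ltnn.
have sr : lebr s r.
  case/orP: (ch' _ _ sC' (fintype.subsetP CC' _ rC)) => [//|h].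
  by case/negP: nrs.
have lt := lebr_card ts ne.
have e : Inv s == Inv r by rewrite eqEcard (flip_card f); apply/andP; split=> //; exact: sr.
by rewrite (Inv_inj (eqP e)).
Qed.

(** The shortest order of [D] strictly above a given one covers it in [D],
    hence in the weak order, where covers are flips. *)
Lemma covering_flag (D : {set linord n}) : alpha n \in D -> omega n \in D -> covering D ->
  exists2 C, flag plain C & C \subset D.
Proof.
move=> aD oD cov.
have [|C fC CD] := @climb (fun s => s \in D) plain _ aD; last first.
  by exists C => //; apply/fintype.subsetP.
move=> s sD so.
pose P t := [&& t \in D, lebr s t & t != s].
have P0 : P (omega n).
  by rewrite /P oD lebr_omega /=; apply/eqP => e; case: so.
case: (arg_minnP (fun s => #|Inv s|) P0) => t /and3P[tD st /eqP ts] tmin.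
have [|_ _ _ cst] := cov s t.
  split=> //; first by rewrite lt_neqAle (st : (s <= t)%O) andbT; apply/eqP => e; case: ts.
  move=> r rD; apply/negP => /andP[].
  rewrite !lt_neqAle => /andP[sr1 sr] /andP[rt1 rt].
  have /tmin : P r by apply/and3P; split; [|exact: sr|rewrite eq_sym].
  by rewrite leqNgt (lebr_card (rt : lebr r t)) //; apply/eqP.
have [|r [x [y [f rt]]]] := bruhat_succ st; first by move=> e; case: ts.
suff e : r = t by subst r; exists t, x, y.
apply/eqP; apply: contraT => nrt.
case: (negP (cst r (in_setT _))); rewrite !lt_neqAle nrt (rt : (r <= t)%O).
rewrite (flip_le f : (s <= r)%O) /= !andbT; apply/eqP => e.
by have := flip_card f; rewrite e; lia.
Qed.
End Inversions.

(** * Domains of peak-pit castings *)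

Section PeakPitCastings.
Variable n : nat.
Implicit Types (s t r : linord n) (i j k x y z : 'I_n).
Implicit Types (I : {set 'I_n * 'I_n}) (u : 'I_n -> 'I_n -> 'I_n -> bool).

(** The sets attached to a triple by cup and cap: the middle element is never
    last, respectively never first. *)
Definition notlast s i j k : bool := before s j i || before s j k.
Definition notfirst s i j k : bool := before s i j || before s k j.

Definition conforms (b : bool) s i j k : bool :=
  if b then notlast s i j k else notfirst s i j k.

(** The casting [u] takes the value cup where it is true, cap elsewhere. *)
Definition cdom u : {set linord n} :=
  [set s | [forall i : 'I_n, forall j : 'I_n, forall k : 'I_n,
     (i < j < k) ==> conforms (u i j k) s i j k]].

Lemma cdomP u s :
  reflect (forall i j k, i < j -> j < k -> conforms (u i j k) s i j k)
          (s \in cdom u).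
Proof.
rewrite inE; apply: (iffP forallP) => [h i j k ij jk|h i].
  by have /forallP/(_ j)/forallP/(_ k)/implyP := h i; apply; rewrite ij.
apply/forallP => j; apply/forallP => k; apply/implyP => /andP[]; exact: h.
Qed.

Lemma notlastE s i j k : i < j -> j < k ->
  notlast s i j k = (((j, k) \in Inv s) ==> ((i, j) \in Inv s)).
Proof.
by move=> ij jk; rewrite /notlast before_Inv // before_nInv // orbC implybE.
Qed.

Lemma notfirstE s i j k : i < j -> j < k ->
  notfirst s i j k = (((i, j) \in Inv s) ==> ((j, k) \in Inv s)).
Proof.
by move=> ij jk; rewrite /notfirst before_nInv // before_Inv // implybE.
Qed.

Definition ideal_at (b : bool) I i j k : Prop :=
  if b then ((i, k) \in I -> (i, j) \in I) /\ ((j, k) \in I -> (i, k) \in I)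
  else ((i, k) \in I -> (j, k) \in I) /\ ((i, j) \in I -> (i, k) \in I).

(** The inversion sets of the members of [cdom u] are the down-sets of the
    relation that orders the pairs of each triple as [u] prescribes. *)
Definition ideal u I : Prop :=
  (forall x y, (x, y) \in I -> x < y) /\
  forall i j k, i < j -> j < k -> ideal_at (u i j k) I i j k.

Lemma dom_ideal u s : s \in cdom u <-> ideal u (Inv s).
Proof.
split=> [/cdomP h|[_ h]].
  split=> [x y|i j k ij jk]; first exact: Inv_lt.
  have := h i j k ij jk; rewrite /conforms /ideal_at.
  have c := @Inv_cotrans _ s _ _ _ ij jk; have tr := @Inv_trans _ s i j k.
  case: (u i j k); rewrite ?notlastE ?notfirstE // => /implyP l; split=> m.
  - by case: (c m) => // /l.
  - exact: tr (l m) m.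
  - by case: (c m) => // /l.
  - exact: tr m (l m).
apply/cdomP => i j k ij jk; have := h i j k ij jk; rewrite /conforms /ideal_at.
by case: (u i j k) => -[a b]; rewrite ?notlastE ?notfirstE //; apply/implyP => ?;
  apply: a; apply: b.
Qed.

Lemma ideal_biconvex u I : ideal u I -> biconvex I.
Proof.
case=> lt h; split=> // i j k ij jk; have := h i j k ij jk; rewrite /ideal_at.
by case: (u i j k) => -[a b]; split=> [p q|p]; by [exact: b|left; exact: a|right; exact: a].
Qed.

Lemma ideal_dom u I : ideal u I -> exists2 s, s \in cdom u & Inv s = I.
Proof.
move=> h; have [s e] := biconvex_Inv (ideal_biconvex h).
by exists s => //; apply/dom_ideal; rewrite e.
Qed.

Lemma ideal_all u (Q : 'I_n * 'I_n -> bool) :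
  (forall i j k, i < j -> j < k ->
     if u i j k then (Q (i, k) -> Q (i, j)) /\ (Q (j, k) -> Q (i, k))
     else (Q (i, k) -> Q (j, k)) /\ (Q (i, j) -> Q (i, k))) ->
  ideal u [set p : 'I_n * 'I_n | (p.1 < p.2) && Q p].
Proof.
move=> h; split=> [x y|i j k ij jk]; first by rewrite inE => /andP[].
have ik := ltn_trans ij jk; have := h i j k ij jk.
by rewrite /ideal_at; case: (u i j k); rewrite !inE /= ij jk ik.
Qed.

Lemma ideal_atU b I J i j k : ideal_at b I i j k -> ideal_at b J i j k ->
  ideal_at b (I :|: J) i j k.
Proof.
rewrite /ideal_at; case: b => -[a b] [c d]; split; rewrite !inE.
- by case/orP=> [/a|/c] ->; rewrite ?orbT.
- by case/orP=> [/b|/d] ->; rewrite ?orbT.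
- by case/orP=> [/a|/c] ->; rewrite ?orbT.
- by case/orP=> [/b|/d] ->; rewrite ?orbT.
Qed.

Lemma ideal_atI b I J i j k : ideal_at b I i j k -> ideal_at b J i j k ->
  ideal_at b (I :&: J) i j k.
Proof.
rewrite /ideal_at; case: b => -[a b] [c d]; split; rewrite !inE => /andP[p q].
- by rewrite a // c.
- by rewrite b // d.
- by rewrite a // c.
- by rewrite b // d.
Qed.

Lemma join_of_union s t r : Inv r = Inv s :|: Inv t -> joinbr s t = r.
Proof.
move=> e; apply: lebr_anti; rewrite joinbrP /lebr e subsetUl subsetUr /=.
have := lebr_refl (joinbr s t); rewrite joinbrP => /andP[a b].
by rewrite subUset; apply/andP.
Qed.

Lemma meet_of_inter s t r : Inv r = Inv s :&: Inv t -> meetbr s t = r.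
Proof.
move=> e; apply: lebr_anti; rewrite meetbrP /lebr e subsetIl subsetIr /= andbT.
have := lebr_refl (meetbr s t); rewrite meetbrP => /andP[a b].
by rewrite subsetI; apply/andP.
Qed.

Lemma dom_join u s t : s \in cdom u -> t \in cdom u ->
  joinbr s t \in cdom u /\ Inv (joinbr s t) = Inv s :|: Inv t.
Proof.
move=> /dom_ideal[s1 s2] /dom_ideal[t1 t2].
have [|r rd e] := @ideal_dom u (Inv s :|: Inv t); last by rewrite (join_of_union e).
split=> [x y|i j k ij jk]; first by rewrite inE => /orP[/s1|/t1].
by apply: ideal_atU; [apply: s2|apply: t2].
Qed.

Lemma dom_meet u s t : s \in cdom u -> t \in cdom u ->
  meetbr s t \in cdom u /\ Inv (meetbr s t) = Inv s :&: Inv t.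
Proof.
move=> /dom_ideal[s1 s2] /dom_ideal[t1 t2].
have [|r rd e] := @ideal_dom u (Inv s :&: Inv t); last by rewrite (meet_of_inter e).
split=> [x y|i j k ij jk]; first by rewrite inE => /andP[/s1].
by apply: ideal_atI; [apply: s2|apply: t2].
Qed.

Lemma dom_alpha u : alpha n \in cdom u.
Proof.
apply/cdomP => i j k ij jk; rewrite /conforms /notlast /notfirst !before_alpha.
by rewrite ij jk orbT if_same.
Qed.

Lemma dom_omega u : omega n \in cdom u.
Proof.
apply/cdomP => i j k ij jk; rewrite /conforms /notlast /notfirst !before_omega.
by rewrite ij jk orbT if_same.
Qed.

(** A schedule lists the pairs in an order for which, on each triple, the
    pairs come in lexicographic (cup) or reverse lexicographic (cap) order. *)
Definition schedule (T : 'I_n -> 'I_n -> nat) u : Prop :=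
  forall i j k, i < j -> j < k ->
    if u i j k then T i j < T i k /\ T i k < T j k
    else T j k < T i k /\ T i k < T i j.

(** Equivalently, [cdom u] contains a flag: see [realizable_flag] and
    [flag_realizable]. *)
Definition realizable u : Prop := exists T, schedule T u.

(** Adding to [s] the inversion of [t] scheduled first among the missing ones
    yields a down-set again. *)
Lemma dom_succ u s t : realizable u -> s \in cdom u -> t \in cdom u ->
  lebr s t -> s <> t ->
  exists r x y, [/\ r \in cdom u, flip s r x y & lebr r t].
Proof.
move=> [T sch] sd td st ne.
have /fintype.subsetPn[q0 q0t q0s] : ~~ (Inv t \subset Inv s).
  by apply: contra_notN ne => ts; apply: lebr_anti; rewrite /lebr ts andbT.
pose P (q : 'I_n * 'I_n) := (q \in Inv t) && (q \notin Inv s).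
have P0 : P q0 by rewrite /P q0t.
case: (arg_minnP (fun q => T q.1 q.2) P0) => -[x y] /andP[/= xyt xys] tmin.
have early a b : (a, b) \in Inv t -> T a b < T x y -> (a, b) \in Inv s.
  move=> abt lt; apply: contraT => abs.
  by have := tmin (a, b); rewrite /P abt abs leqNgt => /(_ isT) /=; rewrite lt.
have [_ it] := proj1 (dom_ideal u t) td.
have [_ is_] := proj1 (dom_ideal u s) sd.
have [|r rd e] := @ideal_dom u ((x, y) |: Inv s); last first.
  exists r, x, y; split=> //; first by split=> //; apply: Inv_lt xyt.
  apply/lebrP => a b; rewrite e in_setU1 => /orP[/eqP[-> ->] //|].
  exact: (lebrP _ _ st).
split=> [a b|i j k ij jk].
  by rewrite in_setU1 => /orP[/eqP[-> ->]|]; [apply: Inv_lt xyt|apply: Inv_lt].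
have := it i j k ij jk; have := is_ i j k ij jk; have := sch i j k ij jk.
rewrite /ideal_at; case: (u i j k) => -[l1 l2] [a b] [c d]; split;
  rewrite !in_setU1 => /orP[/eqP[e1 e2]|h]; subst; apply/orP; right.
- exact: early (c xyt) l1.
- exact: a.
- exact: early (d xyt) l2.
- exact: b.
- exact: early (c xyt) l1.
- exact: a.
- exact: early (d xyt) l2.
- exact: b.
Qed.

(** The longest member strictly below [t] and above [s] has a successor below
    [t], which is [t]. *)
Lemma dom_pred u s t : realizable u -> s \in cdom u -> t \in cdom u ->
  lebr s t -> s <> t ->
  exists r x y, [/\ r \in cdom u, flip r t x y & lebr s r].
Proof.
move=> ru sd td st ne.
pose P r := [&& r \in cdom u, lebr s r, lebr r t & r != t].
have P0 : P s by rewrite /P sd lebr_refl st /=; apply/eqP.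
case: (arg_maxnP (fun r => #|Inv r|) P0) => r /and4P[rd sr rt /eqP nrt] rmax.
have [r' [x [y [r'd f r't]]]] := dom_succ ru rd td rt nrt.
have [e|ne'] := eqVneq r' t; first by exists r, x, y; rewrite -e.
have := rmax r'; rewrite /P r'd r't ne' (lebr_trans sr (flip_le f)) (flip_card f).
by move=> /(_ isT) /=; rewrite ltnn.
Qed.

(** When the outer pair of a triple is flipped, biconvexity of the two orders
    makes exactly one of the two other pairs inverted; which one it is decides
    between cup and cap. *)
Lemma flag_triple R C i j k : flag R C -> i < j -> j < k ->
  exists s t, [/\ s \in C, t \in C, flip s t i k &
    ((i, j) \in Inv s) = ((j, k) \notin Inv s)].
Proof.
move=> fC ij jk; have ik := ltn_trans ij jk.
have [s [t [sC tC f _]]] := flag_step fC ik; exists s, t; split=> //.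
case: (f) => _ nik e.
have c := @Inv_cotrans _ t _ _ _ ij jk (flip_in f).
rewrite !e !in_setU1 /= !xpair_eqE in c.
have nj1 : (j == i) = false by rewrite eq_sym -val_eqE (ltn_eqF ij).
have nj2 : (j == k) = false by rewrite -val_eqE (ltn_eqF jk).
rewrite nj1 nj2 andbF /= in c; have tr := @Inv_trans _ s i j k.
case: (boolP ((i, j) \in Inv s)) => a; case: (boolP ((j, k) \in Inv s)) => b //=.
  by rewrite tr in nik.
by case: c; rewrite ?(negbTE a) ?(negbTE b).
Qed.

(** The casting of a flag: cup when [(i, j)] is inverted before [(j, k)]. *)
Definition cup (C : {set linord n}) i j k : bool :=
  [exists s in C, ~~ notfirst s i j k].

Lemma cup_uniq R C u : flag R C -> C \subset cdom u ->
  forall i j k, i < j -> j < k -> u i j k = cup C i j k.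
Proof.
move=> fC /fintype.subsetP Cu i j k ij jk; apply/esym; rewrite /cup.
case E: (u i j k); last first.
  apply/negbTE; rewrite negb_exists_in; apply/forall_inP => s /Cu/cdomP/(_ i j k ij jk).
  by rewrite /conforms E negbK.
have [s [t [sC tC f h]]] := flag_triple fC ij jk.
apply/existsP; exists s; rewrite sC notfirstE //.
have /cdomP/(_ i j k ij jk) := Cu _ sC; rewrite /conforms E notlastE // h.
by case: ((j, k) \in Inv s).
Qed.

Lemma dom_eq u v : (forall i j k, i < j -> j < k -> u i j k = v i j k) ->
  cdom u = cdom v.
Proof.
by move=> h; apply/setP => s; apply/cdomP/cdomP => hs i j k ij jk;
  [rewrite -h|rewrite h] => //; apply: hs.
Qed.

(** If [D] is closed under union and intersection of inversion sets, a member
    of [D] that violates the casting of a flag of [D] on a triple has, together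
    with one of the two orders of the flag surrounding the flip of the outer
    pair of the triple, a union or an intersection that is not biconvex. *)
Lemma closed_sub_cup R C (D : {set linord n}) : flag R C -> C \subset D ->
  {in D &, forall s t, (exists r, Inv r = Inv s :|: Inv t) /\
                       (exists r, Inv r = Inv s :&: Inv t)} ->
  D \subset cdom (cup C).
Proof.
move=> fC /fintype.subsetP CD cl; apply/fintype.subsetP => s sD; apply/cdomP => i j k ij jk.
have ik := ltn_trans ij jk.
have nj1 : (j == i) = false by rewrite eq_sym -val_eqE (ltn_eqF ij).
have nj2 : (j == k) = false by rewrite -val_eqE (ltn_eqF jk).
(* whichever value the casting has, a member of the wrong type contradicts a
   flip of (i, k) of the other type *)
have key (p q : 'I_n * 'I_n) : (p, q) = ((i, j), (j, k)) \/ (p, q) = ((j, k), (i, j)) ->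
    forall a b, a \in C -> b \in C -> flip a b i k -> p \in Inv a -> q \notin Inv a ->
    p \notin Inv s -> q \in Inv s -> False.
  move=> pq a b aC bC [_ nik eb] pa qa ps qs.
  have [[r1 e1] _] := cl _ _ sD (CD _ aC); have [_ [r2 e2]] := cl _ _ sD (CD _ bC).
  have tr := @Inv_trans _ r1 i j k; have co := @Inv_cotrans _ r2 _ _ _ ij jk.
  have pb : p \in Inv b by rewrite eb in_setU1 pa orbT.
  have qb : q \notin Inv b.
    rewrite eb in_setU1 (negbTE qa) orbF.
    by case: pq => -[_ ->]; rewrite xpair_eqE ?nj1 ?nj2 ?andbF.
  have sik : (i, k) \in Inv s.
    have : (i, k) \in Inv r1.
      by apply: tr; rewrite e1 in_setU; case: pq => -[e e']; subst; rewrite ?pa ?qs ?orbT.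
    by rewrite e1 in_setU (negbTE nik) orbF.
  have : (i, k) \in Inv r2 by rewrite e2 in_setI sik eb in_setU1 eqxx.
  move/co; rewrite e2 !in_setI.
  by case: pq => -[e e']; subst; rewrite ?(negbTE ps) ?(negbTE qb) ?andbF //; case.
have [a [b [aC bC f h]]] := flag_triple fC ij jk.
rewrite /conforms /cup; case: existsP => [[c /andP[cC]]|nex].
  rewrite notfirstE // negb_imply => /andP[c1 c2].
  rewrite notlastE //; apply/implyP => sjk; apply: contraT => sij.
  case: (boolP ((i, j) \in Inv a)) => aij.
    exfalso; apply: (key (i, j) (j, k) _ a b) => //; first by left.
    by rewrite -h.
  (* the flag itself would contain orders of both types *)
  have ajk : (j, k) \in Inv a by move: aij; rewrite h negbK.
  exfalso; case: (fC) => _ _ ch _; case/orP: (ch _ _ aC cC) => /lebrP le.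
    by rewrite le in c2.
  by rewrite le in aij.
rewrite notfirstE //; apply/implyP => sij; apply: contraT => sjk; exfalso.
case: (boolP ((i, j) \in Inv a)) => aij; last first.
  by apply: (key (j, k) (i, j) _ a b) => //; [right|move: aij; rewrite h negbK].
by apply: nex; exists a; rewrite aC notfirstE // aij -h aij.
Qed.

Lemma flag_sub_cup R C : flag R C -> C \subset cdom (cup C).
Proof.
move=> fC; apply: (closed_sub_cup fC (subxx _)) => s t sC tC.
case: fC => _ _ ch _; case/orP: (ch _ _ sC tC) => st; have e := st; rewrite /lebr in e.
  by split; [exists t|exists s]; apply/esym; [apply/setUidPr|apply/setIidPl].
by split; [exists s|exists t]; apply/esym; [apply/setUidPl|apply/setIidPr].
Qed.

(** A flag schedules a pair by the number of its members in which the pair is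
    not yet inverted. *)
Lemma flag_realizable R C u : flag R C -> C \subset cdom u -> realizable u.
Proof.
move=> fC /fintype.subsetP Cu.
exists (fun x y => #|[set s in C | (x, y) \notin Inv s]|) => i j k ij jk.
have ik := ltn_trans ij jk.
have nj1 : (i == j) = false by rewrite -val_eqE (ltn_eqF ij).
have nj2 : (j == k) = false by rewrite -val_eqE (ltn_eqF jk).
have lt (x y x' y' : 'I_n) : x' < y' -> (x, y) != (x', y') ->
    {in C, forall s, (x', y') \in Inv s -> (x, y) \in Inv s} ->
    #|[set s in C | (x, y) \notin Inv s]| < #|[set s in C | (x', y') \notin Inv s]|.
  move=> x'y' ne imp; apply: proper_card; apply/properP; split.
    apply/fintype.subsetP => s /setIdP[sC h]; apply/setIdP; split=> //.
    exact: contra (imp s sC) h.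
  have [s [t [sC tC f _]]] := flag_step fC x'y'; exists s.
    by apply/setIdP; split=> //; case: f.
  apply/negP => /setIdP[_]; apply/negP; rewrite negbK.
  have := imp t tC (flip_in f); case: f => _ _ ->.
  by rewrite in_setU1 (negbTE ne).
have h s : s \in C -> ideal_at (u i j k) (Inv s) i j k.
  by move=> /Cu/dom_ideal[_]; apply.
case: (u i j k) h => h; split; apply: lt => //; rewrite ?xpair_eqE ?eqxx /= ?nj2 ?nj1 //;
  try (by rewrite eq_sym ?nj1 ?nj2); by [rewrite andbF|move=> s /h[]].
Qed.

Lemma realizable_flag u : realizable u -> exists2 C, flag (@plain n) C & C \subset cdom u.
Proof.
move=> ru; have [|C fC Cu] := @climb n (fun s => s \in cdom u) (@plain n) _ (dom_alpha u).
  move=> s sd so; have [r [x [y [rd f _]]]] := dom_succ ru sd (dom_omega u) (lebr_omega s) so.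
  by exists r, x, y.
by exists C => //; apply/fintype.subsetP.
Qed.

Lemma realizable_covering u : realizable u -> covering (cdom u).
Proof.
move=> ru s t [sd td st no]; split; rewrite ?in_setT // => q _.
have [st1 st2] : lebr s t /\ s <> t.
  by move: st; rewrite lt_neqAle => /andP[/eqP ? ?].
have [r [x [y [rd f rt]]]] := dom_succ ru sd td st1 st2.
have e : r = t.
  apply/eqP; apply: contraT => ne; case: (negP (no r rd)).
  rewrite !lt_neqAle ne (rt : (r <= t)%O) (flip_le f : (s <= r)%O) !andbT.
  by apply/eqP => e; have := flip_card f; rewrite e; lia.
subst r; apply/negP; rewrite !lt_neqAle => /andP[/andP[n1 l1] /andP[n2 l2]].
have := lebr_card l1 (elimN eqP n1); have := lebr_card l2 (elimN eqP n2).
by rewrite (flip_card f) ltnS => a b; have := leq_trans b a; rewrite ltnn.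
Qed.

Lemma maximal_flag C : maximal_chain C -> flag (@plain n) C.
Proof.
case=> ch mx.
have add r : {in C, forall s, lebr r s || lebr s r} -> r \in C.
  move=> cr; have <- : r |: C = C; last by rewrite setU11.
  apply: mx; last exact: subsetUr.
  move=> a b; rewrite !in_setU1 => /orP[/eqP->|aC] /orP[/eqP->|bC].
  - exact: comparablexx.
  - exact: cr.
  - by rewrite comparable_sym; apply: cr.
  - exact: ch.
have aC : alpha n \in C by apply: add => s _; rewrite lebr_alpha.
have oC : omega n \in C by apply: add => s _; rewrite lebr_omega orbT.
have cov : covering C.
  move=> s t [sC tC st no]; split; rewrite ?in_setT // => r _.
  apply: contraT; rewrite negbK => srt; have [sr rt] := andP srt.
  have rC : r \in C; last by have := no r rC; rewrite srt.
  apply: add => q qC.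
  have : (q <= s)%O || (t <= q)%O.
    have := ch q s qC sC; have := ch q t qC tC; rewrite /Order.comparable.
    case/orP=> qt /orP[->//|sq]; rewrite ?qt ?orbT //.
    have := no q qC; rewrite !lt_neqAle sq qt !andbT negb_and !negbK.
    by case/orP=> /eqP->; rewrite lexx ?orbT.
  case/orP=> h; apply/orP; [right|left].
    exact: (le_trans h (ltW sr)).
  exact: (le_trans (ltW rt) h).
have [C' fC' C'C] := covering_flag aC oC cov.
suff <- : C' = C by [].
by apply/esym; apply: (proj2 (flag_maximal fC')).
Qed.

(** Climbing through the members comparable to [s] yields a flag all of whose
    members are comparable to [s]; being maximal, it contains [s]. *)
Lemma flag_through u s : realizable u -> s \in cdom u ->
  exists C, [/\ flag (@plain n) C, C \subset cdom u & s \in C].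
Proof.
move=> ru sd; pose P t := t \in cdom u /\ (lebr t s || lebr s t).
have [||C fC CP] := @climb n P (@plain n); last first.
- have Cu : C \subset cdom u by apply/fintype.subsetP => t /CP[].
  exists C; split=> //.
  have [_ mx] := flag_maximal fC.
  have <- : s |: C = C; last by rewrite setU11.
  apply: mx; last exact: subsetUr.
  case: fC => _ _ ch _ a b; rewrite !in_setU1 => /orP[/eqP->|aC] /orP[/eqP->|bC].
  + exact: comparablexx.
  + by have [_] := CP b bC; rewrite orbC.
  + by have [_] := CP a aC.
  + exact: ch.
- by split; [apply: dom_alpha|rewrite lebr_alpha].
- move=> t [td ts] to.
  case: (boolP (lebr s t)) => [st|nst].
    have [r [x [y [rd f _]]]] := dom_succ ru td (dom_omega u) (lebr_omega t) to.
    by exists r, x, y; split=> //; split=> //; rewrite (lebr_trans st (flip_le f)) orbT.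
  rewrite (negbTE nst) orbF in ts.
  have [|r [x [y [rd f rs]]]] := dom_succ ru td sd ts.
    by move=> e; rewrite e lebr_refl in nst.
  by exists r, x, y; split=> //; split=> //; rewrite rs.
Qed.

(** * Restrictions to triples *)

Lemma sorted_word s : sorted (before s) (word s).
Proof.
have -> : word s = map s (enum 'I_n) by [].
rewrite sorted_map; have /= := iota_ltn_sorted 0 n.
rewrite -val_enum_ord sorted_map; apply: sub_sorted => a b /=.
by rewrite /before !permK.
Qed.

Lemma restrictionE s (q : triple n) (l : seq 'I_n) : sorted (before s) l ->
  l =i [:: (val q).1.1; (val q).1.2; (val q).2] -> restriction s q = l.
Proof.
case: q => -[[i j] k] /= ijk so pe; rewrite /restriction /=.
have tr : transitive (before s) by apply: before_trans.
apply: (irr_sorted_eq tr) => //; first exact: before_irr.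
  exact: (sorted_filter tr _ (sorted_word s)).
move=> x; rewrite mem_filter pe andbC; case: (boolP (x \in word s)) => //=.
case/negP; have -> : x = s ((s^-1)%g x) by rewrite permKV.
by apply: map_f; rewrite mem_enum.
Qed.

Lemma triple_cases s i j k : i < j -> j < k ->
  exists l, [/\ sorted (before s) l & 
    l \in [:: [:: i; j; k]; [:: i; k; j]; [:: j; i; k]; [:: j; k; i]; [:: k; i; j]; [:: k; j; i]]].
Proof.
move=> ij jk; have ik := ltn_trans ij jk.
have nij := ord_lt_neq ij; have njk := ord_lt_neq jk; have nik := ord_lt_neq ik.
have tr := @before_trans _ s.
case: (boolP (before s i j)) => a; case: (boolP (before s j k)) => b;
  case: (boolP (before s i k)) => c; rewrite -?(beforeN s nij) -?(beforeN s njk) -?(beforeN s nik) in a b c.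
- by exists [:: i; j; k]; rewrite /= a b !inE !eqxx.
- by have := before_asym (tr _ _ _ a b); rewrite c.
- by exists [:: i; k; j]; rewrite /= c b !inE !eqxx ?orbT.
- by exists [:: k; i; j]; rewrite /= c a !inE !eqxx ?orbT.
- by exists [:: j; i; k]; rewrite /= a c !inE !eqxx ?orbT.
- by exists [:: j; k; i]; rewrite /= b c !inE !eqxx ?orbT.
- by have := before_asym (tr _ _ _ b a); rewrite c.
- by exists [:: k; j; i]; rewrite /= b a !inE !eqxx ?orbT.
Qed.

Lemma restriction_D3 s (q : triple n) (v : castval) :
  let: (i, j, k) := val q in
  (restriction s q \in D3 v q) =
  match v with
  | Cap => notfirst s i j k
  | Cup => notlast s i j k
  | Rightarrow => ~~ (before s i k && before s k j) && ~~ (before s j k && before s k i)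
  | Leftarrow => ~~ (before s j i && before s i k) && ~~ (before s k i && before s i j)
  end.
Proof.
case E: q => [[[i j] k] /= ijk]; rewrite -E; have [ij jk] := andP ijk.
have ik := ltn_trans ij jk.
have [nij njk nik] : [/\ (i == j) = false, (j == k) = false & (i == k) = false].
  by split; apply/negbTE; apply: ord_lt_neq.
have [nji nkj nki] : [/\ (j == i) = false, (k == j) = false & (k == i) = false].
  by split; rewrite eq_sym.
have [l [so lin]] := triple_cases s ij jk.
have -> : restriction s q = l.
  apply: restrictionE => //; rewrite E /=; move: lin; rewrite !inE.
  by case/or4P=> [/eqP->|/eqP->|/eqP->|/orP[/eqP->|/orP[/eqP->|/eqP->]]];
    move=> x; rewrite !inE; case: (x == i); case: (x == j); case: (x == k).
have As := @before_asym _ s; have tr := @before_trans _ s.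
move: lin so; rewrite /D3 E /= !inE /notfirst /notlast.
by case/or4P=> [/eqP->|/eqP->|/eqP->|/orP[/eqP->|/orP[/eqP->|/eqP->]]] /=;
  rewrite andbT => /andP[a b]; have c := tr _ _ _ a b;
  rewrite ?a ?b ?c ?(As _ _ a) ?(As _ _ b) ?(As _ _ c);
  case: v; rewrite !inE !eqseq_cons ?eqxx ?nij ?njk ?nik ?nji ?nkj ?nki.
Qed.

(** On each triple a flag takes all four values of cup or all four values of
    cap, so that it determines its casting. *)
Lemma hatP C (X : {set linord n}) : maximal_chain C -> hat C X <-> X = cdom (cup C).
Proof.
move=> /maximal_flag fC.
have Cd c : C \subset casting_domain c -> casting_domain c = cdom (cup C).
  move=> /fintype.subsetP Cc.
  have val_c (q : triple n) : c q = if cup C (val q).1.1 (val q).1.2 (val q).2 then Cup else Cap.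
    case E: q => [[[i j] k] /= ijk]; rewrite -E; have [ij jk] := andP ijk.
    have mem s : s \in C -> restriction s q \in D3 (c q) q.
      by move=> /Cc; rewrite inE => /forallP.
    have ik := ltn_trans ij jk.
    have [s [t [sC tC f h]]] := flag_triple fC ij jk.
    have := mem s sC; have := mem t tC.
    have := restriction_D3 s q (c q); have := restriction_D3 t q (c q); rewrite E /= -E.
    move=> -> ->.
    have /cdomP/(_ i j k ij jk) := fintype.subsetP (flag_sub_cup fC) _ sC.
    have ji : j != i by rewrite eq_sym ord_lt_neq.
    have jk' : j != k by rewrite ord_lt_neq.
    rewrite /conforms /notlast /notfirst.
    have [-> ->] := flip_other i f ji jk'; have [-> ->] := flip_other k f ji jk'.
    have := flip_adj f ji jk'; have tki := flip_before_t f; have sik := flip_before_s f.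
    rewrite tki sik (before_asym tki) (before_asym sik) => ej.
    rewrite !(beforeN s ji) !(beforeN s jk') ej.
    by case: (c q); case: (cup C i j k); case: (before s j k).
  apply/setP => s; rewrite inE; apply/forallP/cdomP => [h i j k ij jk|h q].
    have ijk : (i < j < k) by rewrite ij.
    have := h (Sub (i, j, k) ijk); have := restriction_D3 s (Sub (i, j, k) ijk) (c (Sub (i, j, k) ijk)).
    by rewrite /= => ->; rewrite val_c /= /conforms; case: (cup C i j k).
  case E: q => [[[i j] k] /= ijk]; have [ij jk] := andP ijk.
  have := restriction_D3 s q (c q); rewrite E /= -E => ->.
  by have := h i j k ij jk; rewrite val_c E /= /conforms; case: (cup C i j k).
split=> [[c Cc ->]|->]; first exact: Cd.
pose c (q : triple n) := if cup C (val q).1.1 (val q).1.2 (val q).2 then Cup else Cap.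
have Cc : C \subset casting_domain c.
  apply/fintype.subsetP => s sC; rewrite inE; apply/forallP => q.
  case E: q => [[[i j] k] /= ijk]; have [ij jk] := andP ijk.
  have := restriction_D3 s q (c q); rewrite E /= -E => ->.
  have /cdomP/(_ i j k ij jk) := fintype.subsetP (flag_sub_cup fC) _ sC.
  by rewrite /c E /= /conforms; case: (cup C i j k).
by exists c => //; rewrite (Cd c Cc).
Qed.

Definition realized (X : {set linord n}) : Prop := exists2 u, realizable u & X = cdom u.

Lemma A_domainP X : A_domain X <-> realized X.
Proof.
split=> [[C mC /(hatP _ mC)->]|[u ru ->]].
  have fC := maximal_flag mC.
  by exists (cup C) => //; apply: flag_realizable fC (flag_sub_cup fC).
have [C fC Cu] := realizable_flag ru; exists C; first exact: flag_maximal.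
by apply/hatP; [exact: flag_maximal|apply: dom_eq (cup_uniq fC Cu)].
Qed.

(** Flags inside [cdom u] are the maximal chains equivalent to a given one,
    and they exhaust [cdom u] by [flag_through]. *)
Lemma GR_domainP X : GR_domain X <-> realized X.
Proof.
have main C s : maximal_chain C ->
    (exists C', [/\ maximal_chain C', chain_equiv C C' & s \in C']) <-> s \in cdom (cup C).
  move=> mC; have fC := maximal_flag mC; split.
    case=> C' [mC' [Y /(hatP _ mC)-> /(hatP _ mC')-> sC']].
    exact: (fintype.subsetP (flag_sub_cup (maximal_flag mC'))).
  move=> sd; have ru := flag_realizable fC (flag_sub_cup fC).
  have [C' [fC' C'u sC']] := flag_through ru sd; have mC' := flag_maximal fC'.
  exists C'; split=> //; exists (cdom (cup C)); first exact/hatP.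
  by apply/hatP => //; apply: dom_eq (cup_uniq fC' C'u).
split=> [[C mC XC]|[u ru ->]].
  have fC := maximal_flag mC.
  exists (cup C); first exact: flag_realizable fC (flag_sub_cup fC).
  by apply/setP => s; apply/idP/idP => [/XC/(main _ _ mC)|/(main _ _ mC)/XC].
have [C fC Cu] := realizable_flag ru; exists C; first exact: flag_maximal.
move=> s; rewrite (dom_eq (cup_uniq fC Cu)); apply: iff_sym; apply: main.
exact: flag_maximal.
Qed.
End PeakPitCastings.

(** * Distributive covering sublattices *)

Section DistributiveCovering.
Variable n : nat.
Implicit Types (s t r : linord n) (i j k x y z : 'I_n) (D : {set linord n}).
Local Open Scope order_scope.

Lemma cover_flip s t : covers_in [set: linord n] s t -> exists x y, flip s t x y.
Proof.
case=> _ _; rewrite lt_neqAle => /andP[/eqP ne st] no.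
have [r [x [y [f rt]]]] := bruhat_succ st ne.
suff e : r = t by subst r; exists x, y.
apply/eqP; apply: contraT => nrt; have := no r (in_setT _).
rewrite !lt_neqAle nrt (rt : (r <= t)%O) (flip_le f : (s <= r)%O) !andbT negbK.
by move=> /eqP e; have := flip_card f; rewrite e => /eqP; rewrite ltn_eqF.
Qed.

(** Prime quotients of a distributive lattice are transported by joins; when
    covers add a single inversion, induction along two chains from the meet
    shows that joins and meets are unions and intersections. *)
Lemma dcs_closed D : distributive_covering_sublattice D ->
  {in D &, forall s t, Inv (s `|` t) = Inv s :|: Inv t /\
                       Inv (s `&` t) = Inv s :&: Inv t}.
Proof.
move=> [[mD jD] dD cD].
have le_case s t : s <= t -> Inv (s `|` t) = Inv s :|: Inv t /\
                             Inv (s `&` t) = Inv s :&: Inv t.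
  move=> st; have st' : Inv s \subset Inv t by exact: st.
  by rewrite (join_r st) (meet_l st) (setUidPr st') (setIidPl st').
have sym s t : Inv (s `|` t) = Inv s :|: Inv t /\ Inv (s `&` t) = Inv s :&: Inv t ->
    Inv (t `|` s) = Inv t :|: Inv s /\ Inv (t `&` s) = Inv t :&: Inv s.
  by rewrite joinC meetC setUC setIC.
have pred m s : m \in D -> s \in D -> m < s -> exists r, [/\ covers_in D r s & m <= r].
  move=> mD' sD ms; pose P r := [&& r \in D, m <= r & r < s].
  have P0 : P m by rewrite /P mD' lexx.
  case: (arg_maxnP (fun r => #|Inv r|) P0) => r /and3P[rD mr rs] rmax.
  exists r; split=> //; split=> // q qD; apply/negP => /andP[rq qs].
  have := rmax q; rewrite /P qD qs (le_trans mr (ltW rq)) => /(_ isT) /=.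
  move: rq; rewrite lt_neqAle => /andP[/eqP ne rq].
  by rewrite leqNgt (lebr_card rq ne).
suff main d s t : (#|Inv s| + #|Inv t| <= 2 * #|Inv (s `&` t)| + d)%N ->
    s \in D -> t \in D ->
    Inv (s `|` t) = Inv s :|: Inv t /\ Inv (s `&` t) = Inv s :&: Inv t.
  by move=> s t sD tD; apply: (main (#|Inv s| + #|Inv t|)%N) => //; rewrite leq_addl.
elim: d s t => [|d IH] s t sz sD tD.
  have a : (#|Inv (s `&` t)| <= #|Inv s|)%N := subset_leq_card (leIl s t).
  have b : (#|Inv (s `&` t)| <= #|Inv t|)%N := subset_leq_card (leIr t s).
  apply: le_case; apply/meet_idPl; apply: Inv_inj; apply/eqP.
  rewrite eqEcard; apply/andP; split; first exact: (leIl s t).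
  have aux (p q m : nat) : (p + q <= 2 * m + 0 -> m <= p -> m <= q -> p <= m)%N by clear; lia.
  exact: aux sz a b.
have [st|nst] := boolP (s <= t); first exact: le_case.
have [ts|nts] := boolP (t <= s); first by apply: sym; apply: le_case.
have lt1 s' t' : ~~ (s' <= t') -> s' `&` t' < s'.
  by move=> h; rewrite lt_neqAle leIl andbT; apply: contra h => /eqP/meet_idPl.
(* a cover of s that is not the meet splits the interval *)
have split s1 t1 r : s1 \in D -> t1 \in D -> (#|Inv s1| + #|Inv t1| <= 2 * #|Inv (s1 `&` t1)| + d.+1)%N ->
    r \in D -> r < s1 -> s1 `&` t1 < r ->
    Inv (s1 `|` t1) = Inv s1 :|: Inv t1 /\ Inv (s1 `&` t1) = Inv s1 :&: Inv t1.
  move=> s1D t1D sz1 rD; rewrite !lt_neqAle => /andP[/eqP ne1 rs] /andP[/eqP ne2 mr].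
  have c1 := lebr_card rs ne1; have c2 := lebr_card mr ne2.
  have em : r `&` t1 = s1 `&` t1.
    apply: le_anti; apply/andP; split; rewrite lexI leIr andbT //.
    exact: le_trans (leIl _ _) rs.
  have aux (p q m x : nat) : (p + q <= 2 * m + d.+1 -> x < p -> x + q <= 2 * m + d)%N by clear; lia.
  have szr : (#|Inv r| + #|Inv t1| <= 2 * #|Inv (r `&` t1)| + d)%N.
    by rewrite em; apply: aux sz1 c1.
  have [a b] := IH r t1 szr rD t1D.
  have em2 : s1 `&` (r `|` t1) = r.
    by rewrite dD // (meet_r rs) joinC; apply/join_idPr.
  have cU := cardsUI (Inv r) (Inv t1); rewrite -a -b em in cU.
  have aux2 (p q m x j : nat) :
    (p + q <= 2 * m + d.+1 -> m < x -> j + m = x + q -> p + j <= 2 * x + d)%N by clear; lia.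
  have szj : (#|Inv s1| + #|Inv (r `|` t1)| <= 2 * #|Inv (s1 `&` (r `|` t1))| + d)%N.
    by rewrite em2; apply: aux2 sz1 c2 cU.
  have [a2 b2] := IH s1 (r `|` t1) szj s1D (jD _ _ rD t1D).
  have rs' : Inv r \subset Inv s1 by exact: rs.
  have -> : Inv (s1 `|` t1) = Inv s1 :|: Inv t1.
    have <- : s1 `|` (r `|` t1) = s1 `|` t1 by rewrite joinA (join_l rs).
    by rewrite a2 a setUA (setUidPl rs').
  split=> //; rewrite -em b; apply/eqP; rewrite eqEsubset setSI //=.
  rewrite subsetI subsetIr andbT -[in X in _ \subset X]em2 b2 a.
  by rewrite setIS // subsetUr.
have [r [[rD _ rs nr] mr]] := pred _ _ (mD _ _ sD tD) sD (lt1 _ _ nst).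
have mt : s `&` t < t by rewrite meetC lt1.
have [q [[qD _ qt nq] mq]] := pred _ _ (mD _ _ sD tD) tD mt.
have [er|ner] := eqVneq r (s `&` t); last first.
  by apply: (split s t r) => //; rewrite lt_neqAle mr eq_sym ner.
have [eq|neq] := eqVneq q (s `&` t); last first.
  have sz' : (#|Inv t| + #|Inv s| <= 2 * #|Inv (t `&` s)| + d.+1)%N.
    by rewrite (meetC t s) addnC.
  apply: sym; apply: (split t s q tD sD sz' qD qt).
  by rewrite meetC lt_neqAle mq eq_sym neq.
subst r; subst q.
have [x [y f]] : exists x y, flip (s `&` t) s x y by apply: cover_flip; apply: cD.
have [x' [y' f']] : exists x y, flip (s `&` t) t x y by apply: cover_flip; apply: cD.
have ne : (x, y) != (x', y').
  apply: contra nst => /eqP-[ex ey]; subst.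
  suff -> : s = t by [].
  by apply: Inv_inj; case: f => _ _ ->; case: f' => _ _ ->.
have [x2 [y2 f2]] : exists x y, flip t (s `|` t) x y.
  apply: cover_flip; apply: cD; split=> //; first exact: jD.
    by rewrite lt_neqAle leUr andbT; apply: contra nst => /eqP e; rewrite e leUl.
  move=> u uD; apply/negP => /andP[tu]; rewrite lt_neqAle => /andP[nus us].
  have /andP[h1 h2] : (s `&` t <= u `&` s) && (u `&` s <= s).
    by rewrite lexI leIl leIr andbT (le_trans (leIr _ _) (ltW tu)).
  have := nr (u `&` s) (mD _ _ uD sD).
  rewrite !lt_neqAle h1 h2 !andbT negb_and !negbK => /orP[/eqP e|/eqP e].
    have := tu; rewrite -(meet_l us) dD // -e (meet_r (ltW tu)).
    by rewrite (join_r (leIr _ _)) ltxx.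
  move: nus; rewrite eq_le us leUx (ltW tu) andbT.
  by rewrite -e leIl.
have em : Inv (s `&` t) = Inv s :&: Inv t.
  case: f => _ nf ->; case: f' => _ nf' ->; rewrite -setUIl.
  suff -> : [set (x, y)] :&: [set (x', y')] = set0 by rewrite set0U.
  by apply/setP => p; rewrite !inE; apply/negP => /andP[/eqP-> ]; rewrite (negbTE ne).
split=> //; apply/eqP; rewrite eq_sym eqEcard subUset.
have := cardsUI (Inv s) (Inv t); rewrite -em (flip_card f2) (flip_card f) (flip_card f').
move=> c; apply/andP; split.
  by apply/andP; split; [exact: (leUl s t)|exact: (leUr t s)].
have aux (p m : nat) : (p + m = m.+1 + m.+1 -> m.+2 <= p)%N by clear; lia.
exact: aux c.
Qed.

Lemma dcs_flag D : distributive_covering_sublattice D -> alpha n \in D -> omega n \in D ->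
  exists2 C, flag (@plain n) C & C \subset D /\ D \subset cdom (cup C).
Proof.
move=> dD aD oD; have [C fC CD] := covering_flag aD oD (let: And3 _ _ c := dD in c).
exists C => //; split=> //; apply: (closed_sub_cup fC CD) => s t sD tD.
by have [a b] := dcs_closed dD sD tD; split; [exists (s `|` t)|exists (s `&` t)].
Qed.

(** Distributivity is that of unions and intersections of inversion sets. *)
Lemma dom_dcs u : realizable u -> distributive_covering_sublattice (@cdom n u).
Proof.
move=> ru; split; last exact: realizable_covering.
- split=> s t sd td; first by case: (dom_meet sd td).
  by case: (dom_join sd td).
move=> s t r sd td rd; apply: Inv_inj.
have [jd ej] := dom_join td rd; have [md em] := dom_meet sd td.
have [md' em'] := dom_meet sd rd; have [_ e1] := dom_meet sd jd.
have [_ e2] := dom_join md md'.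
by rewrite [LHS]e1 [RHS]e2 ej em em' setIUr.
Qed.

Lemma flip_cover s t x y : flip s t x y -> covers_in [set: linord n] s t.
Proof.
move=> f; have st : s <= t := flip_le f.
split; rewrite ?in_setT //; last move=> q _.
  rewrite lt_neqAle st andbT; apply/eqP => e.
  by have := flip_card f; rewrite e => /eqP; rewrite ltn_eqF.
apply/negP; rewrite !lt_neqAle => /andP[/andP[/eqP n1 l1] /andP[/eqP n2 l2]].
have := lebr_card l1 n1; have := lebr_card l2 n2.
by rewrite (flip_card f) ltnS => a b; have := leq_trans b a; rewrite ltnn.
Qed.

Lemma covering_add D m r : covering D -> m \in D ->
  (forall q, q \in D -> m <= q) /\ (exists x y, flip r m x y) \/
  (forall q, q \in D -> q <= m) /\ (exists x y, flip m r x y) ->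
  covering (r |: D).
Proof.
move=> cD mD bd a b [aD bD ab nab].
have in_D c : c \in D -> c \in r |: D by rewrite in_setU1 => ->; rewrite orbT.
have neq : a <> b by move=> e; rewrite e ltxx in ab.
move: (aD) (bD); rewrite !in_setU1 => /orP[/eqP ea|aD'] /orP[/eqP eb|bD'].
- by case: neq; rewrite ea eb.
- subst a; case: bd => [[mle [x [y f]]]|[lem [x [y f]]]].
    suff -> : b = m by exact: flip_cover f.
    apply/eqP; apply: contraT => bm; have := nab m (in_D _ mD).
    have [_ _ -> _] := flip_cover f.
    by rewrite lt_neqAle eq_sym bm mle.
  have [_ _ mr _] := flip_cover f.
  by have := lt_le_trans (lt_trans mr ab) (lem _ bD'); rewrite ltxx.
- subst b; case: bd => [[mle [x [y f]]]|[lem [x [y f]]]].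
    have [_ _ rm _] := flip_cover f.
    by have := lt_le_trans (lt_trans ab rm) (mle _ aD'); rewrite ltxx.
  suff -> : a = m by exact: flip_cover f.
  apply/eqP; apply: contraT => am; have := nab m (in_D _ mD).
  have [_ _ -> _] := flip_cover f.
  by rewrite lt_neqAle am lem.
- by apply: cD; split=> // q /in_D; apply: nab.
Qed.

Lemma dcs_add_bot D m r x y : distributive_covering_sublattice D -> m \in D ->
  (forall q, q \in D -> m <= q) -> flip r m x y ->
  distributive_covering_sublattice (r |: D).
Proof.
move=> [[mD jD] dsD cD] mm mle f.
have rle q : q \in D -> r <= q by move=> /mle; apply: le_trans (flip_le f : r <= m).
have rle' q : (q == r) || (q \in D) -> r <= q by case/orP=> [/eqP->//|/rle].
split; last by apply: (covering_add cD mm); left; split=> //; exists x, y.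
- split=> a b; rewrite !in_setU1 => /orP[/eqP->|aD] /orP[/eqP->|bD].
  + by rewrite meetxx eqxx.
  + by rewrite (meet_l (rle _ bD)) eqxx.
  + by rewrite (meet_r (rle _ aD)) eqxx.
  + by rewrite mD // orbT.
  + by rewrite joinxx eqxx.
  + by rewrite (join_r (rle _ bD)) bD orbT.
  + by rewrite (join_l (rle _ aD)) aD orbT.
  + by rewrite jD // orbT.
- move=> a b c; rewrite !in_setU1 => /orP[/eqP->|aD] hb hc.
    have hbc : r <= b `|` c := le_trans (rle' _ hb) (leUl b c).
    by rewrite (meet_l hbc) (meet_l (rle' _ hb)) (meet_l (rle' _ hc)) joinxx.
  have ra := rle _ aD; move: hb hc => /orP[/eqP->|bD] /orP[/eqP->|c_D].
  + by rewrite !joinxx.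
  + by rewrite (meet_r ra) (join_r (rle _ c_D)) join_r // lexI ra rle.
  + by rewrite (meet_r ra) (join_l (rle _ bD)) join_l // lexI ra rle.
  + exact: dsD.
Qed.

Lemma dcs_add_top D m r x y : distributive_covering_sublattice D -> m \in D ->
  (forall q, q \in D -> q <= m) -> flip m r x y ->
  distributive_covering_sublattice (r |: D).
Proof.
move=> [[mD jD] dsD cD] mm lem f.
have ler q : q \in D -> q <= r by move=> /lem h; apply: le_trans h (flip_le f : m <= r).
have ler' q : (q == r) || (q \in D) -> q <= r by case/orP=> [/eqP->//|/ler].
split; last by apply: (covering_add cD mm); right; split=> //; exists x, y.
- split=> a b; rewrite !in_setU1 => /orP[/eqP->|aD] /orP[/eqP->|bD].
  + by rewrite meetxx eqxx.
  + by rewrite (meet_r (ler _ bD)) bD orbT.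
  + by rewrite (meet_l (ler _ aD)) aD orbT.
  + by rewrite mD // orbT.
  + by rewrite joinxx eqxx.
  + by rewrite (join_l (ler _ bD)) eqxx.
  + by rewrite (join_r (ler _ aD)) eqxx.
  + by rewrite jD // orbT.
- move=> a b c; rewrite !in_setU1 => /orP[/eqP->|aD] hb hc.
    have hbc : b `|` c <= r by rewrite leUx !ler'.
    by rewrite (meet_r hbc) (meet_r (ler' _ hb)) (meet_r (ler' _ hc)).
  have ra := ler _ aD; move: hb hc => /orP[/eqP->|bD] /orP[/eqP->|c_D].
  + by rewrite !joinxx.
  + by rewrite (join_l (ler _ c_D)) (meet_l ra) join_l // leIl.
  + by rewrite (join_r (ler _ bD)) (meet_l ra) join_r // leIl.
  + exact: dsD.
Qed.

(** A maximal distributive covering sublattice reaches both ends of the weak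
    order: otherwise a new bottom or top could be adjoined, one flip away. *)
Lemma dcs_maximal_bounds D : inclusion_maximal (@distributive_covering_sublattice n) D ->
  alpha n \in D /\ omega n \in D.
Proof.
case=> dD mx; have [[mD jD] dsD cD] := dD.
have [s0 s0D] : exists s, s \in D.
  apply/set0Pn; apply/eqP => D0; have : [set alpha n] = D.
    apply: mx; last by rewrite D0 sub0set.
    split; first by split=> a b; rewrite !inE => /eqP-> /eqP->; rewrite ?meetxx ?joinxx.
      by move=> a b c; rewrite !inE => /eqP-> /eqP-> /eqP->; rewrite !(meetxx, joinxx).
    by move=> a b [/set1P-> /set1P->]; rewrite ltxx.
  by move/setP/(_ (alpha n)); rewrite D0 !inE eqxx.
split.
  case: (arg_minnP (fun r => #|Inv r|) s0D) => m m_D mmin.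
  have mle r : r \in D -> m <= r.
    move=> rD; have := mmin (m `&` r) (mD _ _ m_D rD); rewrite leqNgt => h.
    apply/meet_idPl; apply/eqP; apply: contraNT h => /eqP ne.
    exact: lebr_card (leIl m r) ne.
  have [<- //|/eqP ne] := eqVneq m (alpha n).
  have [r [x [y f]]] : exists r x y, flip r m x y.
    pose P r := r < m; have P0 : P (alpha n).
      have am : (alpha n : linord n) <= m := lebr_alpha m.
      by rewrite /P lt_neqAle am andbT eq_sym; apply/eqP.
    case: (arg_maxnP (fun r => #|Inv r|) P0) => r rm rmax; exists r.
    apply: cover_flip; split; rewrite ?in_setT // => q _; apply/negP => /andP[rq qm].
    have := rmax q qm; rewrite /= leqNgt; move: rq; rewrite lt_neqAle => /andP[/eqP n1 l1].
    by rewrite (lebr_card l1 n1).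
  have h : r |: D = D by apply: mx (dcs_add_bot dD m_D mle f) (subsetUr _ _).
  have rD : r \in D by rewrite -h setU11.
  by have [_ _ rm _] := flip_cover f; have := mle _ rD; rewrite (lt_geF rm).
case: (arg_maxnP (fun r => #|Inv r|) s0D) => m m_D mmax.
have lem r : r \in D -> r <= m.
  move=> rD; have := mmax (r `|` m) (jD _ _ rD m_D); rewrite /= leqNgt => h.
  suff <- : r `|` m = m by rewrite leUl.
  apply/eqP; apply: contraNT h => /eqP ne.
  by apply: lebr_card (leUr m r) _ => e; case: ne.
have [<- //|/eqP ne] := eqVneq m (omega n).
have [r [x [y [f _]]]] := bruhat_succ (lebr_omega m) ne.
have h : r |: D = D by apply: mx (dcs_add_top dD m_D lem f) (subsetUr _ _).
have rD : r \in D by rewrite -h setU11.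
by have [_ _ mr _] := flip_cover f; have := lem _ rD; rewrite (lt_geF mr).
Qed.

Lemma dcs_realized D : inclusion_maximal (@distributive_covering_sublattice n) D <-> realized D.
Proof.
split=> [mx|[u ru ->]].
  have [aD oD] := dcs_maximal_bounds mx; case: mx => dD mx.
  have [C fC [CD Dc]] := dcs_flag dD aD oD.
  have ru := flag_realizable fC (flag_sub_cup fC).
  by exists (cup C) => //; apply/esym; apply: mx => //; apply: dom_dcs.
split=> [|D' dD' sub]; first exact: dom_dcs.
have [C fC Cu] := realizable_flag ru.
have uD' := fintype.subsetP sub.
have C_D' := fintype.subset_trans Cu sub.
apply/eqP; rewrite eqEsubset sub andbT (dom_eq (cup_uniq fC Cu)).
apply: (closed_sub_cup fC C_D') => s t sD tD.
by have [a b] := dcs_closed dD' sD tD; split; [exists (s `|` t)|exists (s `&` t)].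
Qed.

(** * Peak-pit domains inside domains of flags *)

(** The condition on triples in the definition of a peak-pit domain. *)
Definition peak_pit_triples D : Prop := forall i j k, (i < j)%N -> (j < k)%N ->
  {in D, forall s, notfirst s i j k} \/ {in D, forall s, notlast s i j k}.

Lemma peak_pitP D : peak_pit D <-> [/\ alpha n \in D, omega n \in D & peak_pit_triples D].
Proof.
have R s q v := restriction_D3 s q v.
split=> -[aD oD h]; split=> //.
  move=> i j k ij jk; have ijk : (i < j < k)%N by rewrite ij.
  pose q : triple n := Sub (i, j, k) ijk.
  by case: (h q) => hq; [left|right] => s sD; have := hq s sD;
    [have := R s q Cap|have := R s q Cup]; rewrite /= => ->.
move=> q; have := fun s => R s q Cap; have := fun s => R s q Cup.
case E: q => [[[i j] k] /= ijk]; rewrite -E => Rup Rap; have [ij jk] := andP ijk.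
by case: (h i j k ij jk) => hq; [left|right] => s sD; rewrite ?Rup ?Rap; apply: hq.
Qed.

Lemma dom_peak_pit u : peak_pit (@cdom n u).
Proof.
apply/peak_pitP; split; [exact: dom_alpha|exact: dom_omega|].
move=> i j k ij jk; case E: (u i j k); [right|left] => s /cdomP/(_ i j k ij jk);
  by rewrite /conforms E.
Qed.

(** A flag of [cdom u] takes on each triple a value that is not cap or a value
    that is not cup, according to [u], so [D] must follow [u]. *)
Lemma pp_sub_dom u D : realizable u -> cdom u \subset D -> peak_pit_triples D -> D = cdom u.
Proof.
move=> ru sub ppD; have [C fC Cu] := realizable_flag ru.
have CD := fintype.subsetP (fintype.subset_trans Cu sub).
apply/eqP; rewrite eqEsubset sub andbT; apply/fintype.subsetP => s sD.
apply/cdomP => i j k ij jk; have [a [b [aC bC f h]]] := flag_triple fC ij jk.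
have /cdomP/(_ i j k ij jk) := fintype.subsetP Cu _ aC.
rewrite /conforms; case: (ppD i j k ij jk) => hD; have := hD a (CD _ aC);
  have := hD s sD; case: (u i j k) => //; rewrite ?notfirstE ?notlastE // h;
  by case: (_ \in Inv a).
Qed.
End DistributiveCovering.

(** * Initial sets and paths *)

Section InitialSets.
Variable n : nat.
Implicit Types (s t r p q : linord n) (i j k x y z e f : 'I_n).
Implicit Types (A B P Q : {set 'I_n}) (u : 'I_n -> 'I_n -> 'I_n -> bool).

Definition initial s P : Prop := forall x y, x \in P -> y \notin P -> before s x y.

(** Strong separation: if the sets alternated, the middle element of the triple
    would be last in [s] and first in [t], against both cup and cap. *)
Lemma initial_separated u s t A B i j k : s \in cdom u -> t \in cdom u ->
  initial s A -> initial t B -> i < j -> j < k ->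
  i \in A -> i \notin B -> k \in A -> k \notin B -> j \in B -> j \notin A -> False.
Proof.
move=> /cdomP su /cdomP tu sA tB ij jk iA iB kA kB jB jA.
have := su i j k ij jk; have := tu i j k ij jk.
rewrite /conforms /notlast /notfirst (before_asym (sA _ _ iA jA)) (before_asym (tB _ _ jB iB)).
by rewrite (before_asym (sA _ _ kA jA)) (before_asym (tB _ _ jB kB)); case: (u i j k).
Qed.

Lemma initial_Inv s P x y : initial s P -> x < y -> (x \in P) != (y \in P) ->
  ((x, y) \in Inv s) = (y \in P).
Proof.
move=> sP xy; case: (boolP (y \in P)) => yP; case: (boolP (x \in P)) => xP //= _.
  by rewrite -before_Inv // sP.
by apply/negbTE; rewrite -before_nInv // sP.
Qed.

(** Splicing [s] inside [P] with [t] outside stays in the domain: a triple with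
    at least two elements in [P] is ordered as in [s], any other as in [t]. *)
Lemma splice u s t P : s \in cdom u -> t \in cdom u -> initial s P -> initial t P ->
  exists r, [/\ r \in cdom u, initial r P,
    forall x y, x \in P -> y \in P -> before r x y = before s x y &
    forall x y, x \notin P -> y \notin P -> before r x y = before t x y].
Proof.
move=> /dom_ideal[_ is_] /dom_ideal[_ it] sP tP.
pose I (q : 'I_n * 'I_n) := if (q.1 \in P) && (q.2 \in P) then q \in Inv s else q \in Inv t.
have [|r ru e] := @ideal_dom n u [set q : 'I_n * 'I_n | (q.1 < q.2) && I q].
  apply: ideal_all => i j k ij jk; have ik := ltn_trans ij jk.
  have := is_ i j k ij jk; have := it i j k ij jk; rewrite /I /=.
  have sI := @initial_Inv s P _ _ sP; have tI := @initial_Inv t P _ _ tP.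
  have := sI _ _ ij; have := sI _ _ jk; have := sI _ _ ik.
  have := tI _ _ ij; have := tI _ _ jk; have := tI _ _ ik.
  rewrite /ideal_at; case: (i \in P); case: (j \in P); case: (k \in P) => //=;
    do 6![first [move/(_ isT)=> ->|move=> _]];
    by case: (u i j k) => // -[h1 h2] [h3 h4]; split=> // ?; by [apply: h1|apply: h2|apply: h3|apply: h4].
have rE x y : x < y -> ((x, y) \in Inv r) = I (x, y).
  by move=> xy; rewrite e inE xy.
exists r; split=> // [x y xP yP|x y xP yP|x y xP yP].
- case: (ltngtP x y) => [xy|yx|/val_inj exy]; last by rewrite -exy xP in yP.
    by rewrite before_nInv // rE // /I /= (negbTE yP) andbF -before_nInv // tP.
  by rewrite before_Inv // rE // /I /= (negbTE yP) /= -before_Inv // tP.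
- case: (ltngtP x y) => [xy|yx|/val_inj ->]; last by rewrite !before_irr.
    by rewrite !before_nInv // rE // /I /= xP yP.
  by rewrite !before_Inv // rE // /I /= xP yP.
- case: (ltngtP x y) => [xy|yx|/val_inj ->]; last by rewrite !before_irr.
    by rewrite !before_nInv // rE // /I /= (negbTE xP).
  by rewrite !before_Inv // rE // /I /= (negbTE yP).
Qed.

(** The direction-free form of a flip: [p] and [q] differ by the exchange of
    the neighbours [e], [f]. *)
Definition swapped p q e f : Prop :=
  [/\ before p e f, before q f e &
      forall x y, (x, y) <> (e, f) -> (x, y) <> (f, e) -> before q x y = before p x y].

Lemma flip_swapped s t x y : flip s t x y -> swapped s t x y /\ swapped t s y x.
Proof.
move=> fl; have a := flip_before_s fl; have b := flip_before_t fl.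
split; split=> // v w ? ?; first exact: (flip_before fl).
by apply/esym; apply: (flip_before fl).
Qed.

Lemma swapped_adj p q e f z : swapped p q e f -> z != e -> z != f ->
  before p z e = before p z f /\ before p e z = before p f z.
Proof.
case=> pef qfe h ze zf.
have h1 : before q z e = before p z e.
  by apply: h => -[]; [move/eqP; rewrite (negbTE ze)|move/eqP; rewrite (negbTE zf)].
have h2 : before q z f = before p z f.
  by apply: h => -[]; [move/eqP; rewrite (negbTE ze)|move/eqP; rewrite (negbTE zf)].
have ez : before p z e = before p z f.
  apply/idP/idP => k; first exact: before_trans k pef.
  by rewrite -h1; apply: before_trans qfe; rewrite h2.
by split=> //; rewrite (beforeN p ze) (beforeN p zf) ez.
Qed.

(** When the step from [P] to [z |: P] is destroyed by an exchange, the
    exchange takes place either just before or just after this step. *)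
Lemma edge_lost p q e f P z : swapped p q e f -> z \notin P ->
  initial p P -> initial p (z |: P) -> ~ (initial q P /\ initial q (z |: P)) ->
  [/\ e \in P, f = z & initial q (z |: P :\ e)] \/
  [/\ e = z, f \notin z |: P, initial q P, initial q (f |: P) & initial q (f |: (z |: P))].
Proof.
move=> sw zP pP pzP no; case: (sw) => pef qfe hsame.
have lost A : initial p A -> ~ initial q A -> e \in A /\ f \notin A.
  move=> pA nqA; have [x [y [xA yA nb]]] : exists x y, [/\ x \in A, y \notin A & ~~ before q x y].
    apply: contrapT => ne; apply: nqA => x y xA yA; apply: contraT => nb.
    by case: ne; exists x, y.
  have [[<- <-] //|/eqP n1] := eqVneq (x, y) (e, f).
  have [[ex ey]|/eqP n2] := eqVneq (x, y) (f, e).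
    by have := before_asym (pA _ _ xA yA); rewrite ex ey pef.
  by case/negP: nb; rewrite hsame // pA.
have keep x y : before p x y -> (x, y) <> (e, f) -> before q x y.
  move=> pxy ne; rewrite hsame // => -[ex ey].
  by have := before_asym pxy; rewrite ex ey pef.
case: (pselect (initial q P)) => qP.
  have [ezP fzP] : e \in z |: P /\ f \notin z |: P by apply: lost => // h; apply: no.
  have fP : f \notin P by apply: contra fzP => h; rewrite in_setU1 h orbT.
  have ez : e = z.
    move: ezP; rewrite in_setU1 => /orP[/eqP//|eP].
    by have := before_asym (qP _ _ eP fP); rewrite qfe.
  have after y : y \notin P -> y != f -> before q f y.
    move=> yP yf; have [->|yz] := eqVneq y z; first by rewrite -ez.
    have ye : y != e by rewrite ez.
    apply: keep; last by case=> /eqP; rewrite eq_sym => ee; case/negP: fzP; rewrite in_setU1 -ez -(eqP ee) eqxx.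
    have [_ <-] := swapped_adj sw ye yf; rewrite ez; apply: pzP; first by rewrite setU11.
    by rewrite in_setU1 negb_or yz.
  right; split=> //.
    move=> x y; rewrite !in_setU1 negb_or => /orP[/eqP->|xP] /andP[yf yP].
      exact: after.
    exact: qP.
  move=> x y; rewrite in_setU1 => /orP[/eqP->|xzP]; rewrite !in_setU1 !negb_or => /and3P[yf yz yP].
    exact: after.
  apply: keep; first by apply: pzP => //; rewrite in_setU1 negb_or yz.
  by case=> _ ey; rewrite ey eqxx in yf.
have [eP fP] := lost _ pP qP.
have ze : z != e by apply: contraNneq zP => ->.
have fz : f = z.
  apply: contrapT => /eqP fz; rewrite eq_sym in fz.
  have [h _] := swapped_adj sw ze fz.
  have : before p z f by apply: pzP; rewrite ?setU11 // in_setU1 negb_or eq_sym fz.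
  by rewrite -h (before_asym (pP _ _ eP zP)).
left; split=> // x y; rewrite !inE !negb_or !negb_and negbK.
case/orP=> [/eqP->|/andP[xe xP]] /andP[yz ye].
  have [->|ne] := eqVneq y e; first by rewrite -fz.
  rewrite (negbTE ne) /= in ye; apply: keep; last by move=> [ez _]; rewrite ez eqxx in ze.
  by apply: pzP; rewrite ?setU11 // in_setU1 negb_or yz.
have xnz : x != z by apply: contraNneq zP => <-.
have [->|ne] := eqVneq y e.
  apply: keep; last by move=> [ex _]; rewrite ex eqxx in xe.
  have xf : x != f by rewrite fz.
  by have [-> _] := swapped_adj sw xe xf; rewrite fz pP.
rewrite (negbTE ne) /= in ye; apply: keep; last by move=> [ex _]; rewrite ex eqxx in xe.
exact: pP.
Qed.

(** The witness is the first element of [s] outside [P]. *)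
Lemma initial_next s P x0 : initial s P -> x0 \notin P ->
  exists2 z, z \notin P & initial s (z |: P).
Proof.
move=> sP x0P; case: (@arg_minnP _ x0 (fun z => z \notin P) (fun z => (s^-1)%g z : nat) x0P) => z zP zmin.
exists z => // x y; rewrite !in_setU1 negb_or => /orP[/eqP->|xP] /andP[yz yP].
  by rewrite (@beforeN _ s y z) // /before -leqNgt zmin.
exact: sP.
Qed.

(** Suppose no step out of [P] leads into [Q]. The steps out of [P] lie on
    either side of a given [x0] in [Q :\: P]; the one closest to [x0] above it
    (or, if there is none, the largest) can be destroyed by moving the order
    down (or up), and the exchange that destroys it exhibits an initial set
    which is not strongly separated from [Q]. *)
Lemma step_towards u s t P Q : realizable u -> s \in cdom u -> t \in cdom u ->
  initial s P -> initial t Q -> P \proper Q ->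
  exists r x, [/\ r \in cdom u, initial r P, x \in Q, x \notin P & initial r (x |: P)].
Proof.
move=> ru su tu sP tQ /properP[PQ [x0 x0Q x0P]].
apply: contrapT => none.
pose path r z := [/\ r \in cdom u, initial r P, z \notin P & initial r (z |: P)].
have outQ r z : path r z -> z \notin Q.
  by case=> rd rP zP rzP; apply/negP => zQ; apply: none; exists r, z.
pose edge z := `[< exists r, path r z >].
have [z0 ez0] : exists z, edge z.
  by have [z zP sz] := initial_next sP x0P; exists z; apply/asboolP; exists s.
case: (pselect (exists z, edge z && (x0 < z))) => [[z1 e1]|nup].
  case: (@arg_minnP _ z1 (fun z => edge z && (x0 < z)) (fun z => z : nat) e1) => z /andP[/asboolP[r1 pr1] x0z] zmin.
  have zQ := outQ _ _ pr1.
  pose W r := `[< path r z >]; have W1 : W r1 by apply/asboolP.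
  case: (arg_minnP (fun r => #|Inv r|) W1) => r /asboolP[rd rP zP rzP] rmin.
  have rzx0 : before r z x0.
    apply: rzP; first by rewrite setU11.
    by rewrite in_setU1 negb_or x0P andbT; apply: contraNneq zQ => <-.
  have ra : alpha n <> r.
    by move=> ea; move: rzx0; rewrite -ea before_alpha ltnNge ltnW.
  have [r' [x [y [r'd fl _]]]] := dom_pred ru (dom_alpha u) rd (lebr_alpha r) ra.
  have lt : #|Inv r'| < #|Inv r| by rewrite (flip_card fl).
  have xy : x < y by case: (fl).
  have [_ sw] := flip_swapped fl.
  have [|[yP xz L]|[yz xzP r'P r'x r'xz]] := edge_lost sw zP rP rzP.
  - move=> [r'P r'zP]; have : W r' by apply/asboolP.
    by move/rmin; rewrite leqNgt lt.
  - subst x; apply: (@initial_separated u t r' Q (z |: P :\ y) x0 z y tu r'd tQ L x0z xy) => //.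
    + by rewrite !inE (negbTE x0P) andbF orbF; apply: contraNneq zQ => <-.
    + exact: (fintype.subsetP PQ).
    + by rewrite !inE eqxx orbF -val_eqE gtn_eqF.
    + by rewrite setU11.
  - subst y; have [xz' xP] : x != z /\ x \notin P.
      by move: xzP; rewrite in_setU1 negb_or => /andP[].
    have px : path r' x by split.
    have xQ := outQ _ _ px.
    have xx0 : x < x0.
      case: (ltngtP x x0) => [//|x0x|/val_inj ex]; last by rewrite ex x0Q in xQ.
      have /zmin : edge x && (x0 < x) by rewrite x0x andbT; apply/asboolP; exists r'.
      by rewrite leqNgt xy.
    apply: (@initial_separated u r' t (x |: (z |: P)) Q x x0 z r'd tu r'xz tQ xx0 x0z) => //.
    + by rewrite setU11.
    + by rewrite !inE eqxx orbT.
    + rewrite !inE !negb_or x0P andbT; apply/andP; split.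
        by rewrite -val_eqE gtn_eqF.
      by rewrite -val_eqE ltn_eqF.
case: (@arg_maxnP _ z0 edge (fun z => z : nat) ez0) => z /asboolP[r1 pr1] zmax.
have zQ := outQ _ _ pr1.
have zx0 : z < x0.
  case: (ltngtP z x0) => [//|x0z|/val_inj ex]; last by rewrite ex x0Q in zQ.
  by case: nup; exists z; rewrite x0z andbT; apply/asboolP; exists r1.
pose W r := `[< path r z >]; have W1 : W r1 by apply/asboolP.
case: (arg_maxnP (fun r => #|Inv r|) W1) => r /asboolP[rd rP zP rzP] rmax.
have rzx0 : before r z x0.
  apply: rzP; first by rewrite setU11.
  by rewrite in_setU1 negb_or x0P andbT; apply: contraNneq zQ => <-.
have ro : r <> omega n.
  by move=> eo; move: rzx0; rewrite eo before_omega ltnNge ltnW.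
have [r' [x [y [r'd fl _]]]] := dom_succ ru rd (dom_omega u) (lebr_omega r) ro.
have lt : #|Inv r| < #|Inv r'| by rewrite (flip_card fl).
have xy : x < y by case: (fl).
have [sw _] := flip_swapped fl.
have [|[xP yz L]|[xz yzP r'P r'y _]] := edge_lost sw zP rP rzP.
- move=> [r'P r'zP]; have : W r' by apply/asboolP.
  by move/rmax; rewrite /= leqNgt lt.
- subst y; apply: (@initial_separated u t r' Q (z |: P :\ x) x z x0 tu r'd tQ L xy zx0) => //.
  + exact: (fintype.subsetP PQ).
  + by rewrite !inE eqxx orbF -val_eqE ltn_eqF.
  + by rewrite !inE (negbTE x0P) andbF orbF; apply: contraNneq zQ => <-.
  + by rewrite setU11.
- subst x; have ey : edge y.
    apply/asboolP; exists r'; split=> //.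
    by move: yzP; rewrite in_setU1 negb_or => /andP[].
  by have := zmax y ey; rewrite /= leqNgt xy.
Qed.

(** One step towards [Q] at a time, splicing the orders obtained. *)
Lemma common_path u s t P Q : realizable u -> s \in cdom u -> t \in cdom u ->
  initial s P -> initial t Q -> P \subset Q ->
  exists r, [/\ r \in cdom u, initial r P & initial r Q].
Proof.
move=> ru; move e : #|Q :\: P| => d; elim: d s P e => [|d IH] s P e su tu sP tQ PQ.
  exists s; split=> //; suff -> : Q = P by [].
  apply/eqP; rewrite eqEsubset PQ andbT -setD_eq0; exact/eqP/cards0_eq.
have pPQ : P \proper Q.
  rewrite properE PQ /= -setD_eq0 -cards_eq0 e //.
have [r [x [rd rP xQ xP rx]]] := step_towards ru su tu sP tQ pPQ.
have xD : x \in Q :\: P by rewrite inE xP.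
have e' : #|Q :\: (x |: P)| = d.
  move: e; rewrite (cardsD1 x) xD => -[<-]; apply: eq_card => y.
  by rewrite !inE negb_or andbA.
have xPQ : x |: P \subset Q.
  by apply/fintype.subsetP => y; rewrite in_setU1 => /orP[/eqP->//|]; apply: (fintype.subsetP PQ).
have [r' [r'd r'x r'Q]] := IH r (x |: P) e' rd tu rx tQ xPQ.
have [q [qd qx qlo qhi]] := splice rd r'd rx r'x.
exists q; split=> // a b aP bP.
  have ax : a \in x |: P by rewrite in_setU1 aP orbT.
  case: (boolP (b \in x |: P)) => bx; first by rewrite qlo // rP.
  exact: qx.
have bx : b \notin x |: P.
  rewrite in_setU1 negb_or; apply/andP; split; first by apply: contraNneq bP => ->.
  by apply: contra bP; apply: (fintype.subsetP PQ).
case: (boolP (a \in x |: P)) => ax; first exact: qx.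
by rewrite qhi // r'Q.
Qed.
End InitialSets.

(** * Every peak-pit domain lies in the domain of a flag *)

Section PeakPitExtension.
Variables (n : nat) (D : {set linord n}).
Hypothesis ppD : peak_pit_triples D.
Implicit Types (s t r : linord n) (i j k x y z : 'I_n).

(** For the largest element [w] of a prefix of the ground set, the position of
    [w] in [s] forces inversions ([forced]) and forbids others ([barred]): the
    pairs [i < j < w] inverted before [w] passes are the pairs whose triple
    with [w] is cup. *)
Definition forced (w : 'I_n) s i j : bool := [&& i < j, j < w, before s j i & before s j w].
Definition barred (w : 'I_n) s i j : bool := [&& i < j, j < w, before s i j & before s w j].

(** A conflict would exhibit the middle element [j] of the triple [i, j, w]
    first in one member of [D] and last in another one. *)
Lemma forced_barred w s t i j : s \in D -> t \in D -> forced w s i j -> ~~ barred w t i j.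
Proof.
move=> sD tD /and4P[ij jw ji sjw]; rewrite /barred ij jw /=.
case: (ppD ij jw) => h.
  by have := h s sD; rewrite /notfirst (before_asym ji) (before_asym sjw).
apply/negP => /andP[tij twj]; have := h t tD.
by rewrite /notlast (before_asym tij) (before_asym twj).
Qed.

Definition preceding (w : 'I_n) s : {set 'I_n} := [set x : 'I_n | (x < w) && before s x w].

(** Two elements separating the sets in both directions form with [w] a triple
    whose middle element is last in one order and first in the other. *)
Lemma preceding_total w s t : s \in D -> t \in D ->
  preceding w s \subset preceding w t \/ preceding w t \subset preceding w s.
Proof.
move=> sD tD.
have main a b x y : a \in D -> b \in D -> x \in preceding w a -> x \notin preceding w b ->
    y \in preceding w b -> y \notin preceding w a -> x < y -> False.
  move=> aD bD; rewrite !inE => /andP[xw ax]; rewrite xw /= => nbx.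
  move=> /andP[yw byw]; rewrite yw /= => nay xy.
  have bx : before b w x by rewrite (@beforeN _ b x w) // ord_lt_neq.
  have ay : before a w y by rewrite (@beforeN _ a y w) // ord_lt_neq.
  have axy := before_trans ax ay; have byx := before_trans byw bx.
  case: (ppD xy yw) => h.
    by have := h b bD; rewrite /notfirst (before_asym byx) (before_asym byw).
  by have := h a aD; rewrite /notlast (before_asym axy) (before_asym ay).
case: (boolP (preceding w s \subset preceding w t)) => [|/fintype.subsetPn[x xs xt]]; first by left.
right; apply/fintype.subsetP => y yt; apply: contraT => ys; exfalso.
case: (ltngtP x y) => [xy|yx|/val_inj e]; last by rewrite e yt in xt.
  exact: (main s t x y).
exact: (main t s y x).
Qed.

Section Step.
Variables (w : 'I_n) (u : 'I_n -> 'I_n -> 'I_n -> bool).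
Hypothesis ru : realizable u.
(* [tr s] is [s] below [w], followed by the remaining elements in increasing
   order *)
Variable tr : linord n -> linord n.
Hypothesis tr_dom : {in D, forall s, tr s \in cdom u}.
Hypothesis tr_Inv : forall s i j, ((i, j) \in Inv (tr s)) = (j < w) && ((i, j) \in Inv s).

Lemma tr_before s x y : x < w -> y < w -> before (tr s) x y = before s x y.
Proof.
move=> xw yw; case: (ltngtP x y) => [xy|yx|/val_inj ->]; last by rewrite !before_irr.
  by rewrite !before_nInv // tr_Inv yw.
by rewrite !before_Inv // tr_Inv xw.
Qed.

Lemma tr_initial s : initial (tr s) (preceding w s).
Proof.
move=> x y; rewrite !inE => /andP[xw sxw] ny; case: (boolP (y < w)) ny => [yw /= nsy|wy _].
  rewrite tr_before //; apply: before_trans sxw _.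
  by rewrite (@beforeN _ s y w) // ord_lt_neq.
have xy : x < y by rewrite -leqNgt in wy; apply: leq_trans xw wy.
by rewrite before_nInv // tr_Inv (negbTE wy).
Qed.

Lemma barred_after s i j : barred w s i j -> j \notin preceding w s.
Proof. by case/and4P=> _ jw _ wj; rewrite inE jw /= (before_asym wj). Qed.

Lemma forced_preceding s i j : forced w s i j -> j \in preceding w s.
Proof. by case/and4P=> _ jw _ sj; rewrite inE jw. Qed.

Lemma barredI s i j : i < j -> j < w -> j \notin preceding w s ->
  before (tr s) i j -> barred w s i j.
Proof.
move=> ij jw; rewrite inE jw /= => nj; rewrite tr_before ?(ltn_trans ij jw) // => sij.
by rewrite /barred ij jw sij (@beforeN _ s j w) // ord_lt_neq.
Qed.

Lemma forcedI s i j : i < j -> j < w -> j \in preceding w s ->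
  before (tr s) j i -> forced w s i j.
Proof.
move=> ij jw; rewrite inE jw /= => nj; rewrite tr_before ?(ltn_trans ij jw) // => sij.
by rewrite /forced ij jw sij.
Qed.

(** The sets preceding [w] in [s] and [t] are nested. If that of [s] is the
    smaller, follow [s] up to it, then a common path, then [t] from the other
    set on. Otherwise follow the join up to the set of [t], then [t]. *)
Lemma separator s t : s \in D -> t \in D -> exists r, [/\ r \in cdom u,
  forall i j, forced w s i j -> before r j i &
  forall i j, barred w t i j -> before r i j].
Proof.
move=> sD tD; set P := preceding w s; set Q := preceding w t.
have sP : initial (tr s) P by apply: tr_initial.
have tQ : initial (tr t) Q by apply: tr_initial.
have [sd td] := (tr_dom sD, tr_dom tD).
have fP i j : forced w s i j -> before (tr s) j i.
  by case/and4P=> ij jw ji _; rewrite tr_before // (ltn_trans ij jw).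
have bQ i j : barred w t i j -> before (tr t) i j.
  by case/and4P=> ij jw ji _; rewrite tr_before // (ltn_trans ij jw).
case: (preceding_total w sD tD) => PQ.
  have [k [kd kP kQ]] := common_path ru sd td sP tQ PQ.
  have [r1 [r1d r1P lo1 hi1]] := splice sd kd sP kP.
  have r1Q : initial r1 Q.
    move=> x y xQ yQ; have yP : y \notin P by apply: contra yQ; apply: (fintype.subsetP PQ).
    case: (boolP (x \in P)) => xP; first exact: r1P.
    by rewrite hi1 // kQ.
  have [r [rd rQ lo hi]] := splice r1d td r1Q tQ; exists r; split=> // i j h.
    have jP := forced_preceding h; have jQ := fintype.subsetP PQ _ jP.
    case: (boolP (i \in Q)) => iQ; last exact: rQ.
    rewrite lo //; case: (boolP (i \in P)) => iP; last exact: r1P.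
    by rewrite lo1 // fP.
  have jQ := barred_after h.
  case: (boolP (i \in Q)) => iQ; first exact: rQ.
  by rewrite hi // bQ.
have [jd eJ] := dom_join sd td; set q := joinbr _ _ in jd eJ.
have qQ : initial q Q.
  move=> x y xQ yQ; have txy := tQ x y xQ yQ.
  case: (ltngtP x y) => [xy|yx|/val_inj e]; last by rewrite -e xQ in yQ.
    rewrite before_nInv // eJ in_setU negb_or -!before_nInv // txy andbT.
    apply: contraT; rewrite -(@beforeN _ _ x y) ?ord_lt_neq // => syx.
    have yP : y \in P.
      by apply: contraT => yP; have := before_asym (sP x y (fintype.subsetP PQ _ xQ) yP); rewrite syx.
    have yw : y < w by move: yP; rewrite inE => /andP[].
    have := forced_barred sD tD (forcedI xy yw yP syx).
    by rewrite (barredI xy yw yQ txy).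
  by rewrite before_Inv // eJ in_setU -!before_Inv // txy orbT.
have [r [rd rQ lo hi]] := splice jd td qQ tQ; exists r; split=> // i j h.
  have [ij jw] : i < j /\ j < w by case/and4P: h.
  have nb := forced_barred sD tD h; have ne := ord_lt_neq ij.
  case: (boolP (j \in Q)) => jQ.
    case: (boolP (i \in Q)) => iQ; last exact: rQ.
    by rewrite lo // before_Inv // eJ in_setU -!before_Inv // fP.
  case: (boolP (i \in Q)) => iQ.
    by rewrite (barredI ij jw jQ (tQ _ _ iQ jQ)) in nb.
  rewrite hi // (beforeN _ ne); apply: contra nb; exact: barredI.
have jQ := barred_after h.
case: (boolP (i \in Q)) => iQ; first exact: rQ.
by rewrite hi // bQ.
Qed.

(** The inversions of [r] are the pairs that, for some [s] in [D], are inverted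
    in all members of the domain complying with the pairs forced by [s]; this is
    a down-set, and [separator] shows that it avoids every barred pair. *)
Lemma separating_path : exists r, [/\ r \in cdom u,
  forall s i j, s \in D -> forced w s i j -> before r j i &
  forall s i j, s \in D -> barred w s i j -> before r i j].
Proof.
pose up s r := r \in cdom u /\ forall i j, forced w s i j -> before r j i.
pose Q (p : 'I_n * 'I_n) := `[< exists2 s, s \in D & forall r, up s r -> p \in Inv r >].
have [|r rd e] := @ideal_dom n u [set p : 'I_n * 'I_n | (p.1 < p.2) && Q p].
  apply: ideal_all => i j k ij jk.
  have lift p p' : (forall r, r \in cdom u -> p \in Inv r -> p' \in Inv r) -> Q p -> Q p'.
    move=> imp /asboolP[s sD h]; apply/asboolP; exists s => // r upr.
    by apply: imp (h r upr); case: upr.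
  have id r : r \in cdom u -> ideal_at (u i j k) (Inv r) i j k.
    by move=> /dom_ideal[_]; apply.
  by case: (u i j k) id => id; split; apply: lift => r rd; have [] := id r rd.
exists r; split=> // s i j sD h.
  have [ij jw] : i < j /\ j < w by case/and4P: h.
  rewrite before_Inv // e inE ij /=; apply/asboolP; exists s => // q [qd up_q].
  by rewrite -before_Inv // up_q.
have [ij jw] : i < j /\ j < w by case/and4P: h.
rewrite before_nInv // e inE ij /=; apply/asboolP => -[t tD up_t].
have [q [qd qf qb]] := separator tD sD.
by have := up_t q (conj qd qf); rewrite -before_Inv // (before_asym (qb _ _ h)).
Qed.
End Step.

Definition conforms_below m (u : 'I_n -> 'I_n -> 'I_n -> bool) : Prop :=
  {in D, forall s i j k, i < j -> j < k -> k < m -> conforms (u i j k) s i j k}.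

(** Pairs are scheduled by their larger, then by their smaller element. *)
Definition tail_time i j : nat := j * n + i.

Lemma tail_time_lt2 i i' j j' : j < j' -> tail_time i j < tail_time i' j'.
Proof.
rewrite /tail_time => jj; have : j.+1 * n <= j' * n by rewrite leq_mul2r jj orbT.
by have := ltn_ord i; clear; lia.
Qed.

Lemma tail_time_lt1 i i' j : i < i' -> tail_time i j < tail_time i' j.
Proof. by rewrite /tail_time ltn_add2l. Qed.

(** One more element [w] is inserted by letting it travel from the last to the
    first position among the elements below it along a path [r] of the current
    domain: first come the pairs inverted in [r], then the pairs of [w], then
    the other pairs below [w], then all remaining pairs. *)
Lemma extend_one m u : m < n -> realizable u -> conforms_below m u ->
  exists2 u', realizable u' & conforms_below m.+1 u'.
Proof.
move=> mn [T sT] cu; pose w := Ordinal mn.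
have [B TB] : exists B, forall i j, T i j < B.
  exists (\max_(p : 'I_n * 'I_n) T p.1 p.2).+1 => i j; rewrite ltnS.
  exact: (leq_bigmax (i, j)).
pose u1 i j k := if (k : 'I_n) < m then u i j k else true.
have ru1 : realizable u1.
  exists (fun i j => if (j : 'I_n) < m then T i j else B + tail_time i j) => i j k ij jk.
  have := sT i j k ij jk; rewrite /u1; case: (boolP (k < m)) => km.
    by rewrite (ltn_trans jk km).
  move=> _; split; last by rewrite ltn_add2l tail_time_lt1.
  case: ifP => _; first exact: leq_trans (TB _ _) (leq_addr _ _).
  by rewrite ltn_add2l tail_time_lt2.
have [tr trI] : exists tr : linord n -> linord n,
    forall s i j, ((i, j) \in Inv (tr s)) = (j < w) && ((i, j) \in Inv s).
  suff h s : exists r, forall i j, ((i, j) \in Inv r) = (j < w) && ((i, j) \in Inv s).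
    by have [tr h'] := choice h; exists tr.
  pose I := [set p : 'I_n * 'I_n | (p.2 < w) && (p \in Inv s)].
  have inI i j : ((i, j) \in I) = (j < w) && ((i, j) \in Inv s) by rewrite inE.
  have [|r e] := @biconvex_Inv n I; last by exists r => i j; rewrite e inI.
  split=> [x y|i j k ij jk]; first by rewrite inI => /andP[_ /Inv_lt].
  rewrite !inI; split=> [/andP[_ a] /andP[-> b]|/andP[kw a]].
    exact: Inv_trans a b.
  by rewrite kw (ltn_trans jk kw); apply: Inv_cotrans a.
have tr_dom : {in D, forall s, tr s \in cdom u1}.
  move=> s sD; apply/cdomP => i j k ij jk; rewrite /u1 /conforms.
  case: (boolP (k < m)) => km; last first.
    by rewrite notlastE // trI /= (negbTE km).
  have := cu s sD i j k ij jk km; rewrite /conforms.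
  by rewrite !notlastE // !notfirstE // !trI /= km (ltn_trans jk km).
have [r [rd rf rb]] := separating_path ru1 tr_dom trI.
pose pos i : nat := (r^-1)%g i.
have posn i : pos i <= n by apply: ltnW; apply: ltn_ord.
pose T' i j := if (j : 'I_n) < m then (if (i, j) \in Inv r then T i j else B + n.+1 + T i j)
               else if j == w then B + (n - pos i) else B + n.+1 + B + tail_time i j.
pose u' i j k := if (k : 'I_n) < m then u i j k else if k == w then (i, j) \in Inv r else true.
have wm (k : 'I_n) : (k < m) = false -> k != w -> m < k.
  by move=> km kw; rewrite ltn_neqAle eq_sym [_ == _](negbTE kw) leqNgt km.
exists u'.
  exists T' => i j k ij jk; rewrite /u' /T'; case: (boolP (k < m)) => km.
    rewrite (ltn_trans jk km); have /dom_ideal[_ /(_ i j k ij jk)] := rd.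
    rewrite /u1 km /ideal_at; have := sT i j k ij jk.
    have := TB i j; have := TB i k; have := TB j k.
    case: (u i j k); case: ((i, j) \in Inv r); case: ((i, k) \in Inv r);
      case: ((j, k) \in Inv r); move: (T i j) (T i k) (T j k);
      by clear=> a b c ? ? ? [? ?] [f g]; try (have := f isT); try (have := g isT); lia.
  have [ek|kw] := eqVneq k w.
    have jm : j < m by rewrite ek in jk.
    rewrite jm; case: (boolP ((i, j) \in Inv r)) => ijr.
      have pp : pos j < pos i by rewrite -before_Inv in ijr.
      have := TB i j; have := posn i; have := posn j; move: pp (T i j).
      by move: (pos i) (pos j); clear; lia.
    have pp : pos i < pos j by rewrite -before_nInv in ijr.
    have := TB i j; have := posn i; have := posn j; move: pp (T i j).
    by move: (pos i) (pos j); clear; lia.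
  split; last by rewrite ltn_add2l tail_time_lt1.
  have := TB i j; have := @tail_time_lt2 i i j k jk; have := posn i.
  move: (T i j) (pos i) (tail_time i j) (tail_time i k) => a b c d.
  by case: ifP => _; [case: ifP => _|case: ifP => _]; clear; lia.
move=> s sD i j k ij jk; rewrite ltnS leq_eqVlt /u' => /orP[/eqP km|km]; last first.
  by rewrite km; apply: cu.
have ek : k = w by apply: val_inj.
subst k; rewrite ltnn eqxx /conforms; case: ifP => h.
  apply: contraT; rewrite /notlast negb_or => /andP[nji njw].
  have sij : before s i j by rewrite (@beforeN _ s j i) // eq_sym ord_lt_neq.
  have swj : before s w j by rewrite (@beforeN _ s j w) // ord_lt_neq.
  have : barred w s i j by rewrite /barred ij jk sij.
  by move/(rb s i j sD); rewrite before_nInv // h.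
apply: contraT; rewrite /notfirst negb_or => /andP[nij nwj].
have sji : before s j i by rewrite (@beforeN _ s i j) // ord_lt_neq.
have sjw : before s j w by rewrite (@beforeN _ s w j) // eq_sym ord_lt_neq.
have : forced w s i j by rewrite /forced ij jk sji.
by move/(rf s i j sD); rewrite before_Inv // h.
Qed.

Lemma pp_in_realized : exists2 u, realizable u & D \subset cdom u.
Proof.
have main m : m <= n -> exists2 u, realizable u & conforms_below m u.
  elim: m => [_|m IH mn].
    exists (fun _ _ _ => true) => //; exists tail_time => i j k ij jk.
    by split; [apply: tail_time_lt2|apply: tail_time_lt1].
  by have [u ru cu] := IH (ltnW mn); apply: extend_one ru cu.
have [u ru cu] := main n (leqnn n); exists u => //.
by apply/fintype.subsetP => s sD; apply/cdomP => i j k ij jk; apply: cu.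
Qed.
End PeakPitExtension.

Lemma peak_pit_realized n (X : {set linord n}) :
  inclusion_maximal (@peak_pit n) X <-> realized X.
Proof.
split=> [[/peak_pitP[_ _ ppX] mx]|[u ru ->]].
  have [u ru Xu] := pp_in_realized ppX.
  by exists u => //; apply/esym; apply: mx => //; apply: dom_peak_pit.
split=> [|Y /peak_pitP[_ _ ppY] sub]; first exact: dom_peak_pit.
exact: pp_sub_dom.
Qed.

(** * The plane and the zonogon *)

Section Plane.
Variables (R : realType) (n : nat) (xi : 'I_n -> 'rV[R]_2).
Hypothesis xiP : zonogon_vectors xi.
Local Open Scope ring_scope.
Implicit Types (p q v : 'rV[R]_2) (f g d : 'I_n -> R) (A B : {set 'I_n}).
Implicit Types (i j k x y z w : 'I_n).

Lemma absD (v v' : 'rV[R]_2) : abscissa (v + v') = abscissa v + abscissa v' :> R.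
Proof. by rewrite /abscissa mxE. Qed.
Lemma absZ a v : abscissa (a *: v) = a * abscissa v :> R.
Proof. by rewrite /abscissa mxE. Qed.
Lemma ordD (v v' : 'rV[R]_2) : ordinate (v + v') = ordinate v + ordinate v' :> R.
Proof. by rewrite /ordinate mxE. Qed.
Lemma ordZ a v : ordinate (a *: v) = a * ordinate v :> R.
Proof. by rewrite /ordinate mxE. Qed.
Lemma abs_sum (I : finType) (P : pred I) (F : I -> 'rV[R]_2) :
  abscissa (\sum_(i | P i) F i) = \sum_(i | P i) abscissa (F i).
Proof. by rewrite /abscissa summxE. Qed.
Lemma ord_sum (I : finType) (P : pred I) (F : I -> 'rV[R]_2) :
  ordinate (\sum_(i | P i) F i) = \sum_(i | P i) ordinate (F i).
Proof. by rewrite /ordinate summxE. Qed.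

Lemma vec_ext (v v' : 'rV[R]_2) : abscissa v = abscissa v' -> ordinate v = ordinate v' -> v = v'.
Proof.
move=> a o; apply/matrixP => i j; rewrite ord1.
case: j => [[|[|//]] lt]; [have -> : Ordinal lt = ord0 by exact: val_inj|].
  exact: a.
by have -> : Ordinal lt = ord_max by exact: val_inj.
Qed.

Lemma xi_ord i : 0 < ordinate (xi i).
Proof. by case: xiP. Qed.

Lemma xi_det i j : (i < j)%N ->
  abscissa (xi i) * ordinate (xi j) - ordinate (xi i) * abscissa (xi j) < 0.
Proof. by case: xiP => _ _; apply. Qed.

(** The points of the zonogon are the images [pt f] of the points [f] of the
    unit cube. *)
Definition pt f : 'rV[R]_2 := \sum_i f i *: xi i.

Definition cube f : Prop := forall i, 0 <= f i <= 1.

Lemma pt_ext f g : f =1 g -> pt f = pt g.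
Proof. by move=> fg; apply: eq_bigr => i _; rewrite fg. Qed.

Lemma ptB f g : pt (fun i => f i - g i) = pt f - pt g.
Proof.
by rewrite /pt -sumrB; apply: eq_bigr => i _; rewrite scalerBl.
Qed.

Lemma ptD f g : pt (fun i => f i + g i) = pt f + pt g.
Proof.
by rewrite /pt -big_split /=; apply: eq_bigr => i _; rewrite scalerDl.
Qed.

Lemma ptZ a f : pt (fun i => a * f i) = a *: pt f.
Proof. by rewrite /pt scaler_sumr; apply: eq_bigr => i _; rewrite scalerA. Qed.

Lemma pt_delta k : pt (fun i => (i == k)%:R) = xi k.
Proof.
rewrite /pt (bigD1 k) //= eqxx scale1r big1 ?addr0 // => i /negbTE->.
by rewrite scale0r.
Qed.

Lemma abs_pt f : abscissa (pt f) = \sum_i f i * abscissa (xi i).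
Proof. by rewrite /pt abs_sum; apply: eq_bigr => i _; rewrite absZ. Qed.

Lemma ord_pt f : ordinate (pt f) = \sum_i f i * ordinate (xi i).
Proof. by rewrite /pt ord_sum; apply: eq_bigr => i _; rewrite ordZ. Qed.

(** A horizontal combination that weighs the leftmost vectors negatively and
    the rightmost ones positively points to the right: subtract the multiple of
    the ordinate which makes the threshold vector vertical. *)
Lemma leaning d k : (forall i, (i < k)%N -> d i <= 0) ->
  (forall i, (k < i)%N -> 0 <= d i) -> ordinate (pt d) = 0 ->
  0 <= abscissa (pt d) /\ (abscissa (pt d) <= 0 -> forall i, d i = 0).
Proof.
move=> lo hi o0; have ok := xi_ord k.
pose F i := d i * (abscissa (xi i) * ordinate (xi k) - ordinate (xi i) * abscissa (xi k)).
have F0 i : 0 <= F i.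
  rewrite /F; case: (ltngtP i k) => [ik|ki|/val_inj ->]; last by lra.
    by apply: mulr_le0; [exact: lo|apply: ltW; exact: xi_det].
  apply: mulr_ge0; [exact: hi|have := xi_det ki; lra].
have FE : \sum_i F i = ordinate (xi k) * abscissa (pt d).
  transitivity (ordinate (xi k) * abscissa (pt d) - abscissa (xi k) * ordinate (pt d));
    last by rewrite o0 mulr0 subr0.
  rewrite abs_pt ord_pt !mulr_sumr -sumrB; apply: eq_bigr => i _; rewrite /F; ring.
split; first by rewrite -(pmulr_rge0 _ ok) -FE sumr_ge0.
move=> a0; have S0 : \sum_i F i = 0.
  apply: le_anti; rewrite sumr_ge0 ?andbT // FE.
  by rewrite pmulr_rle0.
have Fz i : F i = 0.
  by have /(_ i isT) := psumr_eq0P (fun j _ => F0 j) S0.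
have dz i : i != k -> d i = 0.
  move=> ik; have /eqP := Fz i; rewrite mulf_eq0 => /orP[/eqP//|/eqP e]; exfalso.
  case: (ltngtP i k) => [lt|gt|/val_inj e']; last by rewrite e' eqxx in ik.
    by have := xi_det lt; lra.
  by have := xi_det gt; lra.
move=> i; have [->|] := eqVneq i k; last exact: dz.
have := o0; rewrite ord_pt (bigD1 k) //= big1 ?addr0; last first.
  by move=> j jk; rewrite dz // mul0r.
by move/eqP; rewrite mulf_eq0 => /orP[/eqP//|/eqP e]; lra.
Qed.

(** A linear dependency that changes sign at most once has, up to a global sign,
    a threshold as in [leaning], and therefore vanishes. *)
Lemma no_alternation d :
  (forall i j k, (i < j)%N -> (j < k)%N -> ~ [/\ 0 < d i, d j < 0 & 0 < d k]) ->
  (forall i j k, (i < j)%N -> (j < k)%N -> ~ [/\ d i < 0, 0 < d j & d k < 0]) ->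
  pt d = 0 -> forall i, d i = 0.
Proof.
have main d' i0 : (forall i j k, (i < j)%N -> (j < k)%N -> ~ [/\ d' i < 0, 0 < d' j & d' k < 0]) ->
    pt d' = 0 -> d' i0 < 0 -> (forall i, (i < i0)%N -> d' i = 0) -> False.
  move=> na p0 d0 first0.
  have [k lo hi] : exists2 k : 'I_n, forall i, (i < k)%N -> d' i <= 0 &
                              forall i, (k < i)%N -> 0 <= d' i.
    case: (pselect (exists i, 0 < d' i)) => [[i1 di1]|none].
      case: (@arg_minnP _ i1 (fun i => 0 < d' i) (fun i => i : nat) di1) => k dk kmin.
      exists k => i ik.
        by rewrite leNgt; apply/negP => /kmin; rewrite leqNgt ik.
      rewrite leNgt; apply/negP => di; apply: (na i0 k i) => //.
      case: (ltngtP i0 k) => [//|lt|/val_inj e]; first by move: dk; rewrite first0 // ltxx.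
      by move: dk; rewrite -e; lra.
    case: (@arg_maxnP _ i0 xpredT (fun i => i : nat) isT) => k _ kmax.
    exists k => i ik; last by have := kmax i isT; rewrite /= leqNgt ik.
    by rewrite leNgt; apply/negP => di; apply: none; exists i.
  have [|_] := leaning lo hi; first by rewrite p0 /ordinate mxE.
  rewrite p0 {1}/abscissa mxE => /(_ (lexx _))/(_ i0) e.
  by move: d0; rewrite e ltxx.
move=> na1 na2 p0 i; apply/eqP; apply: contraT => di.
case: (@arg_minnP _ i (fun i => d i != 0) (fun i => i : nat) di) => i0 d0 imin; exfalso.
have first0 j : (j < i0)%N -> d j = 0.
  by move=> ji; apply/eqP; apply: contraT => /imin; rewrite leqNgt ji.
have [neg|pos|e] := ltgtP (d i0) 0; last by rewrite e eqxx in d0.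
  exact: (main d i0).
apply: (main (fun j => - d j) i0) => [j k l jk kl [a b c]|||j /first0 ->].
- by apply: (na1 j k l jk kl); split; lra.
- have := ptZ (-1) d; rewrite p0 scaler0 => <-.
  by apply: pt_ext => j; rewrite mulN1r.
- by lra.
- by rewrite oppr0.
Qed.

(** The end of a path that uses each color of the set once. *)
Definition vx A : 'rV[R]_2 := \sum_(i in A) xi i.

Definition ind A i : R := (i \in A)%:R.

Lemma vxE A : vx A = pt (ind A).
Proof.
rewrite /vx /pt big_mkcond /=; apply: eq_bigr => i _; rewrite /ind.
by case: (i \in A); rewrite ?scale1r ?scale0r.
Qed.

Lemma vx0 : vx set0 = 0.
Proof. by rewrite /vx big_set0. Qed.

Lemma vxU1 A x : x \notin A -> vx (x |: A) = vx A + xi x.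
Proof. by move=> xA; rewrite /vx big_setU1 //= addrC. Qed.

(** A point of the two-dimensional face of the cube which corresponds to a tile
    of colors [x], [y] with the color set [A] below it. *)
Definition cell A x a y b i : R :=
  if i == x then a else if i == y then b else ind A i.

Lemma cellE A x a y b : x != y -> x \notin A -> y \notin A ->
  pt (cell A x a y b) = vx A + a *: xi x + b *: xi y.
Proof.
move=> xy xA yA; rewrite vxE -(pt_delta x) -(pt_delta y) -!ptZ -!ptD; apply: pt_ext => i.
rewrite /cell /ind; have [->|ix] := eqVneq i x.
  by rewrite (negbTE xA) (negbTE xy) /= ?mulr0 ?mulr1 ?addr0 ?add0r.
by have [->|iy] := eqVneq i y; rewrite ?(negbTE yA) /= ?mulr0 ?mulr1 ?addr0 ?add0r.
Qed.

Lemma cell_cube A x a y b : 0 <= a <= 1 -> 0 <= b <= 1 -> cube (cell A x a y b).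
Proof.
move=> a01 b01 i; rewrite /cell /ind; case: eqP => // _; case: eqP => // _.
by case: (i \in A); rewrite ler01 lexx.
Qed.

Lemma ind_cube A : cube (ind A).
Proof. by move=> i; rewrite /ind; case: (i \in A); rewrite ler01 lexx. Qed.

(** * The tiling of a casting *)

Implicit Types (s t r : linord n) (u : 'I_n -> 'I_n -> 'I_n -> bool).

Definition bef s x : {set 'I_n} := [set w : 'I_n | before s w x].

Lemma in_bef s x w : (w \in bef s x) = before s w x.
Proof. by rewrite inE. Qed.

Lemma initial_bef s x : initial s (bef s x).
Proof.
move=> y z; rewrite !in_bef => yx zx; case: (eqVneq z x) => [->//|ne].
by apply: before_trans yx _; rewrite (@beforeN _ s z x).
Qed.

Lemma initial_bef1 s x : initial s (x |: bef s x).
Proof.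
move=> y z; rewrite !in_setU1 !in_bef negb_or => yx /andP[zx nzx].
have xz : before s x z by rewrite (@beforeN _ s z x).
by case/orP: yx => [/eqP->//|yx]; apply: before_trans yx xz.
Qed.

Lemma bef_notin s x : x \notin bef s x.
Proof. by rewrite in_bef before_irr. Qed.

(** The colors below a tile of colors [x < y]: a third color sees both of them
    before or both of them after, according to the casting of the triple. *)
Definition base u x y : {set 'I_n} :=
  [set z : 'I_n | if (z < x)%N then ~~ u z x y else
                  if (z == x) || (z == y) then false else
                  if (z < y)%N then u x z y else ~~ u x y z].

(** Comparing both orders of the flip with the casting of the triple [x, y, z]
    decides on which side of the exchanged neighbours [z] lies. *)
Lemma base_flip u s t x y : s \in cdom u -> t \in cdom u -> flip s t x y ->
  bef s x = base u x y.
Proof.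
move=> /cdomP su /cdomP tu f; have xy : (x < y)%N by case: f.
have sxy := flip_before_s f; have tyx := flip_before_t f.
apply/setP => z; rewrite in_bef inE.
have [->|zx] := eqVneq z x; first by rewrite before_irr ltnn.
have [->|zy] := eqVneq z y.
  by rewrite (before_asym sxy) ltnNge (ltnW xy).
have adj := flip_adj f zx zy.
have [fx fx'] := flip_other x f zx zy; have [fy fy'] := flip_other y f zx zy.
have nx : before s x z = ~~ before s z x by rewrite (beforeN _ zx).
have ny : before s y z = ~~ before s z y by rewrite (beforeN _ zy).
case: (ltngtP z x) => [lt|gt|/val_inj e] /=; last by rewrite e eqxx in zx.
  have := su z x y lt xy; have := tu z x y lt xy; rewrite /conforms /notlast /notfirst.
  rewrite fx fx' tyx sxy (before_asym tyx) (before_asym sxy) nx.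
  by case: (u z x y); case: (before s z x).
case: (ltngtP z y) => [lt|gt'|/val_inj e] /=; last by rewrite e eqxx in zy.
  have := su x z y gt lt; rewrite /conforms /notlast /notfirst nx ny -adj.
  by case: (u x z y); case: (before s z x).
have := su x y z xy gt'; have := tu x y z xy gt'; rewrite /conforms /notlast /notfirst.
rewrite fy fy' tyx sxy (before_asym tyx) (before_asym sxy) ny -adj.
by case: (u x y z); case: (before s z x).
Qed.

Lemma base_notin u x y : (x < y)%N -> x \notin base u x y /\ y \notin base u x y.
Proof.
move=> xy; have yx : (y < x)%N = false by rewrite ltnNge (ltnW xy).
by rewrite !inE !eqxx orbT ltnn yx.
Qed.

Section TilesOfCasting.
Variable u : 'I_n -> 'I_n -> 'I_n -> bool.
Hypothesis ru : realizable u.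

(** The initial sets of the members of the domain. *)
Definition ideal_set A : Prop := exists2 s, s \in cdom u & initial s A.

Lemma bef_ideal s x : s \in cdom u -> ideal_set (bef s x) /\ ideal_set (x |: bef s x).
Proof. by move=> sd; split; exists s => //; [apply: initial_bef|apply: initial_bef1]. Qed.

Lemma pair_flip x y : (x < y)%N -> exists s t, [/\ s \in cdom u, t \in cdom u & flip s t x y].
Proof.
move=> xy; have [C fC /fintype.subsetP Cu] := realizable_flag ru.
have [s [t [sC tC f _]]] := flag_step fC xy; exists s, t; split=> //; exact: Cu.
Qed.

Lemma flip_bef s t x y : flip s t x y ->
  [/\ bef s y = x |: bef s x, bef t y = bef s x & bef t x = y |: bef s x].
Proof.
move=> f; have sxy := flip_before_s f; have tyx := flip_before_t f.
have xy : (x < y)%N by case: f.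
split; apply/setP => z; rewrite ?in_setU1 !in_bef.
- have [->|zx] := eqVneq z x; first by rewrite sxy.
  have [->|zy] := eqVneq z y; first by rewrite before_irr (before_asym sxy).
  by rewrite (flip_adj f).
- have [->|zx] := eqVneq z x; first by rewrite before_irr (before_asym tyx).
  have [->|zy] := eqVneq z y; first by rewrite before_irr (before_asym sxy).
  by rewrite (flip_adj f) //; case: (flip_other y f zx zy).
- have [->|zy] := eqVneq z y; first by rewrite tyx.
  have [->|zx] := eqVneq z x; first by rewrite !before_irr.
  by case: (flip_other x f zx zy).
Qed.

Lemma flip_bef_other s t x y z : flip s t x y -> z != x -> z != y -> bef t z = bef s z.
Proof.
by move=> f zx zy; apply/setP => w; rewrite !in_bef; case: (flip_other w f zx zy).
Qed.

(** The four corners of a tile are passed by the paths before and after the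
    flip of its colors. *)
Lemma corners_ideal x y A : (x < y)%N -> A \subset [set x; y] -> ideal_set (base u x y :|: A).
Proof.
move=> xy sub; have [s [t [sd td f]]] := pair_flip xy.
have e := base_flip sd td f; have [h1 h2 h3] := flip_bef f.
have [b1 b2] := bef_ideal x sd; have [_ b3] := bef_ideal y sd; have [_ b4] := bef_ideal y td.
rewrite -e; have inA z : z \in A -> (z == x) || (z == y).
  by move/(fintype.subsetP sub); rewrite !inE.
have ne z w : z \notin A -> w \in A -> (z == w) = false.
  by move=> zA wA; apply: contraNF zA => /eqP->.
case: (boolP (x \in A)) => xA; case: (boolP (y \in A)) => yA.
- suff -> : bef s x :|: A = y |: bef s y by [].
  rewrite h1; apply/setP => z; rewrite !in_setU !in_set1.
  case: (boolP (z \in A)) => [/inA|zA].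
    by case/orP=> ->; rewrite ?orbT.
  by rewrite (ne z x zA xA) (ne z y zA yA) orbF.
- suff -> : bef s x :|: A = x |: bef s x by [].
  apply/setP => z; rewrite !in_setU !in_set1.
  case: (boolP (z \in A)) => [zA|zA].
    case/orP: (inA z zA) => [->|/eqP e']; first by rewrite orbT.
    by rewrite e' (negbTE yA) in zA.
  by rewrite (ne z x zA xA) orbF.
- suff -> : bef s x :|: A = y |: bef t y by [].
  rewrite h2; apply/setP => z; rewrite !in_setU !in_set1.
  case: (boolP (z \in A)) => [zA|zA].
    case/orP: (inA z zA) => [/eqP e'|->]; last by rewrite orbT.
    by rewrite e' (negbTE xA) in zA.
  by rewrite (ne z y zA yA) orbF.
- suff -> : A = set0 by rewrite setU0.
  apply/setP => z; rewrite inE; apply/negP => zA.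
  by case/orP: (inA z zA) => /eqP e'; rewrite e' ?(negbTE xA) ?(negbTE yA) in zA.
Qed.

(** Points of the cube for which positive coordinates can be separated from
    coordinates less than 1 by an ideal set. *)
Definition tame f : Prop := cube f /\
  forall P N : {set 'I_n}, [disjoint P & N] ->
    (forall i, i \in P -> 0 < f i) -> (forall i, i \in N -> f i < 1) ->
    exists A, [/\ ideal_set A, P \subset A & [disjoint N & A]].

(** If the difference of two tame points alternates in sign over three colors,
    suitable level sets of them fail to be strongly separated; so it does not
    alternate, and [no_alternation] applies. *)
Lemma tame_inj f g : tame f -> tame g -> pt f = pt g -> f =1 g.
Proof.
move=> [fc ft] [gc gt] e i.
have alt f1 g1 (a b c : 'I_n) : tame f1 -> tame g1 -> (a < b)%N -> (b < c)%N ->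
    g1 a < f1 a -> f1 b < g1 b -> g1 c < f1 c -> False.
  move=> [fc1 ft1] [gc1 gt1] ab bc fa fb fcc.
  have [/andP[f0a f1a] /andP[f0b f1b] /andP[f0c f1c]] := And3 (fc1 a) (fc1 b) (fc1 c).
  have [/andP[g0a g1a] /andP[g0b g1b] /andP[g0c g1c]] := And3 (gc1 a) (gc1 b) (gc1 c).
  have dis : [disjoint [set a; c] & [set b]].
    rewrite disjoint_sym disjoints1 !inE negb_or -!val_eqE /= neq_ltn ab orbT.
    by rewrite neq_ltn bc.
  have [|i1|A [[s sd sA] acA bA]] := ft1 _ _ dis.
  - by move=> i1; rewrite !inE => /orP[/eqP->|/eqP->]; lra.
  - by rewrite inE => /eqP->; lra.
  rewrite disjoint_sym in dis.
  have [|i1|B [[t td tB] bB acB]] := gt1 _ _ dis.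
  - by move=> i1; rewrite inE => /eqP->; lra.
  - by rewrite !inE => /orP[/eqP->|/eqP->]; lra.
  have inB z : z \in [set a; c] -> z \notin B by move/(disjointFr acB) => ->.
  apply: (initial_separated sd td sA tB ab bc).
  - by apply: (fintype.subsetP acA); rewrite !inE eqxx.
  - by apply: inB; rewrite !inE eqxx.
  - by apply: (fintype.subsetP acA); rewrite !inE eqxx orbT.
  - by apply: inB; rewrite !inE eqxx orbT.
  - by apply: (fintype.subsetP bB); rewrite inE.
  - by rewrite (disjointFr bA) // inE.
apply/eqP; rewrite -subr_eq0; apply/eqP.
apply: (@no_alternation (fun j => f j - g j)) => [a b c ab bc [h1 h2 h3]|a b c ab bc [h1 h2 h3]|].
- by apply: (alt f g a b c) => //; lra.
- by apply: (alt g f a b c) => //; lra.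
- by rewrite ptB e subrr.
Qed.
End TilesOfCasting.
End Plane.

Section TilingOfCasting.
Variables (R : realType) (n : nat) (xi : 'I_n -> 'rV[R]_2).
Hypothesis xiP : zonogon_vectors xi.
Variable u : 'I_n -> 'I_n -> 'I_n -> bool.
Hypothesis ru : realizable u.
Local Open Scope ring_scope.
Implicit Types (p q v : 'rV[R]_2) (f g d : 'I_n -> R) (A B P : {set 'I_n}).
Implicit Types (i j k x y z w : 'I_n) (s r : linord n) (t : tile R n).

Definition casting_tiles : set (tile R n) :=
  fun t => tile_bottom t = vx xi (base u (tile_i t) (tile_j t)).

Lemma tile_ext t t' : tile_bottom t = tile_bottom t' -> tile_i t = tile_i t' ->
  tile_j t = tile_j t' -> t = t'.
Proof.
case: t => b i j lt; case: t' => b' i' j' lt' /= -> ei ej; subst i' j'.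
by rewrite (bool_irrelevance lt lt').
Qed.

Definition casting_tile x y (xy : (x < y)%N) : tile R n :=
  Tile (vx xi (base u x y)) xy.

Lemma casting_tileP x y (xy : (x < y)%N) : casting_tiles (casting_tile xy).
Proof. by []. Qed.

(** A description of [t] in which its two colors play symmetric roles, so that a
    color shared by two tiles can be put first in both. *)
Definition spans t A x y : Prop :=
  [/\ x != y, x \notin A, y \notin A, tile_bottom t = vx xi A &
      (tile_i t = x /\ tile_j t = y) \/ (tile_i t = y /\ tile_j t = x)].

Lemma spansC t A x y : spans t A x y -> spans t A y x.
Proof. by case=> ? ? ? ? [] ?; split; rewrite 1?eq_sym //; by [right|left]. Qed.

Lemma casting_spans t : casting_tiles t -> spans t (base u (tile_i t) (tile_j t)) (tile_i t) (tile_j t).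
Proof.
move=> tT; have [ni nj] := base_notin u (tile_lt t).
by split=> //; [rewrite ord_lt_neq ?(tile_lt t)|left].
Qed.

Lemma spans_points t A x y p : spans t A x y ->
  tile_points xi t p <-> exists a b, [/\ 0 <= a <= 1, 0 <= b <= 1 & p = pt xi (cell A x a y b)].
Proof.
case=> xy xA yA eA h; split=> -[a [b [a01 b01 ->]]].
  case: h => -[-> ->]; first by exists a, b; rewrite cellE // eA.
  by exists b, a; rewrite cellE // eA addrAC.
case: h => -[ei ej]; first by exists a, b; rewrite cellE // eA ei ej.
by exists b, a; rewrite cellE // eA ei ej addrAC.
Qed.

Lemma spans_vertex t A x y (a b : bool) : spans t A x y ->
  tile_vertex xi t (pt xi (cell A x a%:R y b%:R)).
Proof.
case=> xy xA yA eA h; rewrite cellE // /tile_vertex eA.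
case: h => -[-> ->]; case: a; case: b;
  rewrite ?scale1r ?scale0r ?addr0 !inE ?eqxx ?orbT //.
by rewrite addrAC eqxx !orbT.
Qed.

Lemma spans_edge t A x y (b : bool) : spans t A x y ->
  tile_edge xi t (pt xi (cell A x 0 y b%:R)) x.
Proof.
case=> xy xA yA eA h; rewrite cellE // /tile_edge eA.
case: h => -[-> ->]; case: b;
  by rewrite ?scale1r ?scale0r ?addr0 !inE ?eqxx ?orbT.
Qed.

Lemma spans_tame t A x y (a b : R) : spans t A x y -> casting_tiles t ->
  A = base u (tile_i t) (tile_j t) -> 0 <= a <= 1 -> 0 <= b <= 1 ->
  tame u (cell A x a y b).
Proof.
case=> xy xA yA eA h tT eB a01 b01; split; first exact: cell_cube.
move=> P N dPN Ppos Nlt; exists (A :|: (P :&: [set x; y])); split.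
- rewrite eB; apply: corners_ideal => //; first exact: tile_lt.
  have <- : [set x; y] = [set tile_i t; tile_j t]; last exact: subsetIr.
  by case: h => -[-> ->] //; rewrite setUC.
- apply/fintype.subsetP => z zP; have := Ppos z zP; rewrite /cell /ind !inE zP.
  by case: (z == x); case: (z == y); case: (z \in A); rewrite ?ltxx ?orbT.
- rewrite disjoint_sym disjoints_subset; apply/fintype.subsetP => z.
  rewrite !inE => h'; apply/negP => zN; have := Nlt z zN.
  case/orP: h' => [zA|/andP[zP _]]; last by rewrite (disjointFr dPN zP) in zN.
  rewrite /cell /ind; have [ez|_] := eqVneq z x; first by rewrite -ez zA in xA.
  have [ez|_] := eqVneq z y; first by rewrite -ez zA in yA.
  by rewrite zA ltxx.
Qed.

(** By [tame_inj] the intersection of two tiles is the image of the intersection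
    of two faces of the cube: comparing coordinates, two tiles with a common
    color meet in an edge of this color, and two tiles with disjoint color pairs
    in a vertex. *)
Lemma casting_tiles_face t t' : casting_tiles t -> casting_tiles t' -> t <> t' ->
  let I := (tile_points xi t `&` tile_points xi t')%classic in
  [\/ I = classical_sets.set0,
      exists v, [/\ tile_vertex xi t v, tile_vertex xi t' v & I = [set v]%classic] |
      exists v k, [/\ tile_edge xi t v k, tile_edge xi t' v k & I = edge_points xi v k]].
Proof.
move=> tT tT' ne I.
set i := tile_i t; set j := tile_j t; set i' := tile_i t'; set j' := tile_j t'.
have ij : (i < j)%N := tile_lt t; have ij' : (i' < j')%N := tile_lt t'.
set A := base u i j; set A' := base u i' j'.
have S0 : spans t A i j := casting_spans tT.
have S0' : spans t' A' i' j' := casting_spans tT'.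
have [I0|/set0P[p0 [p0t p0t']]] := eqVneq I classical_sets.set0; first by constructor 1.
have common x y x' y' p : spans t A x y -> spans t' A' x' y' -> I p ->
    exists a b a' b', [/\ 0 <= a <= 1, 0 <= b <= 1, p = pt xi (cell A x a y b),
      p = pt xi (cell A' x' a' y' b') & cell A x a y b =1 cell A' x' a' y' b'].
  move=> S S' [/(spans_points p S)[a [b [a01 b01 e]]] /(spans_points p S')[a' [b' [a01' b01' e']]]].
  exists a, b, a', b'; split=> //; apply: (tame_inj xiP).
  - exact: spans_tame S tT _ a01 b01.
  - exact: spans_tame S' tT' _ a01' b01'.
  - by rewrite -e -e'.
have c1 B x (a : R) y b : cell B x a y b x = a by rewrite /cell eqxx.
have c2 B x (a : R) y b : x != y -> cell B x a y b y = b.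
  by rewrite /cell eqxx eq_sym => /negbTE->.
have c3 B x (a : R) y b z : z != x -> z != y -> cell B x a y b z = (z \in B)%:R.
  by rewrite /cell => /negbTE-> /negbTE->.
(* two tiles with exactly one common color meet along an edge of this color *)
have share z y y' : spans t A z y -> spans t' A' z y' -> y != y' ->
    exists v k, [/\ tile_edge xi t v k, tile_edge xi t' v k & I = edge_points xi v k].
  move=> S S' yy'; have [zy zA yA eA _] := S; have [zy' zA' yA' eA' _] := S'.
  have coords p : I p -> exists2 a, 0 <= a <= 1 &
      p = pt xi (cell A z a y (y \in A')%:R) /\
      @cell R n A z 0 y (y \in A')%:R =1 cell A' z 0 y' (y' \in A)%:R.
    move=> Ip; have [a [b [a' [b' [a01 b01 -> _ ff]]]]] := common _ _ _ _ p S S' Ip.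
    have yz : y != z by rewrite eq_sym.
    have yz' : y' != z by rewrite eq_sym.
    have eb : b = (y \in A')%:R by have := ff y; rewrite c2 // c3.
    have eb' : b' = (y' \in A)%:R.
      by have := ff y'; rewrite [RHS]c2 // c3 // eq_sym.
    exists a => //; split; first by rewrite eb.
    move=> w; have := ff w; rewrite /cell eb eb'; case: (w == z) => //.
  have [a0 _ [_ ff]] := coords p0 (conj p0t p0t').
  pose v := pt xi (cell A z 0 y (y \in A')%:R).
  have ve : v = pt xi (cell A' z 0 y' (y' \in A)%:R) by apply: pt_ext.
  exists v, z; split.
  - exact: spans_edge.
  - by rewrite ve; apply: spans_edge.
  have vz a : v + a *: xi z = pt xi (cell A z a y (y \in A')%:R).
    by rewrite /v !cellE // scale0r addr0 addrAC.
  have vz' a : v + a *: xi z = pt xi (cell A' z a y' (y' \in A)%:R).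
    by rewrite ve !cellE // scale0r addr0 addrAC.
  have b01 (b : bool) : 0 <= (b%:R : R) <= 1 by case: b; rewrite ler01 lexx.
  apply/predeqP => p; split=> [/coords[a a01 [-> _]]|[a a01 ->]].
    by exists a; rewrite // vz.
  split; first by apply/(spans_points _ S); exists a, (y \in A')%:R; rewrite vz.
  by apply/(spans_points _ S'); exists a, (y' \in A)%:R; rewrite vz'.
have [eii|nii] := eqVneq i i'.
  have [ejj|njj] := eqVneq j j'.
    case: ne; apply: tile_ext => //.
    by rewrite (tT : _ = vx xi A) (tT' : _ = vx xi A') /A /A' eii ejj.
  by constructor 3; apply: (share i j j') => //; rewrite eii.
have [eji|nji] := eqVneq j i'.
  constructor 3; apply: (share j i j'); [exact: spansC|by rewrite eji|].
  by rewrite -val_eqE /= ltn_eqF // (ltn_trans ij) // eji.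
have [eij|nij] := eqVneq i j'.
  constructor 3; apply: (share i j i') => //; rewrite eij; exact: spansC.
have [ejj|njj] := eqVneq j j'.
  by constructor 3; apply: (share j i i') => //; [exact: spansC|rewrite ejj; exact: spansC].
constructor 2.
have coords p : I p -> p = pt xi (cell A i (i \in A')%:R j (j \in A')%:R) /\
                        p = pt xi (cell A' i' (i' \in A)%:R j' (j' \in A)%:R).
  move=> Ip; have [a [b [a' [b' [_ _ e e' ff]]]]] := common _ _ _ _ p S0 S0' Ip.
  have [nij0 nij0'] : i != j /\ i' != j' by rewrite !ord_lt_neq.
  have ea : a = (i \in A')%:R by have := ff i; rewrite c1 c3.
  have eb : b = (j \in A')%:R by have := ff j; rewrite c2 // c3.
  have ea' : a' = (i' \in A)%:R by have := ff i'; rewrite c1 c3 // eq_sym.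
  have eb' : b' = (j' \in A)%:R by have := ff j'; rewrite [RHS]c2 // c3 // eq_sym.
  by split; [rewrite e ea eb|rewrite e' ea' eb'].
have [e0 e0'] := coords p0 (conj p0t p0t').
exists p0; split.
- by rewrite e0; apply: spans_vertex.
- by rewrite e0'; apply: spans_vertex.
- by apply/predeqP => p; split=> [/coords[-> _]|->].
Qed.

Lemma casting_tiles_finite : finite_set casting_tiles.
Proof.
pose F (q : {q : 'I_n * 'I_n | (q.1 < q.2)%N}) := casting_tile (valP q).
have -> : casting_tiles = range F; last by apply: finite_image; apply: finite_finset.
apply/predeqP => t; split=> [tT|[q _ <-]]; last exact: casting_tileP.
exists (Sub (tile_i t, tile_j t) (tile_lt t)) => //.
exact: tile_ext.
Qed.

Lemma casting_tiles_zonogon t : casting_tiles t -> (tile_points xi t `<=` zonogon xi)%classic.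
Proof.
move=> tT p /(spans_points p (casting_spans tT))[a [b [a01 b01 ->]]].
by exists (cell (base u (tile_i t) (tile_j t)) (tile_i t) a (tile_j t) b) => //; apply: cell_cube.
Qed.

(** * Edges and coverage *)

(** Each step of a member of the domain is an edge of a tile: the highest (or
    lowest) order through the step is not [omega] (not [alpha]), and the next
    flip of it destroys the step. *)
Lemma edge_tile s P z : (1 < n)%N -> s \in cdom u -> initial s P -> z \notin P ->
  initial s (z |: P) -> exists2 t, casting_tiles t & tile_edge xi t (vx xi P) z.
Proof.
move=> n1 sd sP zP szP.
pose W r := `[< [/\ r \in cdom u, initial r P & initial r (z |: P)] >].
have W1 : W s by apply/asboolP.
have [y yz] : exists y, y != z.
  case: (boolP (val z == 0%N)) => [z0|z0].
    by exists (Ordinal n1); rewrite -val_eqE (eqP z0).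
  by exists (Ordinal (ltnW n1)); rewrite -val_eqE eq_sym.
have below r (e f : 'I_n) : before r e f -> initial r P -> e \in P -> f \notin P ->
    (forall w, w != e -> w != f -> before r w e = before r w f) -> P = e |: bef r e.
  move=> ef rP eP fP adj; apply/setP => w; rewrite in_setU1 in_bef.
  have [-> //|we] := eqVneq w e; apply/idP/idP => [wP|/= rwe].
    by rewrite adj //; [exact: rP|apply: contraNneq fP => <-].
  by apply: contraT => wP; have := before_asym (rP _ _ eP wP); rewrite rwe.
have above r : initial r P -> initial r (z |: P) -> P = bef r z.
  move=> rP rzP; apply/setP => w; rewrite in_bef; apply/idP/idP => [wP|rwz]; first exact: rP.
  apply: contraT => wP; have wz := before_neq rwz.
  have := rzP z w (setU11 _ _); rewrite in_setU1 negb_or wz wP => /(_ isT)/before_asym.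
  by rewrite rwz.
case: (pselect (W (omega n))) => [Wo|nWo].
  have nWa : ~ W (alpha n).
    move=> /asboolP[_ aP azP]; case/asboolP: Wo => _ oP ozP.
    case: (boolP (y \in P)) => yP.
      have := aP _ _ yP zP; have := oP _ _ yP zP; rewrite before_alpha before_omega.
      by move=> a b; have := ltn_trans a b; rewrite ltnn.
    have yzP : y \notin z |: P by rewrite in_setU1 negb_or yz.
    have := azP _ _ (setU11 _ _) yzP; have := ozP _ _ (setU11 _ _) yzP.
    by rewrite before_alpha before_omega => a b; have := ltn_trans a b; rewrite ltnn.
  case: (arg_minnP (fun r => #|Inv r|) W1) => r Wr rmin.
  have [rd rP rzP] := asboolW Wr.
  have ra : alpha n <> r by move=> e; apply: nWa; rewrite e.
  have [r' [a [b [r'd fl _]]]] := dom_pred ru (dom_alpha u) rd (lebr_alpha r) ra.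
  have ab : (a < b)%N by case: (fl).
  have [_ sw] := flip_swapped fl; have eb := base_flip r'd rd fl.
  have [na nb] := base_notin u ab; have [_ h2 h3] := flip_bef fl.
  exists (casting_tile ab); first exact: casting_tileP.
  rewrite /tile_edge /=; have [|[bP az _]|[bz _ _ _ _]] := edge_lost sw zP rP rzP.
  - move=> [r'P r'zP]; have /rmin : W r' by apply/asboolP.
    by rewrite (flip_card fl) ltnn.
  - subst a; rewrite (below _ _ _ (flip_before_t fl) rP bP zP); last first.
      by move=> w wb wz; have [-> _] := swapped_adj sw wb wz.
    by rewrite h2 eb vxU1 // !inE eqxx !orbT.
  - by subst b; rewrite (above r rP rzP) h2 eb !inE eqxx orbT.
case: (arg_maxnP (fun r => #|Inv r|) W1) => r Wr rmax.
have [rd rP rzP] := asboolW Wr.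
have ro : r <> omega n by move=> e; apply: nWo; rewrite -e.
have [r' [a [b [r'd fl _]]]] := dom_succ ru rd (dom_omega u) (lebr_omega r) ro.
have ab : (a < b)%N by case: (fl).
have [sw _] := flip_swapped fl; have eb := base_flip rd r'd fl.
have [na nb] := base_notin u ab.
exists (casting_tile ab); first exact: casting_tileP.
rewrite /tile_edge /=; have [|[aP bz _]|[az _ _ _ _]] := edge_lost sw zP rP rzP.
- move=> [r'P r'zP]; have /rmax : W r' by apply/asboolP.
  by rewrite /= (flip_card fl) ltnn.
- subst b; rewrite (below _ _ _ (flip_before_s fl) rP aP zP); last first.
    by move=> w wb wz; have [-> _] := swapped_adj sw wb wz.
  by rewrite eb vxU1 // !inE eqxx !orbT.
- by subst a; rewrite (above r rP rzP) eb !inE eqxx.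
Qed.

Lemma tile_edge_points t v k c : tile_edge xi t v k -> 0 <= c <= 1 ->
  tile_points xi t (v + c *: xi k).
Proof.
have o01 : 0 <= (0 : R) <= 1 by rewrite lexx ler01.
have i01 : 0 <= (1 : R) <= 1 by rewrite lexx ler01.
rewrite /tile_edge !inE => h c01.
case/or4P: h => /eqP[-> ->].
- by exists c, 0; rewrite scale0r addr0.
- by exists 0, c; rewrite scale0r addr0.
- by exists 1, c; rewrite scale1r.
- by exists c, 1; rewrite scale1r addrAC.
Qed.

(** The path of [s] meets the level of [p] at [p] or to the right of it. *)
Definition left_of p s : Prop := exists k c, [/\ 0 <= c <= 1,
  ordinate p = ordinate (vx xi (bef s k) + c *: xi k) &
  abscissa p <= abscissa (vx xi (bef s k) + c *: xi k)].

(** On the right boundary the rightmost colors are used first: by [leaning] no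
    point of the zonogon lies further right on the same level. *)
Lemma left_of_omega p : (0 < n)%N -> zonogon xi p -> left_of p (omega n).
Proof.
move=> n0 [g gc]; rewrite -/(pt xi g) => pE.
have in_bo k w : (w \in bef (omega n) k) = (k < w)%N by rewrite in_bef before_omega.
pose h := ordinate p; pose H k := ordinate (vx xi (bef (omega n) k)).
have o_ge0 w : 0 <= ordinate (xi w) by apply: ltW; apply: xi_ord.
have nlt : (n.-1 < n)%N by rewrite prednK.
have P0 : H (Ordinal nlt) <= h.
  rewrite /H; have -> : bef (omega n) (Ordinal nlt) = finset.set0.
    by apply/setP => w; rewrite in_bo inE /= ltnNge -ltnS prednK // ltn_ord.
  rewrite /h pE ord_pt vx0 {1}/ordinate mxE; apply: sumr_ge0 => w _.
  by apply: mulr_ge0 => //; case/andP: (gc w).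
case: (@arg_minnP _ _ (fun k => H k <= h) (fun k => k : nat) P0) => k Hk kmin.
have nk : k \notin bef (omega n) k by apply: bef_notin.
have Hk' : h <= H k + ordinate (xi k).
  rewrite /H -ordD -vxU1 //; case: (posnP k) => k0.
    have -> : k |: bef (omega n) k = [set: 'I_n].
      apply/setP => w; rewrite in_setU1 in_bo in_setT -val_eqE /= k0.
      by case: (nat_of_ord w).
    rewrite /h pE ord_pt vxE ord_pt; apply: ler_sum => w _; rewrite /ind inE.
    by apply: ler_wpM2r => //; case/andP: (gc w).
  have klt : (k.-1 < n)%N by apply: leq_ltn_trans (leq_pred _) (ltn_ord k).
  rewrite leNgt; apply/negP => lt; have : H (Ordinal klt) <= h.
    rewrite /H; have -> : bef (omega n) (Ordinal klt) = k |: bef (omega n) k; last exact: ltW.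
    apply/setP => w; rewrite in_setU1 !in_bo /= -val_eqE /= (prednK k0).
    by rewrite leq_eqVlt eq_sym.
  by move/kmin; rewrite /= leqNgt prednK // leqnn.
pose c := (h - H k) / ordinate (xi k); have ok : 0 < ordinate (xi k) := xi_ord xiP k.
have cE : c * ordinate (xi k) = h - H k by rewrite /c divfK // gt_eqF.
have c01 : 0 <= c <= 1.
  rewrite /c ler_pdivrMr // mul1r divr_ge0 ?(ltW ok) ?subr_ge0 //=.
  by rewrite lerBlDl.
exists k, c; have oE : h = ordinate (vx xi (bef (omega n) k) + c *: xi k).
  by rewrite ordD ordZ cE /H addrC subrK.
split=> //; pose f i := ind R (bef (omega n) k) i + c * (i == k)%:R.
have fE : vx xi (bef (omega n) k) + c *: xi k = pt xi f by rewrite ptD ptZ pt_delta vxE.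
rewrite fE pE -subr_ge0.
have aE : abscissa (pt xi f) - abscissa (pt xi g) = abscissa (pt xi (fun i => f i - g i)).
  by rewrite ptB absD -scaleN1r absZ mulN1r.
rewrite aE; apply: (proj1 (leaning xiP (k := k) _ _ _)) => [i ik|i ki|].
- have /andP[g0 _] := gc i; rewrite /f /ind in_bo ltnNge (ltnW ik) /=.
  by rewrite -val_eqE /= (ltn_eqF ik) mulr0 addr0 sub0r oppr_le0.
- have /andP[_ g1] := gc i; rewrite /f /ind in_bo ki /=.
  by rewrite -val_eqE /= (gtn_eqF ki) mulr0 addr0 subr_ge0.
- by rewrite ptB ordD -scaleN1r ordZ mulN1r -fE -oE -pE subrr.
Qed.

(** Sweeping leftwards: a point left of the path of [s] is either left of the
    path below, or in the tile between the two paths. *)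
Lemma left_of_covered s p : (1 < n)%N -> s \in cdom u -> zonogon xi p -> left_of p s ->
  exists2 t, casting_tiles t & tile_points xi t p.
Proof.
move=> n1; move e : #|Inv s| => m; elim: m s e => [|m IH] s e sd pZ.
  have -> : s = alpha n.
    by apply: Inv_inj; rewrite Inv_alpha; apply: cards0_eq.
  case=> k [c [c01 oE aE]].
  have in_ba w : (w \in bef (alpha n) k) = (w < k)%N by rewrite in_bef before_alpha.
  pose f i := ind R (bef (alpha n) k) i + c * (i == k)%:R.
  have fE : vx xi (bef (alpha n) k) + c *: xi k = pt xi f by rewrite ptD ptZ pt_delta vxE.
  case: pZ => g gc; rewrite -/(pt xi g) => pE.
  have [i ik|i ki||_ d0] := @leaning _ _ _ xiP (fun i => g i - f i) k.
  - have /andP[_ g1] := gc i; rewrite /f /ind in_ba ik /=.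
    by rewrite -val_eqE /= (ltn_eqF ik) mulr0 addr0 subr_le0.
  - have /andP[g0 _] := gc i; rewrite /f /ind in_ba ltnNge (ltnW ki) /=.
    by rewrite -val_eqE /= (gtn_eqF ki) mulr0 addr0 subr0.
  - by rewrite ptB ordD -scaleN1r ordZ mulN1r -fE -oE -pE subrr.
  have pq : p = vx xi (bef (alpha n) k) + c *: xi k.
    rewrite fE pE; apply: pt_ext => i; apply/eqP; rewrite -subr_eq0.
    apply/eqP; apply: d0; rewrite ptB absD -scaleN1r absZ mulN1r -fE -pE.
    by rewrite subr_le0.
  have [t tT tk] := edge_tile n1 (dom_alpha u) (@initial_bef _ (alpha n) k)
    (bef_notin (alpha n) k) (@initial_bef1 _ (alpha n) k).
  by exists t => //; rewrite pq; apply: tile_edge_points.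
have sa : alpha n <> s by move=> ea; move: e; rewrite -ea Inv_alpha cards0.
have [r [x [y [rd f _]]]] := dom_pred ru (dom_alpha u) sd (lebr_alpha s) sa.
have rm : #|Inv r| = m by move: e; rewrite (flip_card f) => -[].
have xy : (x < y)%N by case: (f).
have [h1 h2 h3] := flip_bef f; have eb := base_flip rd sd f.
have [nx ny] := base_notin u xy.
case=> k [c [/andP[c0 c1] oE aE]].
have ox := xi_ord xiP x; have oy := xi_ord xiP y.
have dxy := xi_det xiP xy.
(* the last path point has coordinates a, b in the tile of the flip *)
suff tile_case a b : 0 <= a <= 1 -> 0 <= b <= 1 ->
    ordinate p = ordinate (vx xi (bef r x) + a *: xi x + b *: xi y) ->
    abscissa p <= abscissa (vx xi (bef r x) + a *: xi x + b *: xi y) ->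
    exists2 t, casting_tiles t & tile_points xi t p.
  have i01 : 0 <= (1 : R) <= 1 by rewrite lexx ler01.
  have o01 : 0 <= (0 : R) <= 1 by rewrite lexx ler01.
  have c01 : 0 <= c <= 1 by rewrite c0.
  have [ek|kx] := eqVneq k x.
    move: oE aE; rewrite ek h3 vxU1 ?eb // -eb => oE aE.
    by apply: (tile_case c 1) => //; rewrite scale1r addrAC.
  have [ek|ky] := eqVneq k y.
    move: oE aE; rewrite ek h2 => oE aE.
    by apply: (tile_case 0 c) => //; rewrite scale0r addr0.
  apply: (IH r rm rd pZ); exists k, c; split=> //; by rewrite -(flip_bef_other f kx ky).
move=> /andP[a0 a1] /andP[b0 b1]; set A := bef r x => oE' aE'.
have {}oE : ordinate p = ordinate (vx xi A) + a * ordinate (xi x) + b * ordinate (xi y).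
  by rewrite oE' !ordD !ordZ.
have {}aE : abscissa p <= abscissa (vx xi A) + a * abscissa (xi x) + b * abscissa (xi y).
  by apply: le_trans aE' _; rewrite !absD !absZ.
(* the point of the lower path on the same level *)
have [a' [b' [/andP[a0' a1'] /andP[b0' b1'] lev pos]]] : exists a' b', [/\ 0 <= a' <= 1, 0 <= b' <= 1,
    a' * ordinate (xi x) + b' * ordinate (xi y) = a * ordinate (xi x) + b * ordinate (xi y) &
    b' = 0 \/ a' = 1].
  have h0 : 0 <= a * ordinate (xi x) by rewrite mulr_ge0 // ltW.
  have h0' : 0 <= b * ordinate (xi y) by rewrite mulr_ge0 // ltW.
  have h1a : a * ordinate (xi x) <= ordinate (xi x) by rewrite ler_piMl // ltW.
  have h1b : b * ordinate (xi y) <= ordinate (xi y) by rewrite ler_piMl // ltW.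
  set h := a * ordinate (xi x) + b * ordinate (xi y).
  have [le|gt] := lerP h (ordinate (xi x)).
    exists (h / ordinate (xi x)), 0; rewrite divfK ?gt_eqF // mul0r addr0 lexx ler01.
    split=> //; last by left.
    by rewrite ler_pdivrMr // mul1r le andbT divr_ge0 // ?addr_ge0 // ltW.
  exists 1, ((h - ordinate (xi x)) / ordinate (xi y)).
  rewrite divfK ?gt_eqF // mul1r [ordinate (xi x) + _]addrC subrK lexx ler01.
  split=> //; last by right.
  rewrite ler_pdivrMr // mul1r divr_ge0 ?subr_ge0 ?(ltW gt) ?(ltW oy) //=.
  by rewrite lerBlDl /h lerD.
have [le|gt] := lerP (abscissa p) (abscissa (vx xi A) + a' * abscissa (xi x) + b' * abscissa (xi y)).
  apply: (IH r rm rd pZ); case: pos => e0.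
    exists x, a'; rewrite a0' a1' ordD ordZ absD absZ; split=> //.
      by move: lev; rewrite e0 mul0r addr0 oE -!addrA => ->.
    by move: le; rewrite e0 mul0r addr0.
  exists y, b'; rewrite b0' b1' h1 vxU1 ?eb // -eb !ordD ordZ !absD absZ; split=> //.
    by rewrite oE -!addrA -lev e0 mul1r.
  by move: le; rewrite e0 mul1r.
(* otherwise p lies between the two path points, inside the tile *)
pose X' := a' * abscissa (xi x) + b' * abscissa (xi y).
pose X := a * abscissa (xi x) + b * abscissa (xi y).
pose X0 := abscissa p - abscissa (vx xi A).
have X01 : X' < X0 by rewrite /X' /X0; lra.
have X02 : X0 <= X by rewrite /X /X0; lra.
pose l := (X0 - X') / (X - X').
have X03 : 0 < X - X' by lra.
have lE : l * (X - X') = X0 - X' by rewrite /l divfK // gt_eqF.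
have l0 : 0 <= l by rewrite /l divr_ge0 //; lra.
have l1 : l <= 1 by rewrite /l ler_pdivrMr // mul1r; lra.
exists (casting_tile xy); first exact: casting_tileP.
exists (a' + l * (a - a')), (b' + l * (b - b')); split.
- by apply/andP; split; nra.
- by apply/andP; split; nra.
rewrite /= -eb -/A; apply: vec_ext.
  rewrite !absD !absZ; transitivity (abscissa (vx xi A) + (X' + l * (X - X'))).
    by rewrite lE /X0; ring.
  by rewrite /X /X'; ring.
rewrite !ordD !ordZ oE; transitivity (ordinate (vx xi A) + (a' * ordinate (xi x) + b' * ordinate (xi y)) + l * ((a * ordinate (xi x) + b * ordinate (xi y)) - (a' * ordinate (xi x) + b' * ordinate (xi y)))).
  by rewrite lev; ring.
by ring.
Qed.

Lemma casting_tiling : rhombus_tiling xi casting_tiles.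
Proof.
split; first exact: casting_tiles_finite.
  move=> n1; apply/predeqP => p; split=> [[t tT pt]|pZ].
    exact: casting_tiles_zonogon pt.
  have [t tT tp] := left_of_covered n1 (dom_omega u) pZ (left_of_omega (ltnW n1) pZ).
  by exists t.
exact: casting_tiles_face.
Qed.

Lemma tame_ind A : ideal_set u A -> tame u (@ind R n A).
Proof.
move=> iA; split; first exact: ind_cube.
move=> P N _ Pp Np; exists A; split=> //.
  apply/fintype.subsetP => i /Pp; rewrite /ind; case: (i \in A) => //.
  by rewrite ltxx.
rewrite disjoints_subset; apply/fintype.subsetP => i /Np; rewrite /ind inE.
by case: (i \in A) => //; rewrite ltxx.
Qed.

Lemma vx_inj A B : ideal_set u A -> ideal_set u B -> vx xi A = vx xi B -> A = B.
Proof.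
move=> iA iB; rewrite !vxE => /(tame_inj xiP (tame_ind iA) (tame_ind iB)) h.
apply/setP => i; have := h i; rewrite /ind; case: (i \in A); case: (i \in B) => //= /eqP;
  by rewrite ?oner_eq0 // eq_sym oner_eq0.
Qed.

Lemma edge_ideal t v k : casting_tiles t -> tile_edge xi t v k ->
  exists B, [/\ v = vx xi B, ideal_set u B, k \notin B & ideal_set u (k |: B)].
Proof.
move=> tT; set i := tile_i t; set j := tile_j t.
have ij : (i < j)%N := tile_lt t; have nij := ord_lt_neq ij.
have [ni nj] := base_notin u ij; have cor A := @corners_ideal _ u ru i j A ij.
set B := base u i j in ni nj cor.
have I0 : ideal_set u B by rewrite -[B]setU0; apply: cor; apply: sub0set.
have Ii : ideal_set u (i |: B) by rewrite setUC; apply: cor; rewrite sub1set !inE eqxx.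
have Ij : ideal_set u (j |: B) by rewrite setUC; apply: cor; rewrite sub1set !inE eqxx orbT.
have Iij : ideal_set u (i |: (j |: B)) by rewrite setUA setUC; apply: cor.
have eb : tile_bottom t = vx xi B := tT.
rewrite /tile_edge eb !inE => /or4P[] /eqP[-> ->].
- by exists B.
- by exists B.
- exists (i |: B); rewrite vxU1 //; split=> //.
    by rewrite in_setU1 negb_or nj eq_sym nij.
  by rewrite setUCA.
- exists (j |: B); rewrite vxU1 //; split=> //.
  by rewrite in_setU1 negb_or ni nij.
Qed.

(** The paths of the graph of the tiling are the members of the domain: by
    injectivity of [vx], the sets traversed by a path are ideal sets. *)
Lemma path_cdom s : (1 < n)%N -> (forall k, graph_edge xi casting_tiles (vx xi (bef s k)) k) <->
  s \in cdom u.
Proof.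
move=> n1; split=> [ge|sd k]; last first.
  left; exact: edge_tile n1 sd (@initial_bef _ s k) (bef_notin s k) (@initial_bef1 _ s k).
have ed k : exists B, [/\ vx xi (bef s k) = vx xi B, ideal_set u B, k \notin B & ideal_set u (k |: B)].
  case: (ge k) => [[t tT te]|[n1' _]]; first exact: edge_ideal te.
  by rewrite n1' in n1.
have ids k : ideal_set u (bef s k).
  have posE z x : before s z x = (val ((s^-1)%g z) < val ((s^-1)%g x))%N by [].
  move: {2}(val _) (erefl (val ((s^-1)%g k))) => m; elim: m k => [|m IH] k ek.
    have -> : bef s k = finset.set0.
      by apply/setP => z; rewrite in_bef inE posE ek ltn0.
    by exists (alpha n); [exact: dom_alpha|move=> a b; rewrite inE].
  have mn : (m < n)%N by apply: ltnW; rewrite -ek; apply: ltn_ord.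
  pose k' := s (Ordinal mn).
  have ek' : val ((s^-1)%g k') = m by rewrite permK.
  have bE : bef s k = k' |: bef s k'.
    apply/setP => z; rewrite in_setU1 !in_bef !posE ek ek' ltnS leq_eqVlt.
    by rewrite -ek' val_eqE (inj_eq perm_inj).
  have [B [e iB kB ikB]] := ed k'.
  by rewrite bE (vx_inj (IH k' ek') iB e).
apply/cdomP => i j k ij jk; rewrite /conforms.
have [B [e iB _ ijB]] := ed j; move: ijB; rewrite -(vx_inj (ids j) iB e).
have [r /cdomP/(_ i j k ij jk) h rj] := ids j => -[r' /cdomP/(_ i j k ij jk) h' rj'].
move: h h'; rewrite /conforms; case: (u i j k) => h h'.
  apply: contraT; rewrite /notlast negb_or => /andP[nji njk].
  have sij : before s i j by rewrite (@beforeN _ s j i) // eq_sym ord_lt_neq.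
  have skj : before s k j by rewrite (@beforeN _ s j k) // ord_lt_neq.
  have rij : before r i j by apply: rj; rewrite ?bef_notin // in_bef.
  have rkj : before r k j by apply: rj; rewrite ?bef_notin // in_bef.
  by move: h; rewrite /notlast (before_asym rij) (before_asym rkj).
apply: contraT; rewrite /notfirst negb_or => /andP[nij nkj].
have ni : i \notin j |: bef s j by rewrite in_setU1 in_bef negb_or ord_lt_neq.
have nk : k \notin j |: bef s j.
  by rewrite in_setU1 in_bef negb_or nkj eq_sym ord_lt_neq.
have rji := rj' j i (setU11 _ _) ni; have rjk := rj' j k (setU11 _ _) nk.
by move: h'; rewrite /notfirst (before_asym rji) (before_asym rjk).
Qed.
End TilingOfCasting.

(** * Snakes *)

Section Snakes.
Variables (R : realType) (n : nat) (xi : 'I_n -> 'rV[R]_2) (T : set (tile R n)).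
Local Open Scope ring_scope.
Implicit Types (s : linord n) (w : seq 'I_n) (v : 'rV[R]_2) (k : 'I_n).

Lemma directed_pathP v w v' : directed_path xi T v w v' <->
  v' = v + \sum_(z <- w) xi z /\
  forall w1 k w2, w = w1 ++ k :: w2 -> graph_edge xi T (v + \sum_(z <- w1) xi z) k.
Proof.
elim: w v => [|k w IH] v /=.
  by rewrite big_nil addr0; split=> [->|[-> _]] //; split=> // -[].
rewrite IH big_cons addrA; split=> [[e [-> h]]|[-> h]]; split=> //.
- case=> [|k' w1] k0 w2 /= [ek ew]; first by rewrite big_nil addr0 -ek.
  by rewrite big_cons addrA -ek; apply: h ew.
- by have := h [::] k w erefl; rewrite big_nil addr0.
- split=> // w1 k' w2 ew; have := h (k :: w1) k' w2; rewrite /= -ew => /(_ erefl).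
  by rewrite big_cons addrA.
Qed.

Lemma snakeP s : snake xi T (word s) <-> forall k, graph_edge xi T (vx xi (bef s k)) k.
Proof.
have pw : pairwise (before s) (word s).
  by rewrite -sorted_pairwise ?sorted_word //; apply: before_trans.
have uw : uniq (word s).
  by rewrite map_inj_uniq ?enum_uniq //; apply: perm_inj.
have mw z : z \in word s.
  by rewrite -(permKV s z); apply: map_f; rewrite mem_enum.
have pre w1 k w2 : word s = w1 ++ k :: w2 -> \sum_(z <- w1) xi z = vx xi (bef s k).
  move=> e; move: pw uw mw; rewrite e pairwise_cat cat_uniq /= allrel_consr.
  move=> /andP[/andP[/allP b1 _] /andP[_ /andP[/allP b2 _]]] /andP[u1 _] mw'.
  rewrite (big_uniq _ u1) /=; apply: eq_bigl => z; rewrite in_bef.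
  apply/idP/idP => [/b1//|zk]; have := mw' z; rewrite mem_cat inE.
  case/or3P=> // [/eqP e'|/b2 kz]; first by rewrite e' before_irr in zk.
  by rewrite (before_asym kz) in zk.
rewrite /snake directed_pathP add0r; split=> [[_ h] k|h].
  have [w1 [w2 e]] : exists w1 w2, word s = w1 ++ k :: w2.
    by case/splitPr: (mw k) => w1 w2; exists w1, w2.
  by have := h w1 k w2 e; rewrite add0r (pre _ _ _ e).
split=> [|w1 k w2 e]; last by rewrite add0r (pre _ _ _ e).
by rewrite /top_vertex (big_uniq _ uw) /=; apply: eq_bigl => z; rewrite mw.
Qed.
End Snakes.

(** * Every tiling is the tiling of a casting *)

HB.instance Definition _ (R : realType) (n : nat) := gen_eqMixin (tile R n).

Section CastingOfTiling.
Variables (R : realType) (n : nat) (xi : 'I_n -> 'rV[R]_2).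
Hypothesis xiP : zonogon_vectors xi.
Hypothesis n1 : (1 < n)%N.
Variable T : set (tile R n).
Hypothesis TP : rhombus_tiling xi T.
Local Open Scope ring_scope.
Implicit Types (p q v : 'rV[R]_2) (f g d : 'I_n -> R) (A B P : {set 'I_n}).
Implicit Types (i j k x y z w : 'I_n) (s r : linord n) (t : tile R n).

(** The tiles are finitely many, so thresholds found for each of them have a
    common lower bound. *)
Lemma T_small (Q : tile R n -> R -> Prop) :
  (forall t, T t -> exists2 e0 : R, 0 < e0 & forall e : R, 0 < e < e0 -> Q t e) ->
  exists2 e0 : R, 0 < e0 & forall e : R, 0 < e < e0 -> forall t, T t -> Q t e.
Proof.
case: TP => /finite_seqP[l lT] _ _ h.
have h' t : t \in l -> exists2 e0 : R, 0 < e0 & forall e : R, 0 < e < e0 -> Q t e.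
  by move=> tl; apply: h; rewrite lT.
suff [e0 e00 he] : exists2 e0 : R, 0 < e0 & forall e : R, 0 < e < e0 -> forall t, t \in l -> Q t e.
  by exists e0 => // e ee t; rewrite lT => /= tl; apply: he.
elim: {lT} l h' => [|t l IH] hl; first by exists 1.
have [e1 e10 h1] := hl t (mem_head _ _).
have [|e2 e20 h2] := IH; first by move=> t' t'l; apply: hl; rewrite inE t'l orbT.
exists (Num.min e1 e2); first by rewrite lt_min e10.
move=> e /andP[e0]; rewrite lt_min => /andP[ee1 ee2] t'; rewrite inE => /orP[/eqP->|t'l].
  by apply: h1; rewrite e0.
by apply: h2 => //; rewrite e0.
Qed.

Lemma T_cover p : zonogon xi p -> exists2 t, T t & tile_points xi t p.
Proof. by case: TP => _ /(_ n1) <- _ [t tT tp]; exists t. Qed.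

Lemma T_zonogon t p : T t -> tile_points xi t p -> zonogon xi p.
Proof. by case: TP => _ /(_ n1) <- _ tT tp; exists t. Qed.

(** Coordinates in the frame of a tile. *)
Definition at_coords t p (a b : R) : Prop :=
  p = tile_bottom t + a *: xi (tile_i t) + b *: xi (tile_j t).

Lemma frame_inj i j (a b a' b' : R) : (i < j)%N ->
  a *: xi i + b *: xi j = a' *: xi i + b' *: xi j -> a = a' /\ b = b'.
Proof.
move=> ij e; have det := xi_det xiP ij.
have e1 : a * abscissa (xi i) + b * abscissa (xi j) = a' * abscissa (xi i) + b' * abscissa (xi j).
  by have := congr1 (@abscissa R) e; rewrite !absD !absZ.
have e2 : a * ordinate (xi i) + b * ordinate (xi j) = a' * ordinate (xi i) + b' * ordinate (xi j).
  by have := congr1 (@ordinate R) e; rewrite !ordD !ordZ.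
have d0 : abscissa (xi i) * ordinate (xi j) - ordinate (xi i) * abscissa (xi j) != 0 by rewrite lt_eqF.
split; apply: (mulIf d0).
  transitivity ((a * abscissa (xi i) + b * abscissa (xi j)) * ordinate (xi j) -
                (a * ordinate (xi i) + b * ordinate (xi j)) * abscissa (xi j)); first by ring.
  by rewrite e1 e2; ring.
transitivity ((a * ordinate (xi i) + b * ordinate (xi j)) * abscissa (xi i) -
              (a * abscissa (xi i) + b * abscissa (xi j)) * ordinate (xi i)); first by ring.
by rewrite e1 e2; ring.
Qed.

Lemma coords_inj t p a b a' b' : at_coords t p a b -> at_coords t p a' b' -> a = a' /\ b = b'.
Proof.
rewrite /at_coords => -> e; apply: (frame_inj (tile_lt t)).
by apply: (addrI (tile_bottom t)); rewrite !addrA.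
Qed.

Definition east : 'rV[R]_2 := \row_k (k == ord0)%:R.

Lemma abs_east : abscissa east = 1. Proof. by rewrite /abscissa mxE. Qed.
Lemma ord_east : ordinate east = 0. Proof. by rewrite /ordinate mxE. Qed.

Lemma east_frame i j : (i < j)%N ->
  exists m l : R, [/\ 0 < m, 0 < l & east = l *: xi j - m *: xi i].
Proof.
move=> ij; have det := xi_det xiP ij; have oi := xi_ord xiP i; have oj := xi_ord xiP j.
set D := ordinate (xi i) * abscissa (xi j) - abscissa (xi i) * ordinate (xi j).
have D0 : 0 < D by rewrite /D; lra.
exists (ordinate (xi j) / D), (ordinate (xi i) / D); split; try exact: divr_gt0.
have Dn : D != 0 by rewrite gt_eqF.
apply: vec_ext; rewrite -scaleNr ?absD ?ordD ?absZ ?ordZ ?abs_east ?ord_east.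
  by rewrite -[LHS](divff Dn) {1}/D; field.
by field.
Qed.

Lemma coords_ex t p : exists a b, at_coords t p a b.
Proof.
have [m [l [m0 l0 eE]]] := east_frame (tile_lt t).
have oi := xi_ord xiP (tile_i t).
suff [a [b e]] : exists a b, p - tile_bottom t = a *: xi (tile_i t) + b *: xi (tile_j t).
  by exists a, b; rewrite /at_coords -addrA -e addrC subrK.
move: (p - tile_bottom t) => v; pose c := ordinate v / ordinate (xi (tile_i t)).
pose a := abscissa v - c * abscissa (xi (tile_i t)).
have ve : v = c *: xi (tile_i t) + a *: east.
  apply: vec_ext; rewrite ?absD ?ordD ?absZ ?ordZ ?abs_east ?ord_east.
    by rewrite mulr1 /a addrC subrK.
  by rewrite mulr0 addr0 /c divfK // gt_eqF.
exists (c - a * m), (a * l); rewrite {1}ve eE.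
by rewrite scalerBr !scalerA scalerBl addrAC -addrA.
Qed.

(** The points slightly to the right of [p] belong to [t]: moving right decreases
    the first coordinate and increases the second one. *)
Definition opens_east t p : Prop :=
  exists a b, [/\ 0 < a <= 1, 0 <= b < 1 & at_coords t p a b].

Lemma opens_east_points t p : opens_east t p -> tile_points xi t p.
Proof.
move=> [a [b [/andP[a0 a1] /andP[b0 b1] e]]]; exists a, b.
by split=> //; apply/andP; split=> //; exact: ltW.
Qed.

Lemma coords_east t p a b : at_coords t p a b -> exists m l, [/\ 0 < m, 0 < l &
  forall e : R, at_coords t (p + e *: east) (a - e * m) (b + e * l)].
Proof.
move=> pe; have [m [l [m0 l0 eE]]] := east_frame (tile_lt t); exists m, l; split=> // e.
by apply: vec_ext; rewrite pe eE -scaleNr !(absD, ordD, absZ, ordZ); ring.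
Qed.

Lemma not_opens_east t p : ~ opens_east t p ->
  exists2 e0 : R, 0 < e0 & forall e : R, 0 < e < e0 -> ~ tile_points xi t (p + e *: east).
Proof.
move=> no; have [a [b pe]] := coords_ex t p.
have [m [l [m0 l0 he]]] := coords_east pe.
have out e : ~ (0 <= a - e * m <= 1 /\ 0 <= b + e * l <= 1) -> ~ tile_points xi t (p + e *: east).
  move=> nin [a' [b' [a01 b01 e']]]; apply: nin.
  by have [-> ->] := coords_inj (he e) e'.
have [a0|a0] := lerP a 0.
  exists 1 => // e /andP[e0 _]; apply: out => -[/andP[h _] _].
  by have := mulr_gt0 e0 m0; lra.
have [b1|b1] := lerP 1 b.
  exists 1 => // e /andP[e0 _]; apply: out => -[_ /andP[_ h]].
  by have := mulr_gt0 e0 l0; lra.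
have [a1|a1] := lerP a 1.
  have [b0|b0] := lerP 0 b.
    by case: no; exists a, b; rewrite a0 a1 b0 b1.
  exists (- b / l); first by apply: divr_gt0 => //; lra.
  move=> e /andP[e0]; rewrite ltr_pdivlMr // => h; apply: out => -[_ /andP[h' _]].
  by lra.
exists ((a - 1) / m); first by apply: divr_gt0 => //; lra.
move=> e /andP[e0]; rewrite ltr_pdivlMr // => h; apply: out => -[/andP[_ h'] _].
by lra.
Qed.

(** Finitely many tiles cover the points slightly to the right of [p], and each
    tile contains all of these points or none, close enough to [p]. *)
Lemma opens_east_ex p :
  (exists2 e0 : R, 0 < e0 & forall e : R, 0 < e < e0 -> zonogon xi (p + e *: east)) ->
  exists2 t, T t & opens_east t p.
Proof.
case=> e0 e00 h0; apply: contrapT => none.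
have [|e1 e10 h1] := @T_small (fun t e => ~ tile_points xi t (p + e *: east)).
  by move=> t tT; apply: not_opens_east => ot; apply: none; exists t.
pose e := Num.min e0 e1 / 2%:R.
have mm : 0 < Num.min e0 e1 by rewrite lt_min e00.
have e_gt0 : 0 < e by rewrite /e divr_gt0.
have lt_min' : e < Num.min e0 e1 by rewrite /e; lra.
have [ee0 ee1] : e < e0 /\ e < e1 by move: lt_min'; rewrite lt_min => /andP[].
have [|t tT tp] := @T_cover (p + e *: east); first by apply: h0; rewrite e_gt0.
by apply: (h1 e _ t tT tp); rewrite e_gt0.
Qed.

Lemma common_face t t' q : T t -> T t' -> t <> t' ->
  tile_points xi t q -> tile_points xi t' q ->
  (tile_vertex xi t q /\ tile_vertex xi t' q) \/
  exists v k c, [/\ tile_edge xi t v k, tile_edge xi t' v k, 0 <= c <= 1 & q = v + c *: xi k].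
Proof.
case: TP => _ _ face tT tT' ne tq tq'.
have Iq : (tile_points xi t `&` tile_points xi t')%classic q by [].
case: (face t t' tT tT' ne) => [I0|[v [tv tv' Iv]]|[v [k [te te' Ie]]]].
- by rewrite I0 in Iq.
- by left; move: Iq; rewrite Iv => ->.
- by right; move: Iq; rewrite Ie => -[c c01 ->]; exists v, k, c.
Qed.

Lemma vertex_coords t v : tile_vertex xi t v ->
  exists a b : bool, at_coords t v a%:R b%:R.
Proof.
rewrite /tile_vertex !inE /at_coords => /or4P[] /eqP->.
- by exists false, false; rewrite !scale0r !addr0.
- by exists true, false; rewrite scale0r scale1r addr0.
- by exists false, true; rewrite scale0r scale1r addr0.
- by exists true, true; rewrite !scale1r.
Qed.

Lemma edge_coords t v k c : tile_edge xi t v k -> exists a b,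
  at_coords t (v + c *: xi k) a b /\
  [\/ [/\ v = tile_bottom t, k = tile_i t, a = c & b = 0],
      [/\ v = tile_bottom t, k = tile_j t, a = 0 & b = c],
      [/\ v = tile_bottom t + xi (tile_i t), k = tile_j t, a = 1 & b = c] |
      [/\ v = tile_bottom t + xi (tile_j t), k = tile_i t, a = c & b = 1]].
Proof.
rewrite /tile_edge !inE /at_coords => /or4P[] /eqP[-> ->].
- by exists c, 0; split; [rewrite scale0r addr0|constructor 1].
- by exists 0, c; split; [rewrite scale0r addr0|constructor 2].
- by exists 1, c; split; [rewrite scale1r|constructor 3].
- by exists c, 1; split; [rewrite scale1r addrAC|constructor 4].
Qed.

(** A point common to two tiles lies on a vertex or an edge of each, where some
    coordinate is 0 or 1. *)
Lemma interior_unique t t' q a b : T t -> T t' -> at_coords t q a b ->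
  0 < a < 1 -> 0 < b < 1 -> tile_points xi t' q -> t = t'.
Proof.
move=> tT tT' qe /andP[a0 a1] /andP[b0 b1] tq'; apply: contrapT => ne.
have tq : tile_points xi t q.
  by exists a, b; split=> //; apply/andP; split; exact: ltW.
case: (common_face tT tT' ne tq tq') => [[/vertex_coords[a' [b' e]] _]|].
  have [ea _] := coords_inj qe e; move: a0 a1; rewrite ea; case: a' {e ea} => /=; lra.
move=> [v [k [c [te _ _ e]]]]; have [a' [b' [e' h]]] := edge_coords c te.
rewrite -e in e'; have [ea eb] := coords_inj qe e'.
by case: h => -[_ _ ea' eb']; lra.
Qed.

(** Slightly to the right of [p] both tiles have interior points. *)
Lemma opens_east_unique t t' p : T t -> T t' -> opens_east t p -> opens_east t' p -> t = t'.
Proof.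
move=> tT tT' [a [b [/andP[a0 a1] /andP[b0 b1] pe]]] [a' [b' [/andP[a0' a1'] /andP[b0' b1'] pe']]].
have [m [l [m0 l0 he]]] := coords_east pe; have [m' [l' [m0' l0' he']]] := coords_east pe'.
pose e := Num.min (Num.min (a / m) ((1 - b) / l)) (Num.min (a' / m') ((1 - b') / l')) / 2%:R.
set M := Num.min _ _ in e.
have M0 : 0 < M by rewrite !lt_min !divr_gt0 //; lra.
have e0 : 0 < e by rewrite /e; lra.
have : e < M by rewrite /e; lra.
rewrite !lt_min !ltr_pdivlMr // => /andP[/andP[h1 h2] /andP[h3 h4]].
have p1 := mulr_gt0 e0 m0; have p2 := mulr_gt0 e0 l0.
have p3 := mulr_gt0 e0 m0'; have p4 := mulr_gt0 e0 l0'.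
apply: (interior_unique tT tT' (he e)); try by apply/andP; split; lra.
by exists (a' - e * m'), (b' + e * l'); split; [apply/andP; split; lra|apply/andP; split; lra|exact: he'].
Qed.

(** Where two colors [lo < hi] can be exchanged in favor of [hi], the zonogon
    extends to the right. *)
Lemma room_east f (lo hi : 'I_n) : cube f -> (lo < hi)%N -> 0 < f lo -> f hi < 1 ->
  exists2 e0 : R, 0 < e0 & forall e : R, 0 < e < e0 -> zonogon xi (pt xi f + e *: east).
Proof.
move=> fc lh flo fhi; have [m [l [m0 l0 eE]]] := east_frame lh.
exists (Num.min (f lo / m) ((1 - f hi) / l)).
  by rewrite lt_min !divr_gt0 // subr_gt0.
move=> e /andP[e0]; rewrite lt_min !ltr_pdivlMr // => /andP[h1 h2].
have p1 := mulr_gt0 e0 m0; have p2 := mulr_gt0 e0 l0.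
pose g i := f i + ((e * l) * (i == hi)%:R + (- (e * m)) * (i == lo)%:R).
exists g; last first.
  rewrite -/(pt xi g) ptD ptD !ptZ !pt_delta eE scalerBr !scalerA.
  by rewrite scaleNr.
have nlh : (lo == hi) = false by rewrite -val_eqE ltn_eqF.
move=> i; have /andP[fi0 fi1] := fc i; rewrite /g.
have [->|nh] := eqVneq i hi.
  by have /andP[? ?] := fc hi; rewrite eq_sym nlh /= mulr1 mulr0; apply/andP; split; lra.
have [->|nl] := eqVneq i lo.
  by have /andP[? ?] := fc lo; rewrite /= mulr1 mulr0; apply/andP; split; lra.
by rewrite /= !mulr0 !addr0 fi0 fi1.
Qed.

Definition upset A : Prop := forall i j, (i < j)%N -> i \in A -> j \in A.

(** At an end point [vx A] of the right boundary [leaning] bounds the abscissa of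
    all points of the zonogon on the same level. *)
Lemma upset_boundary t A : T t -> opens_east t (vx xi A) -> ~ upset A.
Proof.
move=> tT [a [b [/andP[a0 a1] /andP[b0 b1] pe]]] up.
have [m [l [m0 l0 he]]] := coords_east pe.
pose M := Num.min (a / m) ((1 - b) / l); pose e := M / 2%:R.
have M0 : 0 < M by rewrite !lt_min !divr_gt0 //; lra.
have e0 : 0 < e by rewrite /e; lra.
have : e < M by rewrite /e; lra.
rewrite !lt_min !ltr_pdivlMr // => /andP[h1 h2].
have p1 := mulr_gt0 e0 m0; have p2 := mulr_gt0 e0 l0.
have [|g gc gE] := @T_zonogon t (vx xi A + e *: east) tT.
  by exists (a - e * m), (b + e * l); split; [apply/andP; split; lra|apply/andP; split; lra|exact: he].
rewrite -/(pt xi g) in gE.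
have [k lo hi] : exists2 k : 'I_n, forall i, (i < k)%N -> i \notin A & forall i, (k < i)%N -> i \in A.
  case: (set_0Vmem A) => [->|[i0 i0A]].
    have nlt : (n.-1 < n)%N by rewrite prednK // ltnW.
    exists (Ordinal nlt) => i /=; first by rewrite inE.
    by rewrite ltnNge -ltnS prednK ?ltn_ord // ltnW.
  case: (@arg_minnP _ i0 (fun i => i \in A) (fun i => i : nat) i0A) => k kA kmin.
  exists k => i ik; last exact: up ik kA.
  by apply/negP => /kmin; rewrite leqNgt ik.
have [i ik|i ki||h _] := @leaning _ _ _ xiP (fun i => ind R A i - g i) k.
- by have /andP[g0 _] := gc i; rewrite /ind (negbTE (lo i ik)) sub0r oppr_le0.
- by have /andP[_ g1] := gc i; rewrite /ind (hi i ki) subr_ge0.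
- by rewrite ptB ordD -scaleN1r ordZ mulN1r -gE -vxE ordD ordZ ord_east; ring.
- move: h; rewrite ptB absD -scaleN1r absZ mulN1r -gE -vxE absD absZ abs_east.
  by lra.
Qed.

(** The path of [s] consists of edges of the left boundary and of upper right
    or lower right edges of tiles. *)
Definition swept s : Prop := forall k, bef s k = bef (alpha n) k \/
  exists2 t, T t & (tile_j t = k /\ tile_bottom t = vx xi (bef s k)) \/
                   (tile_i t = k /\ tile_bottom t + xi (tile_j t) = vx xi (bef s k)).

Definition lower s k : Prop :=
  exists2 t, T t & tile_i t = k /\ tile_bottom t = vx xi (bef s k).
Definition upper s k : Prop :=
  exists2 t, T t & tile_j t = k /\ tile_bottom t + xi (tile_i t) = vx xi (bef s k).

(** The vertex between the two left edges has coordinates 1 and 0. *)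
Lemma left_vertex_opens t : opens_east t (tile_bottom t + xi (tile_i t)).
Proof.
exists 1, 0; rewrite /at_coords scale1r scale0r addr0.
by split=> //; rewrite ?ltr01 ?lexx.
Qed.

(** Supporting functional of the left boundary edge of color [k]. *)
Definition slope k v : R := abscissa v * ordinate (xi k) - ordinate v * abscissa (xi k).

Lemma slopeD k v v' : slope k (v + v') = slope k v + slope k v'.
Proof. by rewrite /slope absD ordD; ring. Qed.

Lemma slopeZ k (a : R) v : slope k (a *: v) = a * slope k v.
Proof. by rewrite /slope absZ ordZ; ring. Qed.

Lemma slope_lt i k : (i < k)%N -> slope k (xi i) < 0.
Proof. by move=> /(xi_det xiP). Qed.

Lemma slope_gt i k : (k < i)%N -> 0 < slope k (xi i).
Proof. by move=> /(xi_det xiP); rewrite /slope; lra. Qed.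

Lemma slope_self k : slope k (xi k) = 0.
Proof. by rewrite /slope; ring. Qed.

Lemma slope_pt k f : slope k (pt xi f) = \sum_i f i * slope k (xi i).
Proof.
rewrite /slope abs_pt ord_pt !mulr_suml -sumrB; apply: eq_bigr => i _; ring.
Qed.

(** The functional is negative on the colors before [k] and positive on those
    after [k], so its minimum on the zonogon is reached exactly on the boundary
    edge of color [k]. *)
Lemma slope_zonogon k p : zonogon xi p ->
  slope k (vx xi (bef (alpha n) k)) <= slope k p /\
  (slope k p <= slope k (vx xi (bef (alpha n) k)) ->
   exists2 c : R, 0 <= c <= 1 & p = vx xi (bef (alpha n) k) + c *: xi k).
Proof.
case=> g gc; rewrite -/(pt xi g) => pE; set A := bef _ k.
have inA i : (i \in A) = (i < k)%N by rewrite in_bef before_alpha.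
pose F i := (g i - ind R A i) * slope k (xi i).
have FE : slope k p - slope k (vx xi A) = \sum_i F i.
  by rewrite pE vxE !slope_pt -sumrB; apply: eq_bigr => i _; rewrite /F mulrBl.
have F0 i : 0 <= F i.
  have /andP[g0 g1] := gc i; rewrite /F /ind inA; case: (ltngtP i k) => [ik|ki|/val_inj->].
  - by apply: mulr_le0; [rewrite subr_le0|exact: ltW (slope_lt ik)].
  - by apply: mulr_ge0; [rewrite subr0|exact: ltW (slope_gt ki)].
  - by rewrite slope_self mulr0.
split; first by rewrite -subr_ge0 FE sumr_ge0.
move=> le; have S0 : \sum_i F i = 0.
  by apply: le_anti; rewrite sumr_ge0 ?andbT // -FE subr_le0.
have Fz i : i != k -> g i = ind R A i.
  move=> ik; have /(_ i isT)/eqP := psumr_eq0P (fun j _ => F0 j) S0.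
  rewrite /F mulf_eq0 subr_eq0 => /orP[/eqP//|/eqP e]; exfalso.
  case: (ltngtP i k) => [lt|gt|/val_inj e']; last by rewrite e' eqxx in ik.
    by have := slope_lt lt; rewrite e ltxx.
  by have := slope_gt gt; rewrite e ltxx.
exists (g k) => //; rewrite pE vxE -(pt_delta xi k) -ptZ -ptD; apply: pt_ext => i.
have [->|ik] := eqVneq i k; first by rewrite /ind inA ltnn mulr1 add0r.
by rewrite Fz // mulr0 addr0.
Qed.

(** On an edge of the left boundary choose a point which is not the left vertex
    of a tile. A tile that opens to the right at this point lies on one side of
    the supporting line and can then touch it only along an edge of color [k];
    this edge is a segment of the line inside the zonogon of the same length as
    the boundary edge. *)
Lemma boundary_tile s k : bef s k = bef (alpha n) k ->
  (forall c : R, 0 < c < 1 -> exists2 e0 : R, 0 < e0 &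
     forall e : R, 0 < e < e0 -> zonogon xi (vx xi (bef s k) + c *: xi k + e *: east)) ->
  lower s k \/ upper s k.
Proof.
move=> ea room; set v := vx xi (bef s k).
have [|e0 e00 avoid] := @T_small (fun t c => v + c *: xi k <> tile_bottom t + xi (tile_i t)).
  move=> t _; case: (pselect (exists2 c, 0 < c & v + c *: xi k = tile_bottom t + xi (tile_i t))).
    move=> [c c0 ec]; exists c => // c' /andP[_ lt] e'.
    have : c *: xi k = c' *: xi k by apply: (addrI v); rewrite ec e'.
    move/(congr1 (@ordinate R)); rewrite !ordZ => /(mulIf (lt0r_neq0 (xi_ord xiP k))) ecc.
    by rewrite ecc ltxx in lt.
  by move=> none; exists 1 => // c /andP[c0 _] ec; apply: none; exists c.
pose c := Num.min e0 1 / 2%:R.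
have m0 : 0 < Num.min e0 1 by rewrite lt_min e00 ltr01.
have c0 : 0 < c by rewrite /c; lra.
have : c < Num.min e0 1 by rewrite /c; lra.
rewrite lt_min => /andP[ce0 c1].
have [|t tT [a [b [/andP[a0 a1] /andP[b0 b1] pe]]]] := @opens_east_ex (v + c *: xi k).
  by apply: room; rewrite c0.
have nleft : v + c *: xi k <> tile_bottom t + xi (tile_i t) by apply: avoid => //; rewrite c0.
set i := tile_i t in pe nleft *; set j := tile_j t in pe *; have ij : (i < j)%N := tile_lt t.
set be := tile_bottom t in pe nleft.
have corner (a' b' : bool) : zonogon xi (be + a'%:R *: xi i + b'%:R *: xi j).
  apply: (T_zonogon tT); exists a'%:R, b'%:R; split=> //.
    by case: a'; rewrite ?ler01 ?lexx.
  by case: b'; rewrite ?ler01 ?lexx.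
have low q : zonogon xi q -> slope k v <= slope k q.
  by move/(slope_zonogon k) => [+ _]; rewrite -ea.
have on q : zonogon xi q -> slope k q <= slope k v -> exists2 c' : R, 0 <= c' <= 1 & q = v + c' *: xi k.
  by move/(slope_zonogon k) => [_]; rewrite -ea.
have sE : slope k v = slope k be + a * slope k (xi i) + b * slope k (xi j).
  have := congr1 (slope k) pe; rewrite !slopeD !slopeZ slope_self mulr0 addr0 => ->.
  by [].
have s00 : slope k v <= slope k be.
  by have := low _ (corner false false); rewrite !scale0r !addr0.
have s10 : slope k v <= slope k be + slope k (xi i).
  by have := low _ (corner true false); rewrite scale1r scale0r addr0 slopeD.
have s11 : slope k v <= slope k be + slope k (xi i) + slope k (xi j).
  by have := low _ (corner true true); rewrite !scale1r !slopeD.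
(* an edge of color k on the supporting line is the boundary edge *)
have edge q : zonogon xi q -> zonogon xi (q + xi k) -> slope k q <= slope k v -> q = v.
  move=> qZ qZ' qs; have [c1' /andP[h1 h2] eq1] := on q qZ qs.
  have [|c2' /andP[h3 h4] eq2] := on _ qZ'; first by rewrite slopeD slope_self addr0.
  have : (c1' + 1) *: xi k = c2' *: xi k.
    by apply: (addrI v); rewrite -eq2 eq1 scalerDl scale1r addrA.
  move/(congr1 (@ordinate R)); rewrite !ordZ => /(mulIf (lt0r_neq0 (xi_ord xiP k))) h.
  have c10 : c1' = 0 by lra.
  by rewrite eq1 c10 scale0r addr0.
have [ki|ki] := eqVneq k i.
  left; exists t => //; split=> //; have sj : 0 < slope k (xi j) by apply: slope_gt; rewrite ki.
  apply: edge.
  - by have := corner false false; rewrite !scale0r !addr0.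
  - by have := corner true false; rewrite scale1r scale0r addr0 ki.
  - rewrite -ki slope_self mulr0 addr0 in sE.
    by have := mulr_ge0 b0 (ltW sj); lra.
have [kj|kj] := eqVneq k j.
  right; exists t => //; split=> //; have si : slope k (xi i) < 0 by apply: slope_lt; rewrite kj.
  apply: edge.
  - by have := corner true false; rewrite scale1r scale0r addr0.
  - by have := corner true true; rewrite !scale1r kj.
  - rewrite -kj slope_self mulr0 addr0 in sE; rewrite slopeD.
    have : 0 <= (a - 1) * slope k (xi i) by apply: mulr_le0; [lra|exact: ltW].
    by lra.
exfalso; case: (ltngtP k i) => [lt|gt|/val_inj e]; last by rewrite e eqxx in ki.
  have si := slope_gt lt; have sj := slope_gt (ltn_trans lt ij).
  by have := mulr_gt0 a0 si; have := mulr_ge0 b0 (ltW sj); lra.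
have si := slope_lt gt; case: (ltngtP k j) => [lt'|gt'|/val_inj e]; last by rewrite e eqxx in kj.
  have sj := slope_gt lt'.
  have h1 : 0 <= (a - 1) * slope k (xi i) by apply: mulr_le0; [lra|exact: ltW].
  have h2 := mulr_ge0 b0 (ltW sj).
  have h3 : (a - 1) * slope k (xi i) = 0 by lra.
  have h4 : b * slope k (xi j) = 0 by lra.
  move/eqP: h3; rewrite mulf_eq0 (negbTE (ltr0_neq0 si)) orbF subr_eq0 => /eqP ea1.
  move/eqP: h4; rewrite mulf_eq0 (negbTE (lt0r_neq0 sj)) orbF => /eqP eb0.
  by apply: nleft; rewrite pe ea1 eb0 scale1r scale0r addr0.
have sj := slope_lt gt'.
have h1 : 0 <= (a - 1) * slope k (xi i) by apply: mulr_le0; [lra|exact: ltW].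
have h2 : 0 < (b - 1) * slope k (xi j) by rewrite nmulr_lgt0 //; lra.
by move: h1 h2 s11 sE; lra.
Qed.

(** Off the left boundary the edge is a right edge of a tile; the tile that
    opens to the right at its midpoint shares this edge with it, because tiles
    meet face to face. *)
Lemma right_tile s k : swept s -> bef s k <> bef (omega n) k -> lower s k \/ upper s k.
Proof.
move=> sw ne.
have room (c : R) : 0 < c < 1 -> exists2 e0 : R, 0 < e0 &
    forall e : R, 0 < e < e0 -> zonogon xi (vx xi (bef s k) + c *: xi k + e *: east).
  move=> /andP[c0 c1]; pose f i := ind R (bef s k) i + c * (i == k)%:R.
  have nk := bef_notin s k.
  have fk : f k = c by rewrite /f /ind (negbTE nk) eqxx mulr1 add0r.
  have fi i : i != k -> f i = (i \in bef s k)%:R.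
    by move=> ik; rewrite /f /ind (negbTE ik) mulr0 addr0.
  have fc : cube f.
    move=> i; have [->|ik] := eqVneq i k; first by rewrite fk !ltW.
    by rewrite fi //; case: (i \in _); rewrite ler01 lexx.
  have -> : vx xi (bef s k) + c *: xi k = pt xi f by rewrite ptD ptZ pt_delta vxE.
  have [i ik dif] : exists2 i, i != k & (i \in bef s k) != (k < i)%N.
    apply: contrapT => none; apply: ne; apply/setP => i; rewrite [RHS]in_bef before_omega.
    have [->|ik] := eqVneq i k; first by rewrite (negbTE nk) ltnn.
    by apply/eqP; apply: contraT => h; case: none; exists i.
  case: (ltngtP k i) dif => [lt|gt|/val_inj e] dif; last by rewrite e eqxx in ik.
    by apply: (room_east fc lt); rewrite ?fk // fi //; case: (i \in _) dif; rewrite ?ltr01.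
  by apply: (room_east fc gt); rewrite ?fk // fi //; case: (i \in _) dif; rewrite ?ltr01.
case: (sw k) => [ea|[t' tT' h']]; first exact: boundary_tile.
set v := vx xi (bef s k) in h' *.
pose p := v + (1 / 2%:R) *: xi k.
have [|t tT ot] := @opens_east_ex p; first by apply: room; apply/andP; split; lra.
have half01 : 0 <= (1 / 2%:R : R) <= 1 by apply/andP; split; lra.
(* the coordinates of p in the tile on the left *)
have [a' [b' [pe' ab]]] : exists a' b', at_coords t' p a' b' /\
    ([/\ tile_j t' = k, tile_bottom t' = v, a' = 0 & b' = 1 / 2%:R] \/
     [/\ tile_i t' = k, tile_bottom t' + xi (tile_j t') = v, a' = 1 / 2%:R & b' = 1]).
  case: h' => -[ek ev].
    by exists 0, (1 / 2%:R); rewrite /at_coords /p -ev ek scale0r addr0; split=> //; left.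
  exists (1 / 2%:R), 1; rewrite /at_coords /p -ev ek scale1r addrAC; split=> //; by right.
have ntt : t <> t'.
  move=> ett; move: ot; rewrite ett => -[a [b [/andP[a0 _] /andP[_ b1] pe]]].
  have [ea eb] := coords_inj pe pe'; case: ab => -[_ _ ha hb]; move: a0 b1;
    by rewrite ea eb ha hb ?ltxx.
have tp' : tile_points xi t' p.
  by case: ab => -[_ _ ha hb]; exists a', b'; split=> //; rewrite ?ha ?hb ?lexx ?ler01.
case: (common_face tT tT' ntt (opens_east_points ot) tp') => [[_ /vertex_coords[a [b pe]]]|].
  have [ea eb] := coords_inj pe pe'; exfalso.
  case: ab => -[_ _ ha hb]; move: ea eb; rewrite ha hb; case: a pe; case: b => /= _; lra.
move=> [v1 [k1 [c [te te' c01 pE]]]].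
have [ev ek] : v1 = v /\ k1 = k.
  have [a1 [b1 [pe1 cases]]] := edge_coords c te'; rewrite -pE in pe1.
  have [ea eb] := coords_inj pe1 pe'.
  case: ab => -[hk hv ha hb]; case: cases => -[e1 e2 e3 e4]; try (by rewrite e1 e2);
    by exfalso; move: ea eb; rewrite ha hb e3 e4; lra.
move: te; rewrite ev ek in pE * => te.
have [a1 [b1 [pe1 cases]]] := edge_coords c te; rewrite -pE in pe1.
case: ot => a [b [/andP[a0 _] /andP[_ b1'] pe]]; have [ea eb] := coords_inj pe pe1.
case: cases => -[e1 e2 e3 e4].
- by left; exists t.
- by exfalso; move: a0; rewrite ea e3 ltxx.
- by right; exists t.
- by exfalso; move: b1'; rewrite eb e4 ltxx.
Qed.

(** As long as the path is not the right boundary, some tile has its two left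
    edges on it: the last step which is a lower left edge of a tile is followed
    by an upper left edge, and the two tiles, which open to the right at the
    same vertex, coincide. *)
Lemma sweep_flip s : swept s -> s <> omega n ->
  exists r x y, [/\ swept r, flip s r x y &
    exists2 t, T t & [/\ tile_i t = x, tile_j t = y & tile_bottom t = vx xi (bef s x)]].
Proof.
move=> sw so; pose pos k : nat := (s^-1)%g k.
have posE x y : before s x y = (pos x < pos y)%N by [].
have lower_up k : lower s k -> ~ upset (k |: bef s k).
  move=> [t tT [ek ev]]; apply: (upset_boundary tT).
  by rewrite vxU1 ?bef_notin // -ev -ek; apply: left_vertex_opens.
have upper_up k : upper s k -> ~ upset (bef s k).
  by move=> [t tT [ek ev]]; apply: (upset_boundary tT); rewrite -ev; apply: left_vertex_opens.
have bo k i : (i \in bef (omega n) k) = (k < i)%N by rewrite in_bef before_omega.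
have [k0 k0L] : exists k, lower s k.
  have [k1 nk1] : exists k, bef s k != bef (omega n) k.
    apply: contrapT => none; apply: so; apply: before_inj => x y.
    have : bef s y = bef (omega n) y.
      by apply/eqP; apply: contraT => h; case: none; exists y.
    by move/setP/(_ x); rewrite !in_bef.
  case: (@arg_minnP _ k1 (fun k => bef s k != bef (omega n) k) pos nk1) => k nk kmin.
  exists k; case: (right_tile sw (elimN eqP nk)) => // /upper_up[] i j ij.
  rewrite !in_bef !posE => ik; have /eqP/setP/(_ j) : bef s i == bef (omega n) i.
    by apply: contraT => /kmin; rewrite leqNgt ik.
  by rewrite bo ij in_bef posE => /ltn_trans; apply.
have k0B : `[< lower s k0 >] by apply/asboolP.
case: (@arg_maxnP _ k0 (fun k => `[< lower s k >]) pos k0B) => k /asboolP kL kmax.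
have [z zk sz] : exists2 z, z \notin k |: bef s k & initial s (z |: (k |: bef s k)).
  have [y yk] : exists y, y \notin k |: bef s k.
    apply: contrapT => none; apply: (lower_up k kL) => i j _ _.
    by apply: contraT => h; case: none; exists j.
  exact: initial_next (@initial_bef1 _ s k) yk.
have bz : bef s z = k |: bef s k.
  apply/setP => w; rewrite in_bef; apply/idP/idP => [wz|wk].
    apply: contraT => wk; have wz' := before_neq wz.
    have := sz z w (setU11 _ _); rewrite in_setU1 negb_or wz' wk => /(_ isT)/before_asym.
    by rewrite wz.
  exact: (@initial_bef1 _ s k).
have kz : before s k z by rewrite -in_bef bz setU11.
have zo : bef s z <> bef (omega n) z.
  move=> e; apply: (lower_up k kL); rewrite -bz e => i j ij; rewrite !bo.
  by move=> h; apply: ltn_trans h ij.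
have [t tT [ek ev]] := kL.
have [t' tT' [ez ev']] : upper s z.
  case: (right_tile sw zo) => // zL; exfalso.
  have /kmax : `[< lower s z >] by apply/asboolP.
  by rewrite /= leqNgt -posE kz.
have ett : t = t'.
  apply: (opens_east_unique (p := vx xi (bef s z)) tT tT').
    by rewrite bz vxU1 ?bef_notin // -ev -ek; apply: left_vertex_opens.
  by rewrite -ev'; apply: left_vertex_opens.
subst t'; have kz' : (k < z)%N by rewrite -ek -ez; apply: tile_lt.
have [r f] : exists r, flip s r k z.
  apply: flip_adjacent => // w [kw]; rewrite -in_bef bz in_setU1 in_bef.
  by case/orP=> [/eqP e|wk]; [rewrite e before_irr in kw|rewrite (before_asym wk) in kw].
have [_ h2 h3] := flip_bef f.
exists r, k, z; split=> //; last by exists t.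
move=> x; have [->|xk] := eqVneq x k.
  right; exists t => //; right; split=> //; rewrite h3 vxU1 ?ev ?ez //.
  by apply: contra zk => zs; rewrite in_setU1 zs orbT.
have [->|xz] := eqVneq x z.
  by right; exists t => //; left; rewrite h2.
by rewrite (flip_bef_other f xk xz); apply: sw.
Qed.

(** Sweeping yields a flag whose tiles all belong to the tiling; as the tiles of
    its casting cover the zonogon, the center of any other tile would lie in one
    of them. *)
Lemma tiling_casting : exists2 u, realizable u & T = casting_tiles xi u.
Proof.
have [C fC CP] := @climb n swept _ sweep_flip (fun k => or_introl erefl).
have Cu := flag_sub_cup fC; have ru := flag_realizable fC Cu.
exists (cup C) => //; have Cu' := fintype.subsetP Cu.
have sub t : casting_tiles xi (cup C) t -> T t.
  move=> tu; have [s [r [sC rC f [t0 t0T [ei ej eb]]]]] := flag_step fC (tile_lt t).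
  suff -> : t = t0 by [].
  apply: tile_ext => //; rewrite (tu : _ = _) eb.
  by rewrite (base_flip (Cu' _ sC) (Cu' _ rC) f).
apply/predeqP => t; split=> [tT|]; last exact: sub.
pose q := tile_bottom t + (1 / 2%:R) *: xi (tile_i t) + (1 / 2%:R) *: xi (tile_j t).
have h1 : 0 < (1 / 2%:R : R) < 1 by apply/andP; split; lra.
have h2 : 0 <= (1 / 2%:R : R) <= 1 by apply/andP; split; lra.
have tq : tile_points xi t q by exists (1 / 2%:R), (1 / 2%:R).
have [_ /(_ n1) cov _] := casting_tiling xiP ru.
have : zonogon xi q := T_zonogon tT tq.
rewrite -cov => -[t' tu' tq'].
by rewrite (interior_unique tT (sub _ tu') (erefl : at_coords t q _ _) h1 h1 tq').
Qed.
End CastingOfTiling.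

(** * The characterizations agree *)

Section TilingType.
Variables (R : realType) (n : nat) (xi : 'I_n -> 'rV[R]_2).
Hypothesis xiP : zonogon_vectors xi.
Hypothesis n_gt0 : (1 <= n)%N.

(** For [n = 1] the unique order is the unique snake, whatever the tiling. *)
Lemma tiling_type_realized (X : {set linord n}) : tiling_type xi X <-> realized X.
Proof.
have [n1|n1] := ltnP 1 n.
  split=> [[T TP XT]|[u ru ->]].
    have [u ru eT] := tiling_casting xiP n1 TP; exists u => //; apply/setP => s.
    by apply/idP/idP => [/XT/snakeP|/(path_cdom xiP ru s n1) h];
      [rewrite eT => /(path_cdom xiP ru s n1)|apply/XT/snakeP; rewrite eT].
  exists (casting_tiles xi u); first exact: casting_tiling.
  by move=> s; apply: iff_trans (iff_sym (path_cdom xiP ru s n1)) (iff_sym (snakeP _ _ s)).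
have en : n = 1%N by apply/eqP; rewrite eqn_leq n1.
have one (i j : 'I_n) : i = j.
  have z (k : 'I_n) : val k = 0%N.
    by apply/eqP; rewrite -leqn0 -ltnS; apply: leq_trans (ltn_ord k) n1.
  by apply: val_inj; rewrite !z.
have all_snake (T : set (tile R n)) s : snake xi T (word s).
  apply/snakeP => k; right; split=> //; rewrite -(vx0 xi); congr (vx xi _).
  by apply/setP => z; rewrite in_bef (one z k) before_irr inE.
have all_dom u (s : linord n) : s \in cdom u.
  by apply/cdomP => i j k; rewrite (one i j) ltnn.
pose u0 (i j k : 'I_n) := true.
have ru0 : @realizable n u0 by exists (fun _ _ => 0%N) => i j k; rewrite (one i j) ltnn.
split=> [[T TP XT]|[u ru ->]].
  by exists u0 => //; apply/setP => s; rewrite all_dom; apply/XT; apply: all_snake.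
exists classical_sets.set0; last by move=> s; split=> // _; apply: all_dom.
by split=> //; rewrite ltnNge n1.
Qed.
End TilingType.

Theorem mainTheorem3 (R : realType) (n : nat) (xi : 'I_n -> 'rV[R]_2)
    (n_ge1 : (1 <= n)%N) (xiP : zonogon_vectors xi) (X : {set linord n}) :
  [<-> A_domain X;
       GR_domain X;
       inclusion_maximal (@distributive_covering_sublattice n) X;
       inclusion_maximal (@peak_pit n) X;
       tiling_type xi X].
Proof.
tfae.
- by move=> /A_domainP/GR_domainP.
- by move=> /GR_domainP/dcs_realized.
- by move=> /dcs_realized/peak_pit_realized.
- by move=> /peak_pit_realized/(tiling_type_realized xiP n_ge1).
- by move=> /(tiling_type_realized xiP n_ge1)/A_domainP.
Qed.
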